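(* For every positive rational number $x$, the value $F(x)-F(1)$ is a rational linear combination of values $\mathrm{Li}_2(\alpha)$ with arguments $\alpha$ belonging to the cyclotomic field $\mathbb{Q}(e^{2\pi i x},e^{2\pi i/x})$.
   Context: Let $\psi=\Gamma'/\Gamma$ be the digamma function and $F(x)=\sum_{n\ge1}\frac{\psi(nx)-\log(nx)}{n}$ for $x\in\mathbb{C}\setminus(-\infty,0]$. $\mathrm{Li}_2$ denotes Euler's dilogarithm (principal branch, analytically continued from $\sum_{k\ge1}z^k/k^2$). *)

(* Defs.v *)
From Stdlib Require Import Reals QArith Qreals List Factorial Lra Lia.
From Coquelicot Require Import Coquelicot.

Open Scope R_scope.
Open Scope C_scope.

Definition Clim (F : (C -> Prop) -> Prop) : C :=
  @lim C_CompleteNormedModule F.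

Lemma Clim_unique (T : Type) (F : (T -> Prop) -> Prop) (f : T -> C) (l : C) :
  ProperFilter F ->
  filterlim f F (@locally C_UniformSpace l) -> Clim (filtermap f F) = l.
Proof.
intros FF Hf.
assert (FF' : ProperFilter (filtermap f F)) by now apply filtermap_proper_filter.
apply (@is_filter_lim_unique R_AbsRing C_R_NormedModule (filtermap f F)).
- apply Proper_StrongProper, FF'.
- intros P [eps HP].
  apply filter_imp with (1 := HP).
  apply (@complete_cauchy C_CompleteNormedModule (filtermap f F)); try easy.
  intros e. exists l.
  exact (Hf _ (locally_ball l e)).
- exact Hf.
Qed.

Definition Cseries (a : nat -> C) : C :=
  Clim (filtermap (fun N => @sum_n C_AbelianMonoid a N) eventually).

Definition Cexp (z : C) : C :=
  (exp (Re z) * cos (Im z), exp (Re z) * sin (Im z))%R.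

(* Principal value in (-PI, PI]; off the negative real axis this is the
   half-angle formula  tan (arg z / 2) = Im z / (|z| + Re z). *)
Definition Carg (z : C) : R :=
  if Req_EM_T (Im z) 0 then (if Rlt_dec (Re z) 0 then PI else 0%R)
  else (2 * atan (Im z / (Cmod z + Re z)))%R.

Definition Clog (z : C) : C := (ln (Cmod z), Carg z).

Fixpoint Crising (z : C) (n : nat) : C :=
  match n with
  | O => 1
  | S m => Crising z m * (z + INR m)
  end.

(* Gauss: Gamma z = lim n! n^z / (z (z+1) ... (z+n)), for every z that is not
   a non-positive integer. *)
Definition Gamma (z : C) : C :=
  Clim (filtermap
    (fun n : nat => INR (fact n) * Cexp (z * ln (INR n)) / Crising z (S n))
    eventually).

Definition digamma (z : C) : C := C_derive Gamma z / Gamma z.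

Definition Herglotz_F (x : C) : C :=
  Cseries (fun k : nat =>
    (digamma (INR (S k) * x) - Clog (INR (S k) * x)) / INR (S k)).

Definition on_cut (z : C) : Prop := Im z = 0%R /\ 1 <= Re z.

Definition on_cut_dec (z : C) : {on_cut z} + {~ on_cut z}.
Proof.
destruct (Req_EM_T (Im z) 0) as [Hi|Hi].
- destruct (Rle_dec 1 (Re z)) as [Hr|Hr].
  + left; split; assumption.
  + right; intros [_ H]; contradiction.
- right; intros [H _]; contradiction.
Defined.

(* - int_0^z Log (1 - u) du / u  along the segment u = t z. *)
Definition Li2_slit (z : C) : C :=
  @RInt C_R_CompleteNormedModule (fun t : R => - Clog (1 - t * z) / t) 0 1.

(* On the cut [1, +oo) the principal branch is taken continuous from below,
   as results from Arg in (-PI, PI] in the integrand; this includes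
   Li2 1 = PI^2/6.  Off the cut, Li2_series and Li2_holomorphic below identify
   Li2 as the analytic continuation of sum_k z^k / k^2. *)
Definition Li2 (z : C) : C :=
  if on_cut_dec z
  then Clim (filtermap (fun e : R => Li2_slit (z - e * Ci)) (at_right 0))
  else Li2_slit z.

(* The subfield Q(S) of C. *)
Inductive Qadjoin (S : C -> Prop) : C -> Prop :=
| Qadjoin_gen z : S z -> Qadjoin S z
| Qadjoin_1 : Qadjoin S 1
| Qadjoin_add z w : Qadjoin S z -> Qadjoin S w -> Qadjoin S (z + w)
| Qadjoin_opp z : Qadjoin S z -> Qadjoin S (- z)
| Qadjoin_mul z w : Qadjoin S z -> Qadjoin S w -> Qadjoin S (z * w)
| Qadjoin_inv z : z <> 0 -> Qadjoin S z -> Qadjoin S (/ z).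

Definition Qspan (S : C -> Prop) (v : C) : Prop :=
  exists l : list (Q * C),
    List.Forall (fun p => S (snd p)) l /\
    v = fold_right (fun p s => Q2R (fst p) * snd p + s) 0 l.

Local Ltac eqR := match goal with |- @eq _ ?a ?b => change (@eq R a b) end.
Local Ltac eqC := match goal with |- @eq _ ?a ?b => change (@eq C a b) end.

Lemma Cmod_plus_Re_gt0 (z : C) :
  ~ (Im z = 0%R /\ Re z <= 0) -> (0 < Cmod z + Re z)%R.
Proof.
destruct z as [u v]; unfold Cmod, Re, Im; simpl fst; simpl snd; intros H.
assert (Hs := sqrt_pos (u ^ 2 + v ^ 2)).
assert (Hs2 := sqrt_sqrt (u ^ 2 + v ^ 2) ltac:(nra)).
destruct (Rlt_dec 0 u) as [Hu|Hu]; [lra|].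
assert (Hv : (0 < v ^ 2)%R).
{ apply pow2_gt_0. intros Hv; apply H; lra. }
nra.
Qed.

Lemma Carg_half_angle (z : C) :
  ~ (Im z = 0%R /\ Re z <= 0) ->
  Carg z = (2 * atan (Im z / (Cmod z + Re z)))%R.
Proof.
intros H; unfold Carg.
destruct (Req_EM_T (Im z) 0) as [Hi|Hi]; [|easy].
destruct (Rlt_dec (Re z) 0) as [Hr|Hr]; [exfalso; apply H; lra|].
rewrite Hi; unfold Rdiv; rewrite Rmult_0_l, atan_0; lra.
Qed.

Lemma Carg_bound (z : C) : (- PI < Carg z <= PI)%R.
Proof.
unfold Carg; assert (HP := PI_RGT_0).
destruct (Req_EM_T (Im z) 0) as [Hi|Hi].
- destruct (Rlt_dec (Re z) 0); lra.
- assert (Ha := atan_bound (Im z / (Cmod z + Re z))); lra.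
Qed.

Lemma Cexp_Clog (z : C) : z <> 0 -> Cexp (Clog z) = z.
Proof.
intros Hz.
assert (Hm : (0 < Cmod z)%R) by now apply Cmod_gt_0.
unfold Cexp, Clog; simpl Re; simpl Im; rewrite exp_ln by easy.
destruct (Req_EM_T (Im z) 0) as [Hi|Hi].
- unfold Carg; destruct (Req_EM_T (Im z) 0) as [_|?]; [|easy].
  destruct z as [u v]; simpl in Hi |- *; subst v.
  assert (E : Cmod (u, 0%R) = Rabs u) by apply (Cmod_R u).
  assert (Hu : (u <> 0)%R) by (intros ->; rewrite E, Rabs_R0 in Hm; lra).
  rewrite E; destruct (Rlt_dec u 0) as [Hl|Hl].
  + rewrite cos_PI, sin_PI, Rabs_left by easy; f_equal; ring.
  + rewrite cos_0, sin_0, Rabs_pos_eq by lra; f_equal; ring.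
- assert (H : ~ (Im z = 0%R /\ Re z <= 0)) by tauto.
  rewrite Carg_half_angle by easy.
  assert (Hp := Cmod_plus_Re_gt0 z H).
  destruct z as [u v]; simpl Re in *; simpl Im in *.
  set (m := Cmod (u, v)) in *.
  assert (Em : (m * m = u * u + v * v)%R).
  { unfold m, Cmod; simpl fst; simpl snd; rewrite sqrt_sqrt by nra; ring. }
  set (q := (v / (m + u))%R).
  assert (Hq : (0 < 1 + q²)%R) by (unfold Rsqr; nra).
  assert (Hs := sqrt_lt_R0 _ Hq).
  assert (Es : (sqrt (1 + q²) * sqrt (1 + q²) = 1 + q²)%R)
    by (apply sqrt_sqrt; lra).
  assert (Eq : (q * (m + u) = v)%R) by (unfold q; field; lra).
  assert (E1 : ((1 + q²) * (m + u) = 2 * m)%R).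
  { unfold Rsqr; apply Rmult_eq_reg_r with (m + u)%R; [|lra].
    replace ((1 + q * q) * (m + u) * (m + u))%R
      with ((m + u) * (m + u) + q * (m + u) * (q * (m + u)))%R by ring.
    rewrite Eq; lra. }
  rewrite cos_2a, sin_2a, cos_atan, sin_atan.
  assert (Ei : (1 / sqrt (1 + q²) * (1 / sqrt (1 + q²)) = (m + u) / (2 * m))%R).
  { replace (1 / sqrt (1 + q²) * (1 / sqrt (1 + q²)))%R
      with (/ (sqrt (1 + q²) * sqrt (1 + q²)))%R by (field; lra).
    rewrite Es, <- E1; field; split; lra. }
  f_equal.
  + replace (m * (1 / sqrt (1 + q²) * (1 / sqrt (1 + q²)) -
               q / sqrt (1 + q²) * (q / sqrt (1 + q²))))%R
      with (m * ((1 - q * q) * (1 / sqrt (1 + q²) * (1 / sqrt (1 + q²)))))%R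
      by (field; lra).
    rewrite Ei; apply Rmult_eq_reg_l with 2%R; [|lra].
    replace (2 * (m * ((1 - q * q) * ((m + u) / (2 * m)))))%R
      with ((m + u) - q * (q * (m + u)))%R by (field; lra).
    unfold Rsqr in E1; lra.
  + replace (m * (2 * (q / sqrt (1 + q²)) * (1 / sqrt (1 + q²))))%R
      with (2 * m * q * (1 / sqrt (1 + q²) * (1 / sqrt (1 + q²))))%R
      by (field; lra).
    rewrite Ei, <- Eq; field; lra.
Qed.

Lemma off_cut_slit (z : C) (t : R) :
  ~ on_cut z -> 0 <= t <= 1 ->
  ~ (Im (1 - t * z) = 0%R /\ Re (1 - t * z) <= 0).
Proof.
destruct z as [x y]; unfold on_cut; simpl; intros Hz Ht [Hi Hr].
assert (Hy : (t * y = 0)%R) by lra.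
apply Rmult_integral in Hy; destruct Hy as [->| ->]; [lra|].
apply Hz; split; [easy|].
apply Rnot_lt_le; intros Hx.
assert (t * x < 1)%R by (destruct (Rle_dec x 0); nra).
lra.
Qed.

Lemma is_derive_Clog_ray (z : C) (t : R) :
  ~ (Im (1 - t * z) = 0%R /\ Re (1 - t * z) <= 0) ->
  is_derive (fun s : R => Re (Clog (1 - s * z))) t (Re (- z / (1 - t * z))) /\
  is_derive (fun s : R => Im (Clog (1 - s * z))) t (Im (- z / (1 - t * z))).
Proof.
intros H.
assert (Hp := Cmod_plus_Re_gt0 _ H).
destruct z as [x y].
assert (Eu : forall s : R, Re (1 - s * (x, y)) = (1 - s * x)%R)
  by (intros s; simpl; ring).
assert (Ev : forall s : R, Im (1 - s * (x, y)) = (- (s * y))%R)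
  by (intros s; simpl; ring).
assert (Em : forall s : R,
  Cmod (1 - s * (x, y)) = sqrt ((1 - s * x) * (1 - s * x) + s * y * (s * y))).
{ intros s; unfold Cmod; f_equal; simpl; ring. }
assert (Hm : (0 < (1 - t * x) * (1 - t * x) + t * y * (t * y))%R).
{ rewrite Eu, Ev in H.
  destruct (Req_dec (t * y) 0) as [E|E].
  - assert (0 < 1 - t * x)%R by (apply Rnot_le_lt; intros ?; apply H; lra); nra.
  - assert (H1 := Rle_0_sqr (1 - t * x)); assert (H2 := Rsqr_pos_lt _ E).
    unfold Rsqr in *; lra. }
assert (Hs := sqrt_lt_R0 _ Hm).
assert (Ess := sqrt_sqrt _ (Rlt_le _ _ Hm)).
rewrite Em, Eu in Hp.
assert (ERe : Re (- (x, y) / (1 - t * (x, y))) =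
  ((- x * (1 - t * x) + t * y * y) /
   ((1 - t * x) * (1 - t * x) + t * y * (t * y)))%R).
{ simpl; field; try split; intros Hc; lra. }
assert (EIm : Im (- (x, y) / (1 - t * (x, y))) =
  ((- y * (1 - t * x) - t * y * x) /
   ((1 - t * x) * (1 - t * x) + t * y * (t * y)))%R).
{ simpl; field; try split; intros Hc; lra. }
rewrite ERe, EIm; split.
- apply is_derive_ext with
    (fun s : R => ln (sqrt ((1 - s * x) * (1 - s * x) + s * y * (s * y)))).
  { intros s; simpl; now rewrite <- Em. }
  auto_derive; [repeat split; easy|].
  unfold Rminus in *; set (r := sqrt _) in *; rewrite <- Ess; field; lra.
- apply is_derive_ext_loc with (fun s : R =>
    2 * atan (- (s * y) /
       (sqrt ((1 - s * x) * (1 - s * x) + s * y * (s * y)) + (1 - s * x))))%R.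
  + assert (Hc : continuous (fun s : R =>
      sqrt ((1 - s * x) * (1 - s * x) + s * y * (s * y)) + (1 - s * x))%R t).
    { apply (ex_derive_continuous (V := R_NormedModule)); auto_derive; easy. }
    generalize (Hc _ (open_gt 0 _ Hp)); clear Hp; unfold filtermap.
    apply filter_imp; intros s Hs'.
    change (Im (Clog ?w)) with (Carg w); rewrite Carg_half_angle.
    * now rewrite Ev, Em, Eu.
    * rewrite Ev, Eu; intros [Hi Hr].
      replace (s * y * (s * y))%R with 0%R in Hs' by nra.
      rewrite Rplus_0_r in Hs'; fold (Rsqr (1 - s * x)) in Hs'.
      rewrite sqrt_Rsqr_abs, Rabs_left1 in Hs' by easy; lra.
  + unfold Rminus in *; auto_derive; [repeat split; lra|].
    set (r := sqrt _) in *; clearbody r.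
    set (u := (1 + - (t * x))%R) in *.
    assert (E : (1 + - (t * y) * / (r + u) * (- (t * y) * / (r + u) * 1) =
                 2 * r * / (r + u))%R).
    { apply Rmult_eq_reg_r with ((r + u) * (r + u))%R; [|nra].
      transitivity ((r + u) * (r + u) + t * y * (t * y))%R; [field; lra|].
      transitivity (2 * r * (r + u))%R; [lra|field; lra]. }
    rewrite E, <- Ess.
    transitivity ((- y * u + - (t * y * x)) / (r * r) +
      y * (u * u + t * y * (t * y) - r * r) / (r * r * (r + u)))%R.
    * unfold u in *; field; lra.
    * rewrite Ess at 2; field; lra.
Qed.

Lemma ex_RInt_div_id (f df : R -> R) :
  (forall t, 0 <= t <= 1 -> is_derive f t (df t)) -> f 0%R = 0%R ->
  ex_RInt (fun t => f t / t)%R 0 1.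
Proof.
intros Hf Hf0.
set (h := fun t : R => if Req_EM_T t 0 then df 0%R else (f t / t)%R).
apply ex_RInt_ext with h.
{ intros t; rewrite Rmin_left, Rmax_right by lra; intros Ht; unfold h.
  destruct (Req_EM_T t 0); [lra|easy]. }
apply (ex_RInt_continuous (V := R_CompleteNormedModule)).
intros t; rewrite Rmin_left, Rmax_right by lra; intros Ht.
destruct (Req_EM_T t 0) as [->|Hn].
- apply continuity_pt_filterlim.
  assert (Hd : derivable_pt_lim f 0 (df 0%R)) by (apply is_derive_Reals, Hf; lra).
  intros eps He; destruct (Hd eps He) as [d Hd'].
  exists d; split; [apply cond_pos|]; intros s [[_ Hs] Hsd].
  simpl in Hsd |- *; unfold R_dist, Rdist in *; rewrite Rminus_0_r in Hsd.
  unfold h; destruct (Req_EM_T s 0); [congruence|].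
  destruct (Req_EM_T 0 0); [|congruence].
  specialize (Hd' s n Hsd); rewrite Rplus_0_l, Hf0, Rminus_0_r in Hd'; easy.
- apply continuous_ext_loc with (fun t => f t / t)%R.
  + generalize (open_neq 0 t Hn); apply filter_imp; intros s Hs; unfold h.
    destruct (Req_EM_T s 0); [easy|reflexivity].
  + apply (ex_derive_continuous (V := R_NormedModule)).
    apply ex_derive_div; [exists (df t); now apply Hf|apply ex_derive_id|easy].
Qed.

Lemma is_RInt_C_div_id (p q dp dq : R -> R) (g : R -> C) :
  (forall t, 0 <= t <= 1 -> is_derive p t (dp t)) ->
  (forall t, 0 <= t <= 1 -> is_derive q t (dq t)) ->
  p 0%R = 0%R -> q 0%R = 0%R ->
  (forall t, 0 < t < 1 -> g t = (p t, q t) / t) ->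
  @is_RInt C_R_CompleteNormedModule g 0 1
    (@RInt C_R_CompleteNormedModule g 0 1).
Proof.
intros Hp Hq Hp0 Hq0 Hg.
apply (@RInt_correct C_R_CompleteNormedModule).
destruct (ex_RInt_div_id p dp Hp Hp0) as [lp Hlp].
destruct (ex_RInt_div_id q dq Hq Hq0) as [lq Hlq].
exists (lp, lq).
apply (@is_RInt_ext C_R_NormedModule (fun t : R => (p t / t, q t / t)%R)).
- intros t; rewrite Rmin_left, Rmax_right by lra; intros Ht; rewrite Hg by easy.
  unfold Cdiv, Cmult, Cinv, RtoC; simpl; apply injective_projections; simpl; field; lra.
- apply (@is_RInt_fct_extend_pair R_NormedModule R_NormedModule); easy.
Qed.

(* phi(0) = 0 and |phi'| <= K give |phi(t)/t| <= 2 K. *)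
Lemma Cmod_div_le (p q dp dq : R -> R) (K : R) :
  (forall t, 0 <= t <= 1 -> is_derive p t (dp t)) ->
  (forall t, 0 <= t <= 1 -> is_derive q t (dq t)) ->
  (forall t, 0 <= t <= 1 -> Cmod (dp t, dq t) <= K) ->
  p 0%R = 0%R -> q 0%R = 0%R ->
  forall t : R, 0 < t <= 1 -> Cmod ((p t, q t) / t) <= 2 * K.
Proof.
intros Hp Hq HK Hp0 Hq0 t Ht.
assert (G : forall f df : R -> R,
  (forall t, 0 <= t <= 1 -> is_derive f t (df t)) ->
  (forall t, 0 <= t <= 1 -> Rabs (df t) <= K) ->
  f 0%R = 0%R -> (Rabs (f t) <= K * t)%R).
{ intros f df Hf Hdf Hf0.
  destruct (MVT_gen f 0 t df) as [c [Hc E]].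
  - intros s; rewrite Rmin_left, Rmax_right by lra; intros Hs; apply Hf; lra.
  - intros s; rewrite Rmin_left, Rmax_right by lra; intros Hs.
    apply derivable_continuous_pt; exists (df s); apply is_derive_Reals, Hf; lra.
  - rewrite Rmin_left, Rmax_right in Hc by lra.
    rewrite Hf0 in E; replace (f t) with (df c * t)%R by lra.
    rewrite Rabs_mult, (Rabs_pos_eq t) by lra.
    apply Rmult_le_compat_r; [lra|]. apply Hdf; lra. }
assert (H1 : (Rabs (p t) <= K * t)%R).
{ apply (G p dp); try easy; intros s Hs.
  eapply Rle_trans; [|apply (HK s Hs)]; apply (re_le_Cmod (dp s, dq s)). }
assert (H2 : (Rabs (q t) <= K * t)%R).
{ apply (G q dq); try easy; intros s Hs.
  eapply Rle_trans; [|apply (HK s Hs)].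
  eapply Rle_trans; [|apply Rmax_Cmod]; apply Rmax_r. }
rewrite Cmod_div by (intros E; apply RtoC_inj in E; lra).
rewrite Cmod_R, (Rabs_pos_eq t) by lra.
apply Rmult_le_reg_r with t; [lra|].
unfold Rdiv; rewrite Rmult_assoc, Rinv_l, Rmult_1_r by lra.
eapply Rle_trans.
- replace (p t, q t) with (RtoC (p t) + RtoC (q t) * Ci)
    by (unfold RtoC, Ci, Cplus, Cmult; simpl; f_equal; ring).
  apply Cmod_triangle.
- rewrite Cmod_mult, Cmod_Ci, !Cmod_R; lra.
Qed.

Lemma Clog_1 : Clog 1 = 0.
Proof.
unfold Clog; rewrite Cmod_1, ln_1, Carg_half_angle by (simpl; lra).
simpl; rewrite Rdiv_0_l, atan_0, Rmult_0_r; reflexivity.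
Qed.

Lemma is_RInt_Li2_slit (z : C) :
  ~ on_cut z ->
  @is_RInt C_R_CompleteNormedModule (fun t : R => - Clog (1 - t * z) / t) 0 1
    (Li2_slit z).
Proof.
intros Hz.
assert (H0 : Clog (1 - 0 * z) = 0).
{ replace (1 - 0 * z) with (RtoC 1) by ring; apply Clog_1. }
apply (is_RInt_C_div_id
  (fun s : R => opp (Re (Clog (1 - s * z))))
  (fun s : R => opp (Im (Clog (1 - s * z))))
  (fun t => opp (Re (- z / (1 - t * z)))) (fun t => opp (Im (- z / (1 - t * z))))).
- intros t Ht; apply (is_derive_opp (V := R_NormedModule)).
  now apply is_derive_Clog_ray, off_cut_slit.
- intros t Ht; apply (is_derive_opp (V := R_NormedModule)).
  now apply is_derive_Clog_ray, off_cut_slit.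
- rewrite H0; apply Ropp_0.
- rewrite H0; apply Ropp_0.
- intros t Ht; reflexivity.
Qed.

Lemma RInt_Cmod_le (p q dp dq : R -> R) (K : R) (l : C) :
  (forall t, 0 <= t <= 1 -> is_derive p t (dp t)) ->
  (forall t, 0 <= t <= 1 -> is_derive q t (dq t)) ->
  (forall t, 0 <= t <= 1 -> Cmod (dp t, dq t) <= K) ->
  p 0%R = 0%R -> q 0%R = 0%R ->
  @is_RInt C_R_CompleteNormedModule (fun t : R => (p t, q t) / t) 0 1 l ->
  Cmod l <= 2 * K.
Proof.
intros Hp Hq HK Hp0 Hq0 Hl.
replace (2 * K)%R with ((1 - 0) * (2 * K))%R by ring.
rewrite Cmod_norm.
apply (@norm_RInt_le_const C_R_NormedModule (fun t : R => (p t, q t) / t)); [lra| |exact Hl].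
intros t Ht; eapply Rle_trans; [right; symmetry; apply (Cmod_norm ((p t, q t) / t))|].
destruct (Req_dec t 0) as [->|Hn].
- rewrite Hp0, Hq0; change (0%R, 0%R) with (RtoC 0).
  unfold Cdiv; rewrite Cmult_0_l, Cmod_0.
  assert (H := Rle_trans _ _ _ (Cmod_ge_0 _) (HK 0%R ltac:(lra))); lra.
- apply (Cmod_div_le p q dp dq); try easy; lra.
Qed.

Lemma Li2_off_cut (z : C) : ~ on_cut z -> Li2 z = Li2_slit z.
Proof. intros Hz; unfold Li2; destruct (on_cut_dec z); easy. Qed.

Lemma on_cut_Cmod_ge1 (z : C) : on_cut z -> 1 <= Cmod z.
Proof.
intros [_ H]; eapply Rle_trans; [exact H|].
eapply Rle_trans; [apply Rle_abs|apply re_le_Cmod].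
Qed.

Fixpoint Clog_tail (z : C) (N : nat) (t : R) : C :=
  match N with
  | O => - Clog (1 - t * z)
  | S k => Clog_tail z k t - RtoC (t ^ S k / INR (S k))%R * z ^ S k
  end.

Lemma Clog_tail_0 z N : Clog_tail z N 0 = 0.
Proof.
induction N as [|N IH]; simpl Clog_tail.
- replace (1 - 0 * z) with (RtoC 1) by ring; rewrite Clog_1; ring.
- rewrite IH, Rmult_0_l, Rdiv_0_l; ring.
Qed.

Lemma one_minus_neq0 (z : C) (t : R) :
  ~ on_cut z -> 0 <= t <= 1 -> 1 - t * z <> 0.
Proof.
intros Hz Ht E; apply (off_cut_slit z t Hz Ht); rewrite E; simpl; lra.
Qed.

Lemma is_derive_Clog_tail (z : C) (N : nat) (t : R) :
  ~ on_cut z -> 0 <= t <= 1 ->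
  is_derive (fun s => Re (Clog_tail z N s)) t (Re (z * (t * z) ^ N / (1 - t * z))) /\
  is_derive (fun s => Im (Clog_tail z N s)) t (Im (z * (t * z) ^ N / (1 - t * z))).
Proof.
intros Hz Ht; assert (Hn := one_minus_neq0 z t Hz Ht).
induction N as [|N [IH1 IH2]].
- destruct (is_derive_Clog_ray z t (off_cut_slit z t Hz Ht)) as [H1 H2].
  replace (z * (t * z) ^ 0 / (1 - t * z)) with (- (- z / (1 - t * z)))
    by (simpl Cpow; field; easy).
  split.
  + apply (is_derive_opp (V := R_NormedModule)) in H1; exact H1.
  + apply (is_derive_opp (V := R_NormedModule)) in H2; exact H2.
- assert (E : z * (t * z) ^ S N / (1 - t * z) =
    z * (t * z) ^ N / (1 - t * z) - RtoC (t ^ N) * z ^ S N).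
  { rewrite RtoC_pow, !Cpow_S, !Cpow_mult_l; field; easy. }
  assert (HN := not_0_INR (S N) ltac:(lia)).
  assert (D : forall c : R, is_derive (fun s : R => s ^ S N / INR (S N) * c)%R t (t ^ N * c)%R).
  { intros c; apply is_derive_ext with (fun s => c / INR (S N) * s ^ S N)%R;
      [intros s; eqR; field; easy|].
    replace (t ^ N * c)%R with (c / INR (S N) * (INR (S N) * 1 * t ^ pred (S N)))%R
      by (simpl pred; field; easy).
    apply is_derive_scal, is_derive_pow, (is_derive_id (K := R_AbsRing)). }
  rewrite E; split.
  + apply is_derive_ext with (fun s : R =>
      minus (Re (Clog_tail z N s)) (s ^ S N / INR (S N) * Re (z ^ S N))%R).
    { intros s; change (Clog_tail z (S N) s) with
        (Clog_tail z N s - RtoC (s ^ S N / INR (S N))%R * z ^ S N).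
      unfold Cminus; rewrite re_plus, re_opp, re_scal_l; reflexivity. }
    unfold Cminus; rewrite re_plus, re_opp, re_scal_l.
    apply (is_derive_minus (V := R_NormedModule)); [exact IH1|apply D].
  + apply is_derive_ext with (fun s : R =>
      minus (Im (Clog_tail z N s)) (s ^ S N / INR (S N) * Im (z ^ S N))%R).
    { intros s; change (Clog_tail z (S N) s) with
        (Clog_tail z N s - RtoC (s ^ S N / INR (S N))%R * z ^ S N).
      unfold Cminus; rewrite im_plus, im_opp, im_scal_l; reflexivity. }
    unfold Cminus; rewrite im_plus, im_opp, im_scal_l.
    apply (is_derive_minus (V := R_NormedModule)); [exact IH2|apply D].
Qed.

Lemma is_RInt_C_scal (f : R -> C) (c l : C) :
  @is_RInt C_R_NormedModule f 0 1 l ->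
  @is_RInt C_R_NormedModule (fun t => c * f t) 0 1 (c * l).
Proof.
intros H.
assert (H1 : is_RInt (fun t => Re (f t)) 0 1 (Re l))
  by apply (@is_RInt_fct_extend_fst R_NormedModule R_NormedModule f 0 1 l H).
assert (H2 : is_RInt (fun t => Im (f t)) 0 1 (Im l))
  by apply (@is_RInt_fct_extend_snd R_NormedModule R_NormedModule f 0 1 l H).
apply (@is_RInt_fct_extend_pair R_NormedModule R_NormedModule (fun t => c * f t)).
- apply (is_RInt_minus (V := R_NormedModule)
    (fun t => Re c * Re (f t))%R (fun t => Im c * Im (f t))%R);
  now apply (is_RInt_scal (V := R_NormedModule)).
- apply (is_RInt_plus (V := R_NormedModule)
    (fun t => Re c * Im (f t))%R (fun t => Im c * Re (f t))%R);
  now apply (is_RInt_scal (V := R_NormedModule)).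
Qed.

Lemma is_RInt_monomial (k : nat) (c : C) :
  @is_RInt C_R_NormedModule (fun t : R => RtoC (t ^ k / INR (S k))%R * c) 0 1
    (c / INR (S k) ^ 2).
Proof.
assert (HN := not_0_INR (S k) ltac:(lia)).
apply (@is_RInt_ext C_R_NormedModule
  (fun t : R => c / INR (S k) * RtoC (t ^ k)%R)).
{ intros t _; rewrite RtoC_div by easy; eqC; field.
  intros E; apply RtoC_inj in E; easy. }
replace (c / INR (S k) ^ 2) with (c / INR (S k) * RtoC (/ INR (S k))%R).
2: { rewrite RtoC_inv by easy; field.
     intros E; apply RtoC_inj in E; easy. }
apply is_RInt_C_scal.
apply (@is_RInt_fct_extend_pair R_NormedModule R_NormedModule (fun t : R => RtoC (t ^ k)%R)).
- simpl fst.
  replace (/ INR (S k))%R with (minus (1 ^ S k / INR (S k)) (0 ^ S k / INR (S k)))%R.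
  2: { unfold minus, plus, opp; simpl; rewrite pow1; simpl in HN; field; easy. }
  apply (is_RInt_derive (fun t => t ^ S k / INR (S k))%R (fun t => t ^ k)%R).
  + intros t _; apply is_derive_ext with (fun s => / INR (S k) * s ^ S k)%R;
      [intros s; eqR; field; easy|].
    replace (t ^ k)%R with (/ INR (S k) * (INR (S k) * 1 * t ^ pred (S k)))%R
      by (simpl pred; field; easy).
    apply is_derive_scal, is_derive_pow, (is_derive_id (K := R_AbsRing)).
  + intros t _; apply (ex_derive_continuous (V := R_NormedModule)); auto_derive; easy.
- assert (H := is_RInt_const (V := R_NormedModule) 0 1 0%R).
  change (is_RInt (V := R_NormedModule) (fun _ : R => 0%R) 0 1 ((1 - 0) * 0)%R) in H.
  rewrite Rmult_0_r in H.
  exact H.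
Qed.

Definition Li2_term (z : C) (k : nat) : C := z ^ S k / INR (S k) ^ 2.

Lemma is_RInt_Clog_tail (z : C) (N : nat) :
  ~ on_cut z ->
  @is_RInt C_R_NormedModule (fun t : R => Clog_tail z (S N) t / t) 0 1
    (Li2_slit z - @sum_n C_AbelianMonoid (Li2_term z) N).
Proof.
intros Hz.
assert (Step : forall M l,
  @is_RInt C_R_NormedModule (fun t : R => Clog_tail z M t / t) 0 1 l ->
  @is_RInt C_R_NormedModule (fun t : R => Clog_tail z (S M) t / t) 0 1
    (l - Li2_term z M)).
{ intros M l H.
  apply (@is_RInt_ext C_R_NormedModule
    (fun t : R => minus (Clog_tail z M t / t) (RtoC (t ^ M / INR (S M))%R * z ^ S M))).
  - intros t; rewrite Rmin_left, Rmax_right by lra; intros Ht.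
    change (Clog_tail z (S M) t) with
      (Clog_tail z M t - RtoC (t ^ S M / INR (S M))%R * z ^ S M).
    change (minus ?a ?b) with (a - b).
    replace (t ^ S M / INR (S M))%R with (t * (t ^ M / INR (S M)))%R
      by (simpl pow; unfold Rdiv; ring).
    rewrite RtoC_mult; eqC; field.
    intros E; apply RtoC_inj in E; lra.
  - apply (@is_RInt_minus C_R_NormedModule); [exact H|apply is_RInt_monomial]. }
induction N as [|N IH].
- rewrite sum_O; apply Step, is_RInt_Li2_slit, Hz.
- rewrite sum_Sn; change (plus ?a ?b) with (a + b).
  replace (Li2_slit z - (sum_n (Li2_term z) N + Li2_term z (S N))) with
    (Li2_slit z - @sum_n C_AbelianMonoid (Li2_term z) N - Li2_term z (S N)).
  2: { unfold Cminus; rewrite Copp_plus_distr, Cplus_assoc; reflexivity. }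
  now apply Step.
Qed.

Lemma Li2_series (z : C) :
  Cmod z < 1 ->
  @is_series C_AbsRing C_NormedModule
    (fun k : nat => z ^ S k / INR (S k) ^ 2) (Li2 z).
Proof.
intros Hr.
assert (Hz : ~ on_cut z) by (intros H; apply on_cut_Cmod_ge1 in H; lra).
rewrite Li2_off_cut by easy.
assert (Hr0 := Cmod_ge_0 z).
assert (B : forall N, Cmod (Li2_slit z - @sum_n C_AbelianMonoid (Li2_term z) N)
   <= 2 * (Cmod z ^ S (S N) / (1 - Cmod z))).
{ intros N.
  apply (RInt_Cmod_le
    (fun s => Re (Clog_tail z (S N) s)) (fun s => Im (Clog_tail z (S N) s))
    (fun t => Re (z * (t * z) ^ S N / (1 - t * z)))
    (fun t => Im (z * (t * z) ^ S N / (1 - t * z)))).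
  - intros t Ht; now apply is_derive_Clog_tail.
  - intros t Ht; now apply is_derive_Clog_tail.
  - intros t Ht; rewrite <- surjective_pairing.
    assert (Hm : (1 - Cmod z <= Cmod (1 - t * z))%R).
    { assert (Htr := Cmod_triangle (1 - t * z) (t * z)).
      replace (1 - t * z + t * z) with (RtoC 1) in Htr by ring.
      rewrite Cmod_1, Cmod_mult, Cmod_R, Rabs_pos_eq in Htr by lra; nra. }
    rewrite Cmod_div by now apply one_minus_neq0.
    rewrite Cmod_mult, Cmod_pow, Cmod_mult, Cmod_R, Rabs_pos_eq by lra.
    apply Rmult_le_compat.
    + apply Rmult_le_pos; [easy|apply pow_le; nra].
    + apply Rlt_le, Rinv_0_lt_compat; lra.
    + change (Cmod z ^ S (S N))%R with (Cmod z * Cmod z ^ S N)%R.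
      apply Rmult_le_compat_l; [easy|].
      apply pow_incr; nra.
    + apply Rinv_le_contravar; lra.
  - now rewrite Clog_tail_0.
  - now rewrite Clog_tail_0.
  - apply (@is_RInt_ext C_R_NormedModule (fun t : R => Clog_tail z (S N) t / t)).
    + intros t _; now rewrite <- surjective_pairing.
    + now apply is_RInt_Clog_tail. }
assert (L : is_lim_seq (fun N => 2 * (Cmod z ^ S (S N) / (1 - Cmod z)))%R 0).
{ assert (Hg : Rabs (Cmod z) < 1) by (rewrite Rabs_pos_eq; easy).
  assert (L0 := is_lim_seq_scal_l _
    (2 * / (1 - Cmod z) * (Cmod z * Cmod z))%R _ (is_lim_seq_geom _ Hg)).
  simpl Rbar_mult in L0; rewrite Rmult_0_r in L0.
  apply is_lim_seq_ext with (2 := L0).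
  intros N; simpl pow; unfold Rdiv; ring. }
apply (proj2 (@filterlim_locally nat C_UniformSpace eventually _ _ _)); intros eps.
apply is_lim_seq_spec in L; destruct (L eps) as [N0 HN0].
exists N0; intros N HN; apply C_NormedModule_mixin_compat1.
specialize (HN0 N HN); specialize (B N); rewrite Rminus_0_r in HN0.
apply Rle_lt_trans with (2 := HN0).
eapply Rle_trans; [|apply Rle_abs].
eapply Rle_trans; [|exact B]; right.
rewrite <- Cmod_opp; f_equal.
exact (Copp_minus_distr _ _).
Qed.

Lemma one_minus_Cmod_ge (z : C) :
  ~ on_cut z ->
  exists m : R, 0 < m /\ forall t : R, 0 <= t <= 1 -> m <= Cmod (1 - t * z).
Proof.
intros Hz.
destruct (continuity_ab_min (fun t => (1 - t * Re z) ^ 2 + (t * Im z) ^ 2)%R 0 1)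
  as [t0 [Hmin Ht0]]; [lra| |].
{ intros t _; reg. }
assert (E : forall t : R,
  Cmod (1 - t * z) = sqrt ((1 - t * Re z) ^ 2 + (t * Im z) ^ 2)).
{ intros t; unfold Cmod; f_equal; destruct z; simpl; ring. }
exists (Cmod (1 - t0 * z)); split.
- now apply Cmod_gt_0, one_minus_neq0.
- intros t Ht; rewrite !E; apply sqrt_le_1_alt; now apply Hmin.
Qed.

Lemma is_derive_Cdiv_ray (z : C) (t : R) :
  1 - t * z <> 0 ->
  is_derive (fun s : R => Re (s / (1 - s * z))) t (Re (/ (1 - t * z) ^ 2)) /\
  is_derive (fun s : R => Im (s / (1 - s * z))) t (Im (/ (1 - t * z) ^ 2)).
Proof.
destruct z as [x y]; intros Hn.
assert (EM : forall s : R,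
  ((1 + - (s * x - 0 * y)) ^ 2 + (0 + - (s * y + 0 * x)) ^ 2 =
   (1 - s * x) * (1 - s * x) + s * y * (s * y))%R) by (intros s; ring).
assert (Hm : ((1 - t * x) * (1 - t * x) + t * y * (t * y) <> 0)%R).
{ intros E; apply Hn.
  assert ((1 - t * x = 0)%R) by nra.
  assert ((t * y = 0)%R) by nra.
  apply injective_projections; simpl; lra. }
replace (/ (1 - t * (x, y)) ^ 2) with (/ (1 - t * (x, y)) * / (1 - t * (x, y)))
  by (field; exact Hn).
split.
- apply is_derive_ext with (fun s : R =>
    s * (1 - s * x) / ((1 - s * x) * (1 - s * x) + s * y * (s * y)))%R.
  + intros s; eqR; unfold Cdiv, Cinv, Cmult, Re, Im; cbn [fst snd RtoC Cminus Cplus Copp].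
    rewrite EM; unfold Rdiv; ring.
  + auto_derive; [easy|]; simpl; field; try split; intros Hc; apply Hm; lra.
- apply is_derive_ext with (fun s : R =>
    s * (s * y) / ((1 - s * x) * (1 - s * x) + s * y * (s * y)))%R.
  + intros s; eqR; unfold Cdiv, Cinv, Cmult, Re, Im; cbn [fst snd RtoC Cminus Cplus Copp].
    rewrite EM; unfold Rdiv; ring.
  + auto_derive; [easy|]; simpl; field; try split; intros Hc; apply Hm; lra.
Qed.

Lemma Li2_holomorphic (z : C) :
  ~ on_cut z -> @ex_derive C_AbsRing C_NormedModule Li2 z.
Proof.
intros Hz.
destruct (one_minus_Cmod_ge z Hz) as [m [Hm Hmz]].
set (g := fun t : R => t / (1 - t * z) / t).
set (l := @RInt C_R_CompleteNormedModule g 0 1).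
assert (Hl : @is_RInt C_R_NormedModule g 0 1 l).
{ apply (is_RInt_C_div_id
    (fun s : R => Re (s / (1 - s * z))) (fun s : R => Im (s / (1 - s * z)))
    (fun t => Re (/ (1 - t * z) ^ 2)) (fun t => Im (/ (1 - t * z) ^ 2))).
  - intros t Ht; now apply is_derive_Cdiv_ray, one_minus_neq0.
  - intros t Ht; now apply is_derive_Cdiv_ray, one_minus_neq0.
  - unfold Cdiv; rewrite Cmult_0_l; easy.
  - unfold Cdiv; rewrite Cmult_0_l; easy.
  - intros t Ht; unfold g; now rewrite <- surjective_pairing. }
set (K := (2 / (m * (m * m)))%R).
assert (HK : 0 < K) by (apply Rdiv_lt_0_compat; [lra|repeat apply Rmult_lt_0_compat; lra]).
assert (Near : forall w, Cmod (w - z) < m / 2 ->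
  ~ on_cut w /\
  Cmod (Li2_slit w - Li2_slit z - (w - z) * l) <= 2 * (K * (Cmod (w - z) * Cmod (w - z)))).
{ intros w Hw; assert (Hd := Cmod_ge_0 (w - z)).
  assert (Hmw : forall t : R, 0 <= t <= 1 -> m / 2 <= Cmod (1 - t * w)).
  { intros t Ht.
    assert (Htr := Cmod_triangle (1 - t * w) (t * (w - z))).
    replace (1 - t * w + t * (w - z)) with (1 - t * z) in Htr by ring.
    rewrite (Cmod_mult t), Cmod_R, Rabs_pos_eq in Htr by lra.
    specialize (Hmz t Ht); nra. }
  assert (Hcw : ~ on_cut w).
  { intros [Hi Hr].
    assert (Ht : 0 <= / Re w <= 1).
    { split; [apply Rlt_le, Rinv_0_lt_compat; lra|].
      rewrite <- Rinv_1; apply Rinv_le_contravar; lra. }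
    specialize (Hmw _ Ht).
    replace (1 - RtoC (/ Re w)%R * w) with (RtoC 0) in Hmw.
    - rewrite Cmod_0 in Hmw; lra.
    - destruct w as [x y]; simpl in *; subst y.
      apply injective_projections; simpl; field; lra. }
  split; [exact Hcw|].
  set (phi := fun t : R => - Clog (1 - t * w) - - Clog (1 - t * z) - (w - z) * (t / (1 - t * z))).
  set (dphi := fun t : R => w / (1 - t * w) - z / (1 - t * z) - (w - z) * / (1 - t * z) ^ 2).
  assert (H0 : phi 0%R = 0).
  { unfold phi, Cdiv; rewrite !Cmult_0_l, Cmult_0_r.
    replace (1 - 0) with (RtoC 1) by ring; rewrite Clog_1. eqC; ring. }
  assert (Dphi : forall t, 0 <= t <= 1 ->
    is_derive (fun s => Re (phi s)) t (Re (dphi t)) /\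
    is_derive (fun s => Im (phi s)) t (Im (dphi t))).
  { intros t Ht.
    destruct (is_derive_Clog_ray w t (off_cut_slit w t Hcw Ht)) as [W1 W2].
    destruct (is_derive_Clog_ray z t (off_cut_slit z t Hz Ht)) as [Z1 Z2].
    destruct (is_derive_Cdiv_ray z t (one_minus_neq0 z t Hz Ht)) as [R1 R2].
    replace (dphi t) with
      (- (- w / (1 - t * w)) - - (- z / (1 - t * z)) - (w - z) * / (1 - t * z) ^ 2)
      by (unfold dphi, Cdiv; ring).
    assert (LinR : forall a b c : C,
      Re (- a - - b - (w - z) * c) =
      (- Re a + Re b - (Re (w - z) * Re c - Im (w - z) * Im c))%R)
      by (intros a b c; unfold Re, Im; simpl; ring).
    assert (LinI : forall a b c : C,
      Im (- a - - b - (w - z) * c) =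
      (- Im a + Im b - (Re (w - z) * Im c + Im (w - z) * Re c))%R)
      by (intros a b c; unfold Re, Im; simpl; ring).
    rewrite LinR, LinI; split.
    - apply is_derive_ext with (2 := is_derive_minus (V := R_NormedModule) _ _ _ _ _
        (is_derive_plus (V := R_NormedModule) _ _ _ _ _
          (is_derive_opp (V := R_NormedModule) _ _ _ W1) Z1)
        (is_derive_minus (V := R_NormedModule) _ _ _ _ _
          (is_derive_scal _ _ (Re (w - z)) _ R1)
          (is_derive_scal _ _ (Im (w - z)) _ R2))).
      intros s; unfold phi; rewrite LinR; reflexivity.
    - apply is_derive_ext with (2 := is_derive_minus (V := R_NormedModule) _ _ _ _ _
        (is_derive_plus (V := R_NormedModule) _ _ _ _ _
          (is_derive_opp (V := R_NormedModule) _ _ _ W2) Z2)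
        (is_derive_plus (V := R_NormedModule) _ _ _ _ _
          (is_derive_scal _ _ (Re (w - z)) _ R2)
          (is_derive_scal _ _ (Im (w - z)) _ R1))).
      intros s; unfold phi; rewrite LinI; reflexivity. }
  assert (Bphi : forall t, 0 <= t <= 1 ->
    Cmod (dphi t) <= K * (Cmod (w - z) * Cmod (w - z))).
  { intros t Ht.
    assert (Nw := one_minus_neq0 w t Hcw Ht); assert (Nz := one_minus_neq0 z t Hz Ht).
    replace (dphi t) with
      (t * ((w - z) * (w - z)) / ((1 - t * w) * ((1 - t * z) * (1 - t * z))))
      by (unfold dphi; field; split; easy).
    rewrite Cmod_div by (repeat apply Cmult_neq_0; easy).
    rewrite !Cmod_mult, Cmod_R, Rabs_pos_eq by lra.
    unfold Rdiv; rewrite (Rmult_comm K).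
    specialize (Hmw t Ht); specialize (Hmz t Ht).
    apply Rmult_le_compat.
    - apply Rmult_le_pos; [lra|apply Rmult_le_pos; easy].
    - apply Rlt_le, Rinv_0_lt_compat; repeat apply Rmult_lt_0_compat; lra.
    - assert (0 <= Cmod (w - z) * Cmod (w - z))%R by (apply Rmult_le_pos; easy); nra.
    - replace K with (/ (m / 2 * (m * m)))%R by (unfold K; field; lra).
      apply Rinv_le_contravar; [repeat apply Rmult_lt_0_compat; lra|].
      repeat apply Rmult_le_compat; try lra; apply Rmult_le_pos; lra. }
  apply (RInt_Cmod_le (fun s => Re (phi s)) (fun s => Im (phi s))
    (fun t => Re (dphi t)) (fun t => Im (dphi t))).
  - intros t Ht; now apply Dphi.
  - intros t Ht; now apply Dphi.
  - intros t Ht; rewrite <- surjective_pairing; now apply Bphi.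
  - now rewrite H0.
  - now rewrite H0.
  - apply (@is_RInt_ext C_R_NormedModule (fun t : R =>
      minus (minus (- Clog (1 - t * w) / t) (- Clog (1 - t * z) / t)) ((w - z) * g t))).
    + intros t _; rewrite <- surjective_pairing; unfold phi, g.
      do 2 change (minus ?a ?b) with (a - b); unfold Cdiv; eqC; ring.
    + apply (@is_RInt_minus C_R_NormedModule).
      * apply (@is_RInt_minus C_R_NormedModule); now apply is_RInt_Li2_slit.
      * now apply is_RInt_C_scal. }
exists l; split.
- apply (@is_linear_scal_l C_AbsRing C_NormedModule).
- intros z' Hz'; apply (@is_filter_lim_locally_unique C_AbsRing (AbsRing_NormedModule C_AbsRing)) in Hz'.
  subst z'; intros eps.
  assert (He : 0 < Rmin (m / 2) (eps / (2 * K))).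
  { apply Rmin_glb_lt; [lra|]. apply Rdiv_lt_0_compat; [apply cond_pos|lra]. }
  exists (mkposreal _ He); intros w Hw.
  change (Cmod (w - z) < Rmin (m / 2) (eps / (2 * K))) in Hw.
  destruct (Near w) as [Hcw B].
  { eapply Rlt_le_trans; [exact Hw|apply Rmin_l]. }
  rewrite (Li2_off_cut w Hcw), (Li2_off_cut z Hz).
  change (Cmod (Li2_slit w - Li2_slit z - (w - z) * l) <= eps * Cmod (w - z)).
  eapply Rle_trans; [exact B|].
  assert (Hd := Cmod_ge_0 (w - z)).
  assert (Hw' : Cmod (w - z) <= eps / (2 * K)).
  { apply Rlt_le; eapply Rlt_le_trans; [exact Hw|apply Rmin_r]. }
  replace (2 * (K * (Cmod (w - z) * Cmod (w - z))))%R
    with (2 * K * Cmod (w - z) * Cmod (w - z))%R by ring.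
  apply Rmult_le_compat_r; [easy|].
  replace (pos eps) with (2 * K * (eps / (2 * K)))%R by (field; lra).
  apply Rmult_le_compat_l; lra.
Qed.

(* Main.v *)
(* Write x = p/q with p, q coprime and u = e^-s.  On the positive axis
   psi(y) = lim (ln n - sum_{k<=n} 1/(y+k)), and comparing derivatives in s gives
     | ln(N/q) - psi(N/q) - (sum_k q u^(N+qk)/(N+qk) - E_1(N s)) | <= q (1 - u^N)/N,
   a cut-off form of psi(y) - ln y = - int_0^oo (1/(1-e^-t) - 1/t) e^(-ty) dt.
   Summing over N = np with weights 1/n and subtracting the case p = q = 1, the
   E_1 terms give ((ln ps)^2 - (ln s)^2)/2 + O(s), and the others give A(u), where
   A' = q ln(1-u^p)/(u(1-u^q)) and A(0) = 0.  So F(x) - F(1) is (ln p)^2/2 plus the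
   difference of the constant terms of A at u = 1 for (p,q) and (1,1).
   Splitting over p-th roots z and q-th roots w of unity,
     A(u) = -(q/p) Li2(u^p) + sum_{z,w} int_0^u Log(1-zt) w/(1-wt) dt,
   and for z <> w the integrals are
     [Li2(z(1-wt)/(z-w)) - Log(1-z/w) Log(1-wt)]_0^u,
   with principal branches since 1-zt and 1-z/w have positive real part.
   Products of logarithms are in the span by polarization and
     Li2(-w) + Li2(-1/w) = 2 Li2(-1) - (Log w)^2 / 2.  *)

Require Import Defs.
From Stdlib Require Import Reals ZArith QArith Qreals List Factorial Lra Lia.
From Coquelicot Require Import Coquelicot.
Open Scope R_scope.
Open Scope C_scope.

Local Ltac eqC := match goal with |- @eq _ ?a ?b => change (@eq C a b) end.
Local Ltac eqR := match goal with |- @eq _ ?a ?b => change (@eq R a b) end.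

(** Sums and improper integrals are never interchanged: two functions of s are compared through
    their derivatives and their common limit 0 at infinity, with explicit errors. The order of
    limits is then decisive. The number M of summands goes to infinity at fixed s, and s goes to 0
    next. The accumulated cut-off error is a multiple of sum (1 - u^(np))/n^2; it is split at a free
    index m, which goes to infinity last. At u = 1 the function A diverges like -(ln(1-u))^2/2 - ln
    p ln(1-u). The square stems from z = w = 1 and cancels against the case p = q = 1. The
    coefficient ln p is the sum of Log(1-z) over the p-th roots z <> 1; this term cancels the cross
    term ln p ln s of (ln ps)^2/2, since 1 - u is asymptotic to s. Each functional equation of Li2
    is proved by a vanishing derivative along a path. Its constant is read off at a point where it
    is a value of Li2 or ln already in the span: Li2(-1) for inversion, Li2(1/2) and ln(1/2)^2 for
    reflection. *)

Fixpoint Rsum (f : nat -> R) (n : nat) : R :=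
  match n with O => 0%R | S m => (Rsum f m + f m)%R end.

Lemma Rsum_ext (f g : nat -> R) (n : nat) :
  (forall k, (k < n)%nat -> f k = g k) -> Rsum f n = Rsum g n.
Proof.
induction n as [|n IH]; intros H; simpl; [easy|].
rewrite IH, H by (try lia; intros; apply H; lia); easy.
Qed.

Lemma Rsum_le (f g : nat -> R) (n : nat) :
  (forall k, (k < n)%nat -> f k <= g k) -> Rsum f n <= Rsum g n.
Proof.
induction n as [|n IH]; intros H; simpl; [lra|].
apply Rplus_le_compat; [apply IH; intros; apply H|apply H]; lia.
Qed.

Lemma Rsum_plus (f g : nat -> R) (n : nat) :
  Rsum (fun k => f k + g k)%R n = (Rsum f n + Rsum g n)%R.
Proof. induction n as [|n IH]; simpl; [ring|rewrite IH; ring]. Qed.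

Lemma Rsum_scal (c : R) (f : nat -> R) (n : nat) :
  Rsum (fun k => c * f k)%R n = (c * Rsum f n)%R.
Proof. induction n as [|n IH]; simpl; [ring|rewrite IH; ring]. Qed.

Lemma Rsum_minus (f g : nat -> R) (n : nat) :
  Rsum (fun k => f k - g k)%R n = (Rsum f n - Rsum g n)%R.
Proof. induction n as [|n IH]; simpl; [ring|rewrite IH; ring]. Qed.

Lemma Rsum_Rabs (f : nat -> R) (n : nat) :
  Rabs (Rsum f n) <= Rsum (fun k => Rabs (f k)) n.
Proof.
induction n as [|n IH]; simpl; [rewrite Rabs_R0; lra|].
eapply Rle_trans; [apply Rabs_triang|lra].
Qed.

Lemma Rsum_const (c : R) (n : nat) : Rsum (fun _ => c) n = (INR n * c)%R.
Proof. induction n as [|n IH]; [simpl; ring|rewrite S_INR; simpl Rsum; rewrite IH; ring]. Qed.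

Lemma is_derive_Rsum (f df : nat -> R -> R) (n : nat) (x : R) :
  (forall k, (k < n)%nat -> is_derive (f k) x (df k x)) ->
  is_derive (fun y => Rsum (fun k => f k y) n) x (Rsum (fun k => df k x) n).
Proof.
induction n as [|n IH]; intros H; simpl.
- apply (is_derive_const (K := R_AbsRing) (V := R_NormedModule) 0%R).
- apply (is_derive_plus (V := R_NormedModule)); [apply IH; intros; apply H; lia|apply H; lia].
Qed.

Lemma is_lim_seq_inv_INR : is_lim_seq (fun n => / INR (S n))%R 0.
Proof.
replace (Finite 0) with (Rbar_inv p_infty) by easy.
apply is_lim_seq_inv; [|easy]; apply (is_lim_seq_incr_1 INR), is_lim_seq_INR.
Qed.

(** * The digamma function on the positive real axis *)

Lemma ln_le_sub_1 (x : R) : 0 < x -> ln x <= x - 1.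
Proof.
intros Hx; assert (H := exp_ineq1_le (ln x)); rewrite exp_ln in H by easy; lra.
Qed.

Lemma ln_ge_1_sub_inv (x : R) : 0 < x -> 1 - / x <= ln x.
Proof.
intros Hx; assert (H := ln_le_sub_1 (/ x) (Rinv_0_lt_compat _ Hx)).
rewrite ln_Rinv in H by easy; lra.
Qed.

(** The bounds telescope: B/((k+1)(k+2)) sums to B - B/(n+1). The lemma serves Gauss's limit, the
    digamma limit and the Herglotz series. *)
Lemma incr_bounded_seq_cv (u v : nat -> R) (B : R) :
  (forall n, u n = (u O + Rsum v n)%R) ->
  (forall k, 0 <= v k <= B / (INR (S k) * INR (S (S k)))) ->
  ex_finite_lim_seq u.
Proof.
intros Hu Hv.
assert (HB : 0 <= B).
{ specialize (Hv O); simpl in Hv; lra. }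
apply ex_finite_lim_seq_incr with (u O + B)%R.
- intros n; rewrite (Hu n), (Hu (S n)); simpl Rsum; specialize (Hv n); lra.
- intros n; rewrite Hu; apply Rplus_le_compat_l.
  apply Rle_trans with (B - B / INR (S n))%R.
  + induction n as [|n IH].
    * simpl; lra.
    * change (Rsum v (S n)) with (Rsum v n + v n)%R.
      assert (H1 := lt_0_INR (S n) ltac:(lia)); assert (H2 := lt_0_INR (S (S n)) ltac:(lia)).
      specialize (Hv n).
      replace (B / (INR (S n) * INR (S (S n))))%R with (B / INR (S n) - B / INR (S (S n)))%R in Hv.
      2: { rewrite (S_INR (S n)) in *; field; lra. }
      lra.
  + assert (H1 := lt_0_INR (S n) ltac:(lia)).
    assert (0 <= B / INR (S n)) by (apply Rdiv_le_0_compat; lra); lra.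
Qed.

(* Indexed from n = 1, where ln n makes sense. *)
Definition lngamma_seq (y : R) (n : nat) : R :=
  (ln (INR (fact (S n))) + y * ln (INR (S n)) - Rsum (fun k => ln (y + INR k)) (S (S n)))%R.

(** The derivative of [lngamma_seq] in [y]. *)
Definition digamma_seq (y : R) (n : nat) : R :=
  (ln (INR (S n)) - Rsum (fun k => / (y + INR k)) (S (S n)))%R.

Lemma ln_succ_bounds (n : nat) :
  / INR (S (S n)) <= ln (INR (S (S n))) - ln (INR (S n)) <= / INR (S n).
Proof.
assert (H1 := lt_0_INR (S n) ltac:(lia)); assert (H2 := lt_0_INR (S (S n)) ltac:(lia)).
rewrite <- ln_div by easy.
assert (Hq : 0 < INR (S (S n)) / INR (S n)) by (apply Rdiv_lt_0_compat; easy).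
assert (A := ln_le_sub_1 _ Hq); assert (B := ln_ge_1_sub_inv _ Hq).
rewrite (S_INR (S n)) in *; set (a := INR (S n)) in *.
replace ((a + 1) / a - 1)%R with (/ a)%R in A by (field; lra).
replace (1 - / ((a + 1) / a))%R with (/ (a + 1))%R in B by (field; lra).
lra.
Qed.

Lemma Rinv_mult_bound (y a : R) :
  0 < y -> 0 < a -> / a - / (a + 1 + y) <= (1 + y) / (a * (a + 1)).
Proof.
intros Hy Ha.
replace (/ a - / (a + 1 + y))%R with ((1 + y) / (a * (a + 1 + y)))%R by (field; lra).
apply Rmult_le_compat_l; [lra|]; apply Rinv_le_contravar; nra.
Qed.

(** The increment is y (ln(n+2) - ln(n+1)) - ln(1 + y/(n+2)). The bounds 1 - 1/x <= ln x <= x - 1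
    place it between 0 and y/(n+1) - y/(n+2+y). *)
Lemma lngamma_seq_cv (y : R) : 0 < y -> ex_finite_lim_seq (lngamma_seq y).
Proof.
intros Hy.
apply incr_bounded_seq_cv with
  (fun n => lngamma_seq y (S n) - lngamma_seq y n)%R (y * (1 + y))%R.
- induction n as [|n IH]; simpl Rsum; [ring|lra].
- intros n.
  assert (H1 := lt_0_INR (S n) ltac:(lia)); assert (H2 := lt_0_INR (S (S n)) ltac:(lia)).
  assert (E : (lngamma_seq y (S n) - lngamma_seq y n =
    y * (ln (INR (S (S n))) - ln (INR (S n))) - ln ((y + INR (S (S n))) / INR (S (S n))))%R).
  { unfold lngamma_seq; rewrite (fact_simpl (S n)), mult_INR, ln_mult, ln_div
      by (try lra; apply INR_fact_lt_0).
    change (Rsum (fun k => ln (y + INR k)) (S (S (S n)))) with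
      (Rsum (fun k => ln (y + INR k)) (S (S n)) + ln (y + INR (S (S n))))%R; ring. }
  rewrite E.
  assert (Hq : 0 < (y + INR (S (S n))) / INR (S (S n))) by (apply Rdiv_lt_0_compat; lra).
  assert (A := ln_le_sub_1 _ Hq); assert (B := ln_ge_1_sub_inv _ Hq).
  assert (D := ln_succ_bounds n).
  assert (M := Rinv_mult_bound y (INR (S n)) Hy H1).
  rewrite (S_INR (S n)) in *; set (a := INR (S n)) in *.
  replace ((y + (a + 1)) / (a + 1) - 1)%R with (y * / (a + 1))%R in A by (field; lra).
  replace (1 - / ((y + (a + 1)) / (a + 1)))%R with (y * / (a + 1 + y))%R in B by (field; lra).
  replace (y * (1 + y) / (a * (a + 1)))%R with (y * ((1 + y) / (a * (a + 1))))%R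
    by (field; lra).
  nra.
Qed.

Lemma digamma_seq_cv (y : R) : 0 < y -> ex_finite_lim_seq (digamma_seq y).
Proof.
intros Hy.
apply incr_bounded_seq_cv with
  (fun n => digamma_seq y (S n) - digamma_seq y n)%R (1 + y)%R.
- induction n as [|n IH]; simpl Rsum; [ring|lra].
- intros n.
  assert (H1 := lt_0_INR (S n) ltac:(lia)); assert (H2 := lt_0_INR (S (S n)) ltac:(lia)).
  assert (E : (digamma_seq y (S n) - digamma_seq y n =
    (ln (INR (S (S n))) - ln (INR (S n))) - / (y + INR (S (S n))))%R).
  { unfold digamma_seq.
    change (Rsum (fun k => / (y + INR k))%R (S (S (S n)))) with
      (Rsum (fun k => / (y + INR k))%R (S (S n)) + / (y + INR (S (S n))))%R; ring. }
  rewrite E.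
  assert (D := ln_succ_bounds n).
  assert (M := Rinv_mult_bound y (INR (S n)) Hy H1).
  rewrite (S_INR (S n)) in *; set (a := INR (S n)) in *.
  assert (/ (y + (a + 1)) <= / (a + 1)) by (apply Rinv_le_contravar; lra).
  replace (a + 1 + y)%R with (y + (a + 1))%R in M by ring.
  lra.
Qed.

Definition lngammaR (y : R) : R := real (Lim_seq (lngamma_seq y)).
Definition digammaR (y : R) : R := real (Lim_seq (digamma_seq y)).

Lemma is_lim_lngammaR (y : R) : 0 < y -> is_lim_seq (lngamma_seq y) (lngammaR y).
Proof. intros Hy; apply Lim_seq_correct', lngamma_seq_cv, Hy. Qed.

Lemma is_lim_digammaR (y : R) : 0 < y -> is_lim_seq (digamma_seq y) (digammaR y).
Proof. intros Hy; apply Lim_seq_correct', digamma_seq_cv, Hy. Qed.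

Lemma sum_inv_sqr_le (y : R) (n : nat) :
  0 < y -> Rsum (fun k => / (y + INR k) * / (y + INR k))%R (S n) <= / y * / y + / y.
Proof.
intros Hy.
(* The extra term -1/(y+n) makes the bound telescope, so that the induction closes. *)
apply Rle_trans with (/ y * / y + / y - / (y + INR n))%R.
- induction n as [|n IH].
  + simpl; rewrite Rplus_0_r; lra.
  + change (Rsum (fun k => / (y + INR k) * / (y + INR k))%R (S (S n))) with
      (Rsum (fun k => / (y + INR k) * / (y + INR k))%R (S n) +
       / (y + INR (S n)) * / (y + INR (S n)))%R.
    assert (H1 := pos_INR n); rewrite S_INR in *; set (a := INR n) in *.
    assert (/ (y + (a + 1)) * / (y + (a + 1)) <= / (y + a) - / (y + (a + 1))).
    { replace (/ (y + a) - / (y + (a + 1)))%R with (/ (y + a) * / (y + (a + 1)))%R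
        by (field; lra).
      apply Rmult_le_compat_r; [apply Rlt_le, Rinv_0_lt_compat; lra|].
      apply Rinv_le_contravar; lra. }
    lra.
- assert (H1 := pos_INR n).
  assert (0 < / (y + INR n)) by (apply Rinv_0_lt_compat; lra); lra.
Qed.

Lemma ln_1p_quadratic (z : R) : -1 / 2 <= z -> Rabs (ln (1 + z) - z) <= 2 * (z * z).
Proof.
intros Hz.
assert (A := ln_le_sub_1 (1 + z) ltac:(lra)); assert (B := ln_ge_1_sub_inv (1 + z) ltac:(lra)).
rewrite Rabs_left1 by lra.
assert (z - z * z * / (1 + z) = 1 - / (1 + z))%R by (field; lra).
assert (/ (1 + z) <= 2).
{ replace 2%R with (/ (1 / 2))%R by field; apply Rinv_le_contravar; lra. }
assert (0 <= z * z) by nra.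
nra.
Qed.

(** A second-order estimate uniform in [n] survives the limit and gives the derivative of the limit
    function. The condition on [h] ensures h/(y+k) >= -1/2, the range of [ln_1p_quadratic]. *)
Lemma lngammaR_taylor (y h : R) :
  0 < y -> Rabs h <= y / 2 ->
  Rabs (lngammaR (y + h) - lngammaR y - h * digammaR y) <=
    2 * (/ y * / y + / y) * (h * h).
Proof.
intros Hy Hh; apply Rabs_le_between in Hh.
set (u := fun n => (lngamma_seq (y + h) n - lngamma_seq y n - h * digamma_seq y n)%R).
assert (Lu : is_lim_seq u (lngammaR (y + h) - lngammaR y - h * digammaR y)%R).
{ apply is_lim_seq_minus'.
  - apply is_lim_seq_minus'; apply is_lim_lngammaR; lra.
  - apply (is_lim_seq_scal_l _ h (digammaR y)), is_lim_digammaR, Hy. }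
assert (Bu : forall n, Rabs (u n) <= 2 * (/ y * / y + / y) * (h * h)).
{ intros n.
  assert (E : u n = (- Rsum (fun k => ln (1 + h * / (y + INR k)) - h * / (y + INR k)) (S (S n)))%R).
  { unfold u, lngamma_seq, digamma_seq.
    rewrite Rsum_minus, Rsum_scal.
    rewrite (Rsum_ext (fun k => ln (1 + h * / (y + INR k)))%R
      (fun k => ln (y + h + INR k) - ln (y + INR k))%R), Rsum_minus; [ring|].
    intros k _; assert (Hk := pos_INR k).
    rewrite <- ln_div by lra; f_equal; field; lra. }
  rewrite E, Rabs_Ropp; eapply Rle_trans; [apply Rsum_Rabs|].
  apply Rle_trans with (Rsum (fun k => 2 * (h * h) * (/ (y + INR k) * / (y + INR k)))%R (S (S n))).
  - apply Rsum_le; intros k _; assert (Hk := pos_INR k).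
    assert (Hi : 0 < / (y + INR k) <= / y)
      by (split; [apply Rinv_0_lt_compat|apply Rinv_le_contravar]; lra).
    assert (Ei : (/ y * y = 1)%R) by (field; lra).
    eapply Rle_trans; [apply ln_1p_quadratic; nra|right; ring].
  - rewrite Rsum_scal; assert (H := sum_inv_sqr_le y (S n) Hy).
    assert (0 <= h * h) by nra; nra. }
assert (Lb := is_lim_seq_abs _ _ Lu).
exact (is_lim_seq_le _ _ (Rbar_abs _) _ Bu Lb (is_lim_seq_const _)).
Qed.

Lemma is_derive_lngammaR (y : R) : 0 < y -> is_derive lngammaR y (digammaR y).
Proof.
intros Hy; apply is_derive_Reals; intros eps He.
set (K := (2 * (/ y * / y + / y))%R).
assert (HK : 0 < K).
{ unfold K; assert (0 < / y) by (apply Rinv_0_lt_compat; lra); nra. }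
assert (Hd : 0 < Rmin (y / 2) (eps / K)).
{ apply Rmin_glb_lt; [lra|apply Rdiv_lt_0_compat; lra]. }
exists (mkposreal _ Hd); intros h Hh0 Hh; simpl in Hh.
assert (Hh1 := Rlt_le_trans _ _ _ Hh (Rmin_l _ _)).
assert (Hh2 := Rlt_le_trans _ _ _ Hh (Rmin_r _ _)).
assert (T := lngammaR_taylor y h Hy (Rlt_le _ _ Hh1)).
replace ((lngammaR (y + h) - lngammaR y) / h - digammaR y)%R
  with ((lngammaR (y + h) - lngammaR y - h * digammaR y) / h)%R by (field; easy).
unfold Rdiv; rewrite Rabs_mult, Rabs_inv.
assert (Ha := Rabs_pos_lt _ Hh0).
apply Rle_lt_trans with (K * Rabs h)%R.
- apply Rmult_le_reg_r with (Rabs h); [easy|].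
  rewrite Rmult_assoc, Rinv_l, Rmult_1_r by lra.
  replace (K * Rabs h * Rabs h)%R with (K * (Rabs h * Rabs h))%R by ring.
  rewrite <- Rabs_mult, (Rabs_pos_eq (h * h)) by nra; exact T.
- apply Rmult_lt_reg_r with (/ K)%R; [apply Rinv_0_lt_compat; easy|].
  replace (K * Rabs h * / K)%R with (Rabs h) by (field; lra); exact Hh2.
Qed.

Lemma Cexp_RtoC (r : R) : Cexp r = exp r.
Proof.
unfold Cexp, RtoC; simpl; rewrite cos_0, sin_0; f_equal; ring.
Qed.

Lemma Crising_pos (y : R) (n : nat) :
  0 < y -> Crising y n = RtoC (exp (Rsum (fun k => ln (y + INR k)) n)).
Proof.
intros Hy; induction n as [|n IH]; simpl.
- rewrite exp_0; reflexivity.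
- assert (H := pos_INR n).
  rewrite IH, exp_plus, exp_ln by lra.
  now rewrite <- RtoC_plus, <- RtoC_mult.
Qed.

Lemma filterlim_RtoC (T : Type) (F : (T -> Prop) -> Prop) (f : T -> R) (l : R) :
  Filter F -> filterlim f F (locally l) ->
  filterlim (fun t => RtoC (f t)) F (@locally C_UniformSpace (RtoC l)).
Proof.
intros FF Hf; apply (proj2 (@filterlim_locally _ C_UniformSpace F FF _ _)).
intros eps; generalize (proj1 (filterlim_locally f l) Hf eps); apply filter_imp.
intros t Ht; split; [exact Ht|apply ball_center].
Qed.

Lemma Gamma_pos (y : R) : 0 < y -> Gamma y = RtoC (exp (lngammaR y)).
Proof.
intros Hy; apply Clim_unique; [apply eventually_filter|].
apply (filterlim_ext_loc (fun n => RtoC (exp (lngamma_seq y (pred n))))).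
- exists 1%nat; intros [|n] Hn; [lia|].
  assert (H := lt_0_INR (S n) ltac:(lia)).
  simpl pred; unfold lngamma_seq; rewrite Crising_pos by easy.
  rewrite <- RtoC_mult, Cexp_RtoC.
  rewrite <- RtoC_mult, <- RtoC_div by (apply Rgt_not_eq, exp_pos).
  f_equal; unfold Rminus; rewrite !exp_plus, exp_Ropp, exp_ln by apply INR_fact_lt_0.
  reflexivity.
- apply filterlim_RtoC; [apply eventually_filter|].
  apply (filterlim_comp _ _ _ (fun n => lngamma_seq y (pred n)) exp _ (locally (lngammaR y))).
  + change (is_lim_seq (fun n => lngamma_seq y (pred n)) (lngammaR y)).
    apply is_lim_seq_incr_1, is_lim_lngammaR, Hy.
  + apply (ex_derive_continuous (V := R_NormedModule) exp); exists (exp (lngammaR y)).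
    apply is_derive_exp.
Qed.

(* [C_derive] takes its limit along the real direction only. *)
Lemma digamma_pos (y : R) : 0 < y -> digamma y = RtoC (digammaR y).
Proof.
intros Hy; unfold digamma.
assert (D : is_derive (fun t => exp (lngammaR t)) y (digammaR y * exp (lngammaR y))%R).
{ apply (is_derive_comp exp lngammaR); [apply is_derive_exp|now apply is_derive_lngammaR]. }
assert (E : C_derive Gamma y = RtoC (digammaR y * exp (lngammaR y))%R).
{ assert (Q : forall t : R, 0 < t ->
    (Gamma (t, 0%R) - Gamma y) / ((t, 0%R) - y) =
    RtoC ((exp (lngammaR t) - exp (lngammaR y)) / (t - y))%R \/ t = y).
  { intros t Ht; destruct (Req_dec t y) as [->|Hn]; [now right|left].
    change (t, 0%R) with (RtoC t).
    rewrite !Gamma_pos by easy.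
    rewrite <- !RtoC_minus, <- RtoC_div by lra; reflexivity. }
  unfold C_derive, C_lim, RtoC; simpl fst; simpl snd.
  assert (Lr : is_lim (fun t => (exp (lngammaR t) - exp (lngammaR y)) / (t - y))%R y
     (digammaR y * exp (lngammaR y))%R).
  { apply is_derive_Reals in D; intros P [eps HP].
    destruct (D eps (cond_pos eps)) as [d Hd].
    exists d; intros t Ht Hn; apply HP; change R in t.
    specialize (Hd (t - y)%R ltac:(lra) Ht).
    replace (y + (t - y))%R with t in Hd by lra; exact Hd. }
  assert (LQ : forall (g : C -> R) (l : R), 
     is_lim (fun t => g (RtoC ((exp (lngammaR t) - exp (lngammaR y)) / (t - y))%R)) y l ->
     real (Lim (fun t => g ((Gamma (t, 0%R) - Gamma (y, 0%R)) / ((t, 0%R) - (y, 0%R)))) y) = l).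
  { intros g l H; replace l with (real (Finite l)) by easy; f_equal.
    apply is_lim_unique; revert H; apply is_lim_ext_loc.
    exists (mkposreal y Hy); intros t Ht Hn.
    change (Rabs (t - y) < y) in Ht; apply Rabs_lt_between' in Ht.
    destruct (Q t ltac:(lra)) as [E|E]; [|easy].
    change (y, 0%R) with (RtoC y); now rewrite E. }
  f_equal.
  - apply (LQ fst); exact Lr.
  - apply (LQ snd); simpl; apply is_lim_const. }
rewrite E, Gamma_pos by easy.
rewrite <- RtoC_div by (apply Rgt_not_eq, exp_pos).
f_equal; field; apply Rgt_not_eq, exp_pos.
Qed.

(** * Laplace-type integrals *)

(** Monotonicity of g - f and g + f. It stands for integrating |f'| <= g' over [a, b]. *)
Lemma mean_value_bound (f g df dg : R -> R) (a b : R) :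
  a <= b ->
  (forall t, a <= t <= b -> is_derive f t (df t)) ->
  (forall t, a <= t <= b -> is_derive g t (dg t)) ->
  (forall t, a <= t <= b -> Rabs (df t) <= dg t) ->
  Rabs (f b - f a) <= g b - g a.
Proof.
intros Hab Hf Hg H.
assert (G : forall h dh : R -> R,
  (forall t, a <= t <= b -> is_derive h t (dh t)) ->
  (forall t, a <= t <= b -> 0 <= dh t) -> h a <= h b).
{ intros h dh Hh Hp.
  destruct (MVT_gen h a b dh) as [c [Hc E]].
  - intros t; rewrite Rmin_left, Rmax_right by easy; intros Ht; apply Hh; lra.
  - intros t; rewrite Rmin_left, Rmax_right by easy; intros Ht.
    apply derivable_continuous_pt; exists (dh t); apply is_derive_Reals, Hh; lra.
  - rewrite Rmin_left, Rmax_right in Hc by easy; specialize (Hp c Hc); nra. }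
assert (G1 := G (fun t => g t - f t)%R (fun t => dg t - df t)%R
  (fun t Ht => is_derive_minus (V := R_NormedModule) _ _ _ _ _ (Hg t Ht) (Hf t Ht))).
assert (G2 := G (fun t => g t + f t)%R (fun t => dg t + df t)%R
  (fun t Ht => is_derive_plus (V := R_NormedModule) _ _ _ _ _ (Hg t Ht) (Hf t Ht))).
apply Rabs_le; split.
- assert (g a + f a <= g b + f b); [apply G2|lra].
  intros t Ht; specialize (H t Ht); apply Rabs_le_between in H; lra.
- assert (g a - f a <= g b - f b); [apply G1|lra].
  intros t Ht; specialize (H t Ht); apply Rabs_le_between in H; lra.
Qed.

(** The improper version, obtained from [a, b] as b goes to infinity. Applied to a difference, it
    compares two functions through their derivatives. *)
Lemma decay_bound (f g df dg : R -> R) (a : R) :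
  (forall t, a <= t -> is_derive f t (df t)) ->
  (forall t, a <= t -> is_derive g t (dg t)) ->
  (forall t, a <= t -> Rabs (df t) <= - dg t) ->
  is_lim f p_infty 0 -> is_lim g p_infty 0 ->
  Rabs (f a) <= g a.
Proof.
intros Hf Hg H Lf Lg.
assert (B : forall b, a <= b -> Rabs (f b - f a) <= g a - g b).
{ intros b Hb; replace (g a - g b)%R with (- g b - - g a)%R by ring.
  apply (mean_value_bound f (fun t => - g t)%R df (fun t => - dg t)%R); try easy.
  - intros t Ht; apply Hf; lra.
  - intros t Ht; apply (is_derive_opp (V := R_NormedModule)), Hg; lra.
  - intros t Ht; apply H; lra. }
assert (L1 : is_lim (fun b => f b - f a)%R p_infty (0 - f a)%R)
  by (apply is_lim_minus'; [exact Lf|apply is_lim_const]).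
assert (L2 : is_lim (fun b => g a - g b)%R p_infty (g a - 0)%R)
  by (apply is_lim_minus'; [apply is_lim_const|exact Lg]).
assert (L3 := is_lim_opp _ _ _ L2).
assert (K1 : Rbar_le (0 - f a)%R (g a - 0)%R).
{ refine (is_lim_le_loc _ _ p_infty _ _ _ L1 L2).
  exists a; intros b Hb; specialize (B b (Rlt_le _ _ Hb)); apply Rabs_le_between in B; lra. }
assert (K2 : Rbar_le (Rbar_opp (g a - 0)%R) (0 - f a)%R).
{ refine (is_lim_le_loc _ _ p_infty _ _ _ L3 L1).
  exists a; intros b Hb; specialize (B b (Rlt_le _ _ Hb)); apply Rabs_le_between in B; lra. }
simpl in K1, K2; apply Rabs_le; lra.
Qed.

(** The integral of e^-t f(e^-t) over t >= s, brought to a bounded interval by v = e^-t. *)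
Definition exp_RInt (f : R -> R) (s : R) : R := RInt f 0 (exp (- s)).

Lemma exp_neg_bounds (s : R) : 0 < s -> 0 < exp (- s) < 1.
Proof.
intros Hs; split; [apply exp_pos|rewrite <- exp_0; apply exp_increasing; lra].
Qed.

Lemma exp_RInt_derive (f : R -> R) (s : R) :
  (forall u, 0 <= u < 1 -> continuous f u) -> 0 < s ->
  is_derive (exp_RInt f) s (- (exp (- s) * f (exp (- s))))%R.
Proof.
intros Hf Hs; assert (HU := exp_neg_bounds s Hs).
replace (- (exp (- s) * f (exp (- s))))%R with
  (scal (- exp (- s)) (f (exp (- s))))%R.
2: { unfold scal; simpl; unfold mult; simpl; ring. }
apply (is_derive_comp (fun b => RInt f 0 b) (fun s => exp (- s))).
- apply (is_derive_RInt f _ 0); [|apply Hf; lra].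
  assert (O := open_and _ _ (open_gt 0) (open_lt 1)).
  generalize (O (exp (- s)) HU); apply filter_imp; intros b Hb.
  apply (RInt_correct (V := R_CompleteNormedModule)).
  apply (ex_RInt_continuous (V := R_CompleteNormedModule)).
  intros t; rewrite Rmin_left, Rmax_right by lra; intros Ht; apply Hf; lra.
- auto_derive; [easy|ring].
Qed.

Lemma is_lim_exp_neg : is_lim (fun s => exp (- s)) p_infty 0.
Proof.
apply (is_lim_comp exp Ropp p_infty 0 m_infty).
- apply is_lim_exp_m.
- apply (is_lim_opp (fun x => x) p_infty p_infty), is_lim_id.
- exists 0%R; intros; easy.
Qed.

Lemma exp_RInt_lim (f : R -> R) :
  (forall u, 0 <= u < 1 -> continuous f u) -> is_lim (exp_RInt f) p_infty 0.
Proof.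
intros Hf.
set (K := (Rabs (f 0%R) + 1)%R).
assert (HK : 0 < K) by (unfold K; assert (H := Rabs_pos (f 0%R)); lra).
assert (B : exists d : posreal, forall u, Rabs (u - 0) < d -> Rabs (f u) <= K).
{ destruct (proj1 (filterlim_locally (F := locally 0%R) f (f 0%R)) (Hf 0%R ltac:(lra)) (mkposreal 1 Rlt_0_1)) as [d Hd].
  exists d; intros u Hu; specialize (Hd u Hu).
  change (Rabs (f u - f 0%R) < 1) in Hd.
  replace (f u) with (f u - f 0%R + f 0%R)%R by ring.
  eapply Rle_trans; [apply Rabs_triang|unfold K; lra]. }
destruct B as [d Hd].
assert (L := is_lim_scal_l _ K _ _ is_lim_exp_neg); simpl in L; rewrite Rmult_0_r in L.
apply (is_lim_le_le_loc (fun s => - (K * exp (- s)))%R (fun s => K * exp (- s))%R); [| |exact L].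
- assert (L1 := is_lim_exp_neg).
  apply is_lim_spec in L1; destruct (L1 d) as [M HM].
  exists (Rmax M 0); intros s Hs.
  assert (Hs1 := Rle_lt_trans _ _ _ (Rmax_l _ _) Hs).
  assert (Hs2 := Rle_lt_trans _ _ _ (Rmax_r _ _) Hs).
  assert (HU := exp_neg_bounds s Hs2).
  specialize (HM s Hs1); simpl in HM; rewrite Rminus_0_r, Rabs_pos_eq in HM by lra.
  apply Rabs_le_between; unfold exp_RInt.
  replace (K * exp (- s))%R with ((exp (- s) - 0) * K)%R by ring.
  apply abs_RInt_le_const; [lra| |].
  + apply (ex_RInt_continuous (V := R_CompleteNormedModule)).
    intros t; rewrite Rmin_left, Rmax_right by lra; intros Ht; apply Hf; lra.
  + intros t Ht; apply Hd; rewrite Rminus_0_r, Rabs_pos_eq; lra.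
- assert (L1 := is_lim_opp _ _ _ L); simpl in L1; rewrite Ropp_0 in L1; exact L1.
Qed.

(* The exponential integral; at [v = 0] the integrand has the junk value
   [- / ln 0 = 0], which is also its limit. *)
Definition expint : R -> R := exp_RInt (fun v => - / ln v)%R.

Lemma continuous_inv_ln (u : R) : 0 <= u < 1 -> continuous (fun v => - / ln v)%R u.
Proof.
intros Hu; destruct (Req_dec u 0) as [->|Hn].
- apply (proj2 (filterlim_locally (F := locally 0%R) _ _)); intros eps.
  (* For 0 < v < exp(-1/eps) one has -ln v > 1/eps. For v <= 0 both [ln v] and its inverse are 0 by
     convention, so continuity at 0 is two-sided. *)
  exists (mkposreal _ (exp_pos (- / eps))); intros v Hv.
  change (Rabs (- / ln v - - / ln 0) < eps); change (Rabs (v - 0) < exp (- / eps)) in Hv.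
  assert (E0 : forall x, x <= 0 -> ln x = 0%R).
  { intros x Hx; unfold ln; destruct (Rlt_dec 0 x); [exfalso; lra|easy]. }
  rewrite (E0 0%R) by lra; rewrite Rinv_0.
  destruct (Rle_dec v 0) as [Hv0|Hv0].
  + rewrite (E0 v) by easy; rewrite Rinv_0, Rminus_eq_0, Rabs_R0; apply cond_pos.
  + apply Rnot_le_lt in Hv0; rewrite Rminus_0_r, Rabs_pos_eq in Hv by lra.
    assert (Hl : ln v < - / eps).
    { rewrite <- (ln_exp (- / eps)); apply ln_increasing; easy. }
    assert (He := Rinv_0_lt_compat _ (cond_pos eps)).
    replace (- / ln v - - 0)%R with (/ (- ln v))%R by (field; lra).
    rewrite Rabs_pos_eq by (apply Rlt_le, Rinv_0_lt_compat; lra).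
    rewrite <- (Rinv_inv eps); apply Rinv_lt_contravar; [|lra].
    apply Rmult_lt_0_compat; lra.
- apply (ex_derive_continuous (V := R_NormedModule)); auto_derive.
  assert (ln u < 0) by (rewrite <- ln_1; apply ln_increasing; lra).
  repeat split; lra.
Qed.

Lemma expint_derive (s : R) : 0 < s -> is_derive expint s (- (exp (- s) / s))%R.
Proof.
intros Hs.
assert (H := exp_RInt_derive _ s continuous_inv_ln Hs); unfold expint.
cbv beta in H; rewrite ln_exp in H.
replace (- (exp (- s) / s))%R with (- (exp (- s) * - / - s))%R by (field; lra).
exact H.
Qed.

Lemma expint_lim : is_lim expint p_infty 0.
Proof. apply exp_RInt_lim, continuous_inv_ln. Qed.

Lemma exp_neg_pow (s : R) (n : nat) : (exp (- s) ^ n = exp (- (INR n * s)))%R.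
Proof.
induction n as [|n IH]; [simpl; rewrite Rmult_0_l, Ropp_0, exp_0; easy|].
rewrite S_INR; simpl pow; rewrite IH, <- exp_plus; f_equal; ring.
Qed.

Lemma pow_lt_1 (u : R) (n : nat) : 0 <= u < 1 -> (0 < n)%nat -> 0 <= u ^ n < 1.
Proof.
intros Hu Hn; destruct n as [|n]; [lia|].
assert (0 <= u ^ n <= 1).
{ split; [apply pow_le; lra|rewrite <- (pow1 n); apply pow_incr; lra]. }
simpl; nra.
Qed.

(* Sum over k >= 0 of q u^(N + q k) / (N + q k) with u = e^-s. *)
Definition arith_log (q N : nat) : R -> R :=
  exp_RInt (fun u => INR q * u ^ pred N / (1 - u ^ q))%R.

Lemma continuous_arith_log_integrand (q N : nat) (u : R) :
  (0 < q)%nat -> 0 <= u < 1 ->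
  continuous (fun u => INR q * u ^ pred N / (1 - u ^ q))%R u.
Proof.
intros Hq Hu; assert (H := pow_lt_1 u q Hu Hq).
apply (ex_derive_continuous (V := R_NormedModule)); auto_derive; lra.
Qed.

Lemma arith_log_derive (q N : nat) (s : R) :
  (0 < q)%nat -> (0 < N)%nat -> 0 < s ->
  is_derive (arith_log q N) s (- (INR q * exp (- s) ^ N / (1 - exp (- s) ^ q)))%R.
Proof.
intros Hq HN Hs.
assert (H := exp_RInt_derive _ s (fun u => continuous_arith_log_integrand q N u Hq) Hs).
destruct N as [|N]; [lia|]; simpl pred in H.
replace (- (INR q * exp (- s) ^ S N / (1 - exp (- s) ^ q)))%R with
  (- (exp (- s) * (INR q * exp (- s) ^ N / (1 - exp (- s) ^ q))))%R; [exact H|].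
unfold Rdiv; simpl pow; ring.
Qed.

Lemma arith_log_lim (q N : nat) : (0 < q)%nat -> is_lim (arith_log q N) p_infty 0.
Proof. intros Hq; apply exp_RInt_lim; intros u Hu; now apply continuous_arith_log_integrand. Qed.

Lemma is_lim_comp_scal (f : R -> R) (c : R) :
  0 < c -> is_lim f p_infty 0 -> is_lim (fun s => f (c * s)%R) p_infty 0.
Proof.
intros Hc Hf; apply (is_lim_comp f (fun s => c * s)%R p_infty 0 p_infty); [exact Hf| |].
- assert (H := is_lim_scal_l (fun s => s) c _ _ (is_lim_id p_infty)).
  replace p_infty with (Rbar_mult c p_infty) at 2; [exact H|].
  apply is_Rbar_mult_unique, is_Rbar_mult_sym, is_Rbar_mult_p_infty_pos; easy.
- exists 0%R; intros; easy.
Qed.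

Lemma exp_pow_lim (c : R) (N : nat) :
  (0 < N)%nat -> is_lim (fun s => c * exp (- s) ^ N)%R p_infty 0.
Proof.
intros HN; replace (Finite 0) with (Rbar_mult c 0) by (simpl; now rewrite Rmult_0_r).
apply is_lim_scal_l, (is_lim_ext (fun s => exp (- (INR N * s)))).
- intros s; now rewrite exp_neg_pow.
- apply (is_lim_comp_scal (fun t => exp (- t))); [now apply (lt_0_INR N)|apply is_lim_exp_neg].
Qed.

Lemma exp_pow_derive (c s : R) (N : nat) :
  is_derive (fun s => c * exp (- s) ^ N)%R s (- (INR N * c * exp (- s) ^ N))%R.
Proof.
destruct N as [|N].
- simpl; replace (- (0 * c * 1))%R with 0%R by ring.
  apply (is_derive_const (K := R_AbsRing) (V := R_NormedModule) (c * 1)%R).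
- auto_derive; [easy|]; simpl pred; change (exp (- s) ^ S N)%R with (exp (- s) * exp (- s) ^ N)%R.
  change (match N with O => 1%R | S _ => (INR N + 1)%R end) with (INR (S N)); ring.
Qed.

(** This is the integral of e^(-Nt) (q/(1 - e^(-qt)) - 1/t) over t >= s. *)
Definition psi_laplace (q N : nat) (s : R) : R := (arith_log q N s - expint (INR N * s))%R.

Lemma psi_laplace_derive (q N : nat) (s : R) :
  (0 < q)%nat -> (0 < N)%nat -> 0 < s ->
  is_derive (psi_laplace q N) s
    (- (exp (- s) ^ N * (INR q / (1 - exp (- s) ^ q) - / s)))%R.
Proof.
intros Hq HN Hs.
assert (H1 := lt_0_INR N HN).
assert (H2 := pow_lt_1 (exp (- s)) q ltac:(assert (H := exp_neg_bounds s Hs); lra) Hq).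
replace (- (exp (- s) ^ N * (INR q / (1 - exp (- s) ^ q) - / s)))%R with
  (minus (- (INR q * exp (- s) ^ N / (1 - exp (- s) ^ q)))
    (scal (INR N) (- (exp (- (INR N * s)) / (INR N * s)))))%R.
- apply (is_derive_minus (V := R_NormedModule)); [now apply arith_log_derive|].
  apply (is_derive_comp expint (fun s => INR N * s)%R).
  + apply expint_derive; nra.
  + auto_derive; [easy|ring].
- rewrite <- exp_neg_pow; unfold minus, plus, opp, scal; simpl; unfold mult; simpl.
  field; repeat split; lra.
Qed.

(** With t = qs this reads 0 <= 1/(1 - e^-t) - 1/t <= 1, from e^-t >= 1 - t and e^t >= 1 + t. The
    poles at 0 cancel, which keeps the effect of the cut-off bounded. *)
Lemma laplace_weight_bounds (q : nat) (s : R) :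
  (0 < q)%nat -> 0 < s -> 0 <= INR q / (1 - exp (- s) ^ q) - / s <= INR q.
Proof.
intros Hq Hs; rewrite exp_neg_pow.
assert (H1 := lt_0_INR q Hq); set (t := (INR q * s)%R).
assert (Ht : 0 < t) by (apply Rmult_lt_0_compat; easy).
assert (Hb := exp_neg_bounds t Ht).
assert (Ha := exp_ineq1_le (- t)); assert (Hc := exp_ineq1_le t).
assert (Ee : (exp (- t) * exp t = 1)%R) by (rewrite <- exp_plus, Rplus_opp_l, exp_0; easy).
replace (/ s)%R with (INR q * / t)%R by (unfold t; field; lra).
assert (G : 0 <= / (1 - exp (- t)) - / t <= 1).
{ split.
  - assert (/ t <= / (1 - exp (- t))) by (apply Rinv_le_contravar; lra); lra.
  - assert (/ (1 - exp (- t)) <= / (t / (1 + t))).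
    { apply Rinv_le_contravar; [apply Rdiv_lt_0_compat; lra|].
      apply Rmult_le_reg_r with (1 + t)%R; [lra|].
      replace (t / (1 + t) * (1 + t))%R with t by (field; lra); nra. }
    replace (/ (t / (1 + t)))%R with (/ t + 1)%R in H by (field; lra); lra. }
unfold Rdiv; nra.
Qed.

Lemma psi_laplace_lim (q N : nat) :
  (0 < q)%nat -> (0 < N)%nat -> is_lim (psi_laplace q N) p_infty 0.
Proof.
intros Hq HN; replace (Finite 0) with (Finite (0 - 0)%R) by (f_equal; ring).
apply is_lim_minus'; [now apply arith_log_lim|].
apply is_lim_comp_scal; [now apply (lt_0_INR N)|apply expint_lim].
Qed.

Lemma psi_laplace_derive_bound (q N : nat) (t : R) :
  (0 < q)%nat -> (0 < N)%nat -> 0 < t ->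
  Rabs (- (exp (- t) ^ N * (INR q / (1 - exp (- t) ^ q) - / t))) <=
  INR N * (INR q / INR N) * exp (- t) ^ N.
Proof.
intros Hq HN Ht.
assert (Hw := laplace_weight_bounds q t Hq Ht).
assert (Hp := pow_lt _ N (exp_pos (- t))).
assert (HN' := lt_0_INR N HN).
rewrite Rabs_Ropp, Rabs_pos_eq by (apply Rmult_le_pos; lra).
replace (INR N * (INR q / INR N))%R with (INR q) by (field; lra); nra.
Qed.

Lemma psi_laplace_le (q N : nat) (s : R) :
  (0 < q)%nat -> (0 < N)%nat -> 0 < s ->
  Rabs (psi_laplace q N s) <= INR q / INR N * exp (- s) ^ N.
Proof.
intros Hq HN Hs.
apply (decay_bound (psi_laplace q N) (fun s => INR q / INR N * exp (- s) ^ N)%R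
  (fun s => - (exp (- s) ^ N * (INR q / (1 - exp (- s) ^ q) - / s)))%R
  (fun s => - (INR N * (INR q / INR N) * exp (- s) ^ N))%R).
- intros t Ht; apply psi_laplace_derive; try easy; lra.
- intros t Ht; apply exp_pow_derive.
- intros t Ht; rewrite Ropp_involutive; apply psi_laplace_derive_bound; try easy; lra.
- now apply psi_laplace_lim.
- now apply exp_pow_lim.
Qed.

Lemma psi_laplace_increment (q N : nat) (a b : R) :
  (0 < q)%nat -> (0 < N)%nat -> 0 < a <= b ->
  Rabs (psi_laplace q N b - psi_laplace q N a) <=
    INR q / INR N * exp (- a) ^ N - INR q / INR N * exp (- b) ^ N.
Proof.
intros Hq HN Hab.
replace (INR q / INR N * exp (- a) ^ N - INR q / INR N * exp (- b) ^ N)%R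
  with (- (INR q / INR N * exp (- b) ^ N) - - (INR q / INR N * exp (- a) ^ N))%R by ring.
apply (mean_value_bound (psi_laplace q N) (fun s => - (INR q / INR N * exp (- s) ^ N))%R
  (fun s => - (exp (- s) ^ N * (INR q / (1 - exp (- s) ^ q) - / s)))%R
  (fun s => - - (INR N * (INR q / INR N) * exp (- s) ^ N))%R); [lra| | |].
- intros t Ht; apply psi_laplace_derive; try easy; lra.
- intros t Ht; apply (is_derive_opp (V := R_NormedModule)), exp_pow_derive.
- intros t Ht; rewrite Ropp_involutive; apply psi_laplace_derive_bound; try easy; lra.
Qed.

(** One step of a geometric series: q u^N/(1-u^q) - q u^(N+q)/(1-u^q) = q u^N. Hence both sides have
    the same derivative in s and the same limit 0. *)
Lemma arith_log_shift (q N : nat) (s : R) :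
  (0 < q)%nat -> (0 < N)%nat -> 0 < s ->
  (arith_log q N s - arith_log q (N + q) s = INR q / INR N * exp (- s) ^ N)%R.
Proof.
intros Hq HN Hs; assert (HN' := lt_0_INR N HN).
set (f := fun s => (arith_log q N s - arith_log q (N + q) s - INR q / INR N * exp (- s) ^ N)%R).
enough (H : Rabs (f s) <= 0).
{ assert (f s = 0)%R by (apply Rabs_eq_0; assert (H1 := Rabs_pos (f s)); lra).
  unfold f in *; lra. }
(* With the zero majorant, [decay_bound] becomes a uniqueness statement. *)
apply (decay_bound f (fun _ => 0%R) (fun _ => 0%R) (fun _ => 0%R)).
- intros t Ht.
  assert (H2 := pow_lt_1 (exp (- t)) q
    ltac:(assert (H := exp_neg_bounds t ltac:(lra)); lra) Hq).
  replace 0%R with (minus (minus (- (INR q * exp (- t) ^ N / (1 - exp (- t) ^ q)))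
    (- (INR q * exp (- t) ^ (N + q) / (1 - exp (- t) ^ q))))
    (- (INR N * (INR q / INR N) * exp (- t) ^ N)))%R.
  + repeat apply (is_derive_minus (V := R_NormedModule)).
    * apply arith_log_derive; try easy; lra.
    * apply arith_log_derive; try lia; lra.
    * apply exp_pow_derive.
  + unfold minus, plus, opp; simpl; rewrite pow_add; field; lra.
- intros; apply (is_derive_const (K := R_AbsRing) (V := R_NormedModule) 0%R).
- intros; rewrite Rabs_R0; lra.
- unfold f; replace (Finite 0) with (Finite (0 - 0 - 0)%R) by (f_equal; ring).
  repeat apply is_lim_minus'; try now apply arith_log_lim.
  now apply exp_pow_lim.
- apply is_lim_const.
Qed.

Lemma arith_log_shift_sum (q N K : nat) (s : R) :
  (0 < q)%nat -> (0 < N)%nat -> 0 < s ->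
  (arith_log q N s - arith_log q (N + q * K) s =
   Rsum (fun k => INR q / INR (N + q * k) * exp (- s) ^ (N + q * k)) K)%R.
Proof.
intros Hq HN Hs; induction K as [|K IH].
- rewrite Nat.mul_0_r, Nat.add_0_r; simpl; ring.
- simpl Rsum; rewrite <- IH, <- arith_log_shift by (try easy; lia).
  replace (N + q * S K)%nat with (N + q * K + q)%nat by lia; ring.
Qed.

Lemma one_sub_exp_div_bounds (t : R) : 0 < t -> 0 <= (1 - exp (- t)) / t <= 1.
Proof.
intros Ht; assert (Hb := exp_neg_bounds t Ht); assert (Ha := exp_ineq1_le (- t)).
split; [apply Rdiv_le_0_compat; lra|].
apply Rmult_le_reg_r with t; [easy|].
replace ((1 - exp (- t)) / t * t)%R with (1 - exp (- t))%R by (field; lra); lra.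
Qed.

(** E_1 + ln has derivative (1 - e^-t)/t, which lies in [0, 1]. As s goes to 0 this turns E_1(Ns) -
    E_1(Ms) into ln(M/N). *)
Lemma expint_log_increment (a b : R) :
  0 < a <= b -> Rabs (expint a - expint b - ln (b / a)) <= b - a.
Proof.
intros Hab.
replace (expint a - expint b - ln (b / a))%R with (- ((expint b + ln b) - (expint a + ln a)))%R
  by (rewrite ln_div by lra; ring).
rewrite Rabs_Ropp.
apply (mean_value_bound (fun t => expint t + ln t)%R (fun t => t)
  (fun t => (1 - exp (- t)) / t)%R (fun _ => 1%R)); [lra| | |].
- intros t Ht.
  replace ((1 - exp (- t)) / t)%R with (plus (- (exp (- t) / t)) (/ t))%R
    by (unfold plus; simpl; field; lra).
  apply (is_derive_plus (V := R_NormedModule)); [apply expint_derive; lra|].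
  apply is_derive_ln; lra.
- intros t _; apply (is_derive_id (K := R_AbsRing)).
- intros t Ht; assert (H := one_sub_exp_div_bounds t ltac:(lra)).
  rewrite Rabs_pos_eq; lra.
Qed.

Lemma one_sub_pow_le (u : R) (n : nat) : 0 <= u <= 1 -> 1 - u ^ n <= INR n * (1 - u).
Proof.
intros Hu; induction n as [|n IH]; [simpl; lra|].
rewrite S_INR; simpl pow.
assert (0 <= u ^ n <= 1).
{ split; [apply pow_le; lra|rewrite <- (pow1 n); apply pow_incr; lra]. }
nra.
Qed.

Lemma one_sub_exp_pow_le (s : R) (n : nat) : 0 < s -> 1 - exp (- s) ^ n <= INR n * s.
Proof.
intros Hs; assert (H := exp_neg_bounds s Hs); assert (H1 := exp_ineq1_le (- s)).
eapply Rle_trans; [apply one_sub_pow_le; lra|].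
apply Rmult_le_compat_l; [apply pos_INR|lra].
Qed.

(** Lets a cut-off t tend to 0 in an inequality whose error is explicit and linear in t. *)
Lemma Rle_of_small (a b c d : R) :
  0 < d -> (forall t, 0 < t <= d -> a <= b + c * t) -> a <= b.
Proof.
intros Hd H; apply Rnot_lt_le; intros Hab.
assert (Hc := Rabs_pos c).
set (t := Rmin d ((a - b) / (2 * (Rabs c + 1)))).
assert (Ht : 0 < t).
{ apply Rmin_glb_lt; [easy|apply Rdiv_lt_0_compat; lra]. }
specialize (H t (conj Ht (Rmin_l _ _))).
assert (t <= (a - b) / (2 * (Rabs c + 1))) by apply Rmin_r.
assert ((Rabs c + 1) * t <= (a - b) / 2).
{ replace ((a - b) / 2)%R with ((Rabs c + 1) * ((a - b) / (2 * (Rabs c + 1))))%R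
    by (field; lra).
  apply Rmult_le_compat_l; lra. }
assert (Hc' := Rle_abs c); nra.
Qed.

(** At a second cut-off s' tending to 0, the difference of the two [psi_laplace] values is a damped
    partial sum minus a difference of E_1 values; their limits are the sum of q/(N+qk) and ln(M/N),
    where M = N + qK. Moving from s' to s costs the two increments on the right-hand side. *)
Lemma digamma_partial_laplace (q N K : nat) (s : R) :
  (0 < q)%nat -> (0 < N)%nat -> 0 < s ->
  Rabs (Rsum (fun k => INR q / INR (N + q * k))%R K - ln (INR (N + q * K) / INR N)
        - (psi_laplace q N s - psi_laplace q (N + q * K) s)) <=
  INR q / INR N * (1 - exp (- s) ^ N) +
  INR q / INR (N + q * K) * (1 - exp (- s) ^ (N + q * K)).
Proof.
intros Hq HN Hs.
assert (HN' := lt_0_INR N HN).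
set (M := (N + q * K)%nat) in *.
assert (HM : (0 < M)%nat) by (unfold M; lia); assert (HM' := lt_0_INR M HM).
assert (HNM : INR N <= INR M) by (apply le_INR; unfold M; lia).
(* The coefficient collects the error K q s' of the damped sum ([I4]) and the error (M - N) s' of
   the logarithm ([I3]). *)
apply (Rle_of_small _ _ (INR K * INR q + (INR M - INR N))%R s Hs); intros s' Hs'.
assert (E : (psi_laplace q N s' - psi_laplace q M s' =
  Rsum (fun k => INR q / INR (N + q * k) * exp (- s') ^ (N + q * k))%R K
  - (expint (INR N * s') - expint (INR M * s')))%R).
{ rewrite <- arith_log_shift_sum by (try easy; lra); unfold psi_laplace, M; ring. }
assert (I1 := psi_laplace_increment q N s' s Hq HN Hs').
assert (I2 := psi_laplace_increment q M s' s Hq HM Hs').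
assert (I3 : Rabs (expint (INR N * s') - expint (INR M * s') - ln (INR M / INR N)) <=
  INR M * s' - INR N * s').
{ replace (INR M / INR N)%R with (INR M * s' / (INR N * s'))%R by (field; lra).
  apply expint_log_increment; nra. }
assert (I4 : 0 <= Rsum (fun k => INR q / INR (N + q * k))%R K -
  Rsum (fun k => INR q / INR (N + q * k) * exp (- s') ^ (N + q * k))%R K <= INR K * INR q * s').
{ rewrite <- Rsum_minus.
  assert (T : forall k, 0 <= INR q / INR (N + q * k) -
    INR q / INR (N + q * k) * exp (- s') ^ (N + q * k) <= INR q * s').
  { intros k; set (m := (N + q * k)%nat).
    assert (Hm := lt_0_INR m ltac:(unfold m; lia)); assert (Hq' := lt_0_INR q Hq).
    assert (B1 := one_sub_exp_pow_le s' m ltac:(lra)).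
    assert (B2 := pow_lt_1 (exp (- s')) m
      ltac:(assert (H := exp_neg_bounds s' ltac:(lra)); lra) ltac:(unfold m; lia)).
    replace (INR q / INR m - INR q / INR m * exp (- s') ^ m)%R
      with (INR q / INR m * (1 - exp (- s') ^ m))%R by ring.
    assert (0 < INR q / INR m) by (apply Rdiv_lt_0_compat; easy).
    split; [apply Rmult_le_pos; lra|].
    replace (INR q * s')%R with (INR q / INR m * (INR m * s'))%R by (field; lra).
    apply Rmult_le_compat_l; lra. }
  split.
  - replace 0%R with (Rsum (fun _ => 0%R) K) by (rewrite Rsum_const; ring).
    apply Rsum_le; intros k _; apply T.
  - rewrite Rmult_assoc, <- Rsum_const; apply Rsum_le; intros k _; apply T. }
assert (P1 : exp (- s') ^ N <= 1).
{ apply Rlt_le, pow_lt_1; [assert (H := exp_neg_bounds s' ltac:(lra)); lra|easy]. }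
assert (P2 : exp (- s') ^ M <= 1).
{ apply Rlt_le, pow_lt_1; [assert (H := exp_neg_bounds s' ltac:(lra)); lra|easy]. }
assert (C1 : 0 < INR q / INR N) by (apply Rdiv_lt_0_compat; [now apply (lt_0_INR q)|easy]).
assert (C2 : 0 < INR q / INR M) by (apply Rdiv_lt_0_compat; [now apply (lt_0_INR q)|easy]).
apply Rabs_le_between in I1, I2, I3.
apply Rabs_le; split; nra.
Qed.

Lemma digamma_laplace (q N : nat) (s : R) :
  (0 < q)%nat -> (0 < N)%nat -> 0 < s ->
  Rabs (ln (INR N / INR q) - digammaR (INR N / INR q) - psi_laplace q N s) <=
  INR q / INR N * (1 - exp (- s) ^ N).
Proof.
intros Hq HN Hs.
assert (HN' := lt_0_INR N HN); assert (Hq' := lt_0_INR q Hq).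
set (y := (INR N / INR q)%R).
assert (Hy : 0 < y) by (apply Rdiv_lt_0_compat; easy).
(* [digamma_seq] pairs ln(n+1) with n+2 reciprocals. The third logarithm tends to 0 and replaces
   ln(n+1) by ln(y+n+2), as [digamma_partial_laplace] requires for K = n+2. *)
set (u := fun n : nat => (ln y - digamma_seq y n - ln ((y + INR (S (S n))) / INR (S n)) 
  - psi_laplace q N s)%R).
assert (Lu : is_lim_seq u (ln y - digammaR y - 0 - psi_laplace q N s)%R).
{ apply is_lim_seq_minus'; [apply is_lim_seq_minus'|apply is_lim_seq_const].
  - apply is_lim_seq_minus'; [apply is_lim_seq_const|now apply is_lim_digammaR].
  - apply (is_lim_seq_le_le (fun _ => 0%R) _ (fun n => (y + 1) * / INR (S n))%R).
    + intros n; assert (H := lt_0_INR (S n) ltac:(lia)); rewrite (S_INR (S n)).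
      replace ((y + (INR (S n) + 1)) / INR (S n))%R with (1 + (y + 1) * / INR (S n))%R
        by (field; lra).
      assert (0 < (y + 1) * / INR (S n)).
      { apply Rmult_lt_0_compat; [lra|apply Rinv_0_lt_compat; easy]. }
      split.
      * rewrite <- ln_1; apply Rlt_le, ln_increasing; lra.
      * eapply Rle_trans; [apply ln_le_sub_1; lra|lra].
    + apply is_lim_seq_const.
    + replace (Finite 0) with (Rbar_mult (y + 1)%R 0) by (simpl; now rewrite Rmult_0_r).
      apply is_lim_seq_scal_l.
      apply is_lim_seq_inv_INR. }
rewrite Rminus_0_r in Lu.
(* With M = N + q(n+2), the increment error q/M (1 - u^M) and the bound q/M u^M on
   [psi_laplace q M s] add up to q/M. *)
set (b := fun n : nat => (INR q / INR N * (1 - exp (- s) ^ N) +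
  INR q * / INR (N + q * S (S n)))%R).
assert (Lb : is_lim_seq b (INR q / INR N * (1 - exp (- s) ^ N) + INR q * 0)%R).
{ apply is_lim_seq_plus'; [apply is_lim_seq_const|].
  apply (is_lim_seq_scal_l _ (INR q) 0).
  apply (is_lim_seq_le_le (fun _ => 0%R) _ (fun n => / INR (S n))%R).
  - intros n; assert (H := lt_0_INR (S n) ltac:(lia)).
    assert (H1 : INR (S n) <= INR (N + q * S (S n))) by (apply le_INR; nia).
    split; [apply Rlt_le, Rinv_0_lt_compat; lra|apply Rinv_le_contravar; lra].
  - apply is_lim_seq_const.
  - apply is_lim_seq_inv_INR. }
rewrite Rmult_0_r, Rplus_0_r in Lb.
assert (B : forall n, Rabs (u n) <= b n).
{ intros n; set (K := S (S n)).
  assert (H := digamma_partial_laplace q N K s Hq HN Hs).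
  assert (HM := lt_0_INR (N + q * K) ltac:(lia)).
  assert (HM2 := psi_laplace_le q (N + q * K) s Hq ltac:(lia) Hs).
  assert (Hn := lt_0_INR (S n) ltac:(lia)).
  assert (E : u n = (Rsum (fun k => INR q / INR (N + q * k))%R K - ln (INR (N + q * K) / INR N)
        - (psi_laplace q N s - psi_laplace q (N + q * K) s) - psi_laplace q (N + q * K) s)%R).
  { unfold u, digamma_seq; fold K.
    rewrite (Rsum_ext (fun k => INR q / INR (N + q * k))%R (fun k => / (y + INR k))%R).
    - assert (HK := pos_INR K).
      replace (INR (N + q * K) / INR N)%R with ((y + INR K) / y)%R.
      2: { unfold y; rewrite plus_INR, mult_INR; field; lra. }
      rewrite !ln_div by lra; ring.
    - intros k _; assert (Hk := pos_INR k); unfold y; rewrite plus_INR, mult_INR.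
      field; split; [lra|]. nra. }
  rewrite E; unfold b; fold K.
  apply Rabs_le_between in H, HM2; unfold Rdiv in *; apply Rabs_le; split; lra. }
exact (is_lim_seq_le _ _ (Rbar_abs _) _ B (is_lim_seq_abs _ _ Lu) Lb).
Qed.

(** * Summation over the multiples of x *)

(** For 0 <= v < 1, the remainder of the series of -ln(1-v) after the exponent M, in closed form. *)
Definition log_tail (M : nat) (v : R) : R :=
  (- ln (1 - v) - Rsum (fun n => v ^ S n / INR (S n)) M)%R.

Lemma Rsum_geom (v : R) (M : nat) : ((1 - v) * Rsum (fun n => v ^ n) M = 1 - v ^ M)%R.
Proof.
induction M as [|M IH]; simpl; [ring|].
rewrite Rmult_plus_distr_l, IH; ring.
Qed.

Lemma log_tail_derive (M : nat) (v : R) :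
  v < 1 -> is_derive (log_tail M) v (v ^ M / (1 - v))%R.
Proof.
intros Hv.
replace (v ^ M / (1 - v))%R with (minus (/ (1 - v)) (Rsum (fun n => v ^ n) M))%R.
- apply (is_derive_minus (V := R_NormedModule)).
  + auto_derive; [lra|field; lra].
  + apply (is_derive_Rsum (fun n v => v ^ S n / INR (S n))%R (fun n v => v ^ n)%R).
    intros n _; assert (H := not_0_INR (S n) ltac:(lia)).
    apply is_derive_ext with (fun s => / INR (S n) * s ^ S n)%R;
      [intros s; eqR; field; easy|].
    replace (v ^ n)%R with (/ INR (S n) * (INR (S n) * 1 * v ^ pred (S n)))%R
      by (simpl pred; field; easy).
    apply is_derive_scal, is_derive_pow, (is_derive_id (K := R_AbsRing)).
- assert (G := Rsum_geom v M); unfold minus, plus, opp; simpl.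
  apply Rmult_eq_reg_l with (1 - v)%R; [|lra].
  rewrite Rmult_plus_distr_l, <- Ropp_mult_distr_r, G; field; lra.
Qed.

Lemma log_tail_0 (M : nat) : log_tail M 0 = 0%R.
Proof.
unfold log_tail; rewrite Rminus_0_r, ln_1, (Rsum_ext _ (fun _ => 0%R)).
- rewrite Rsum_const; ring.
- intros n _; simpl; unfold Rdiv; ring.
Qed.

(** The derivative is compared with t^M/(1-c). The factor [v] is kept because, at v = e^(-pt), it
    supplies the decay at infinity that [decay_bound] requires. *)
Lemma log_tail_bound (M : nat) (v c : R) :
  0 <= v <= c -> c < 1 -> Rabs (log_tail M v) <= / INR (S M) * / (1 - c) * v.
Proof.
intros Hv Hc; assert (HM := lt_0_INR (S M) ltac:(lia)).
set (g := fun t => (/ (INR (S M) * (1 - c)) * t ^ S M)%R).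
assert (B : Rabs (log_tail M v - log_tail M 0) <= g v - g 0%R).
{ apply (mean_value_bound (log_tail M) g (fun v => v ^ M / (1 - v))%R
    (fun v => v ^ M / (1 - c))%R); [lra| | |].
  - intros t Ht; apply log_tail_derive; lra.
  - intros t Ht; unfold g.
    replace (t ^ M / (1 - c))%R with
      (/ (INR (S M) * (1 - c)) * (INR (S M) * 1 * t ^ pred (S M)))%R
      by (simpl pred; field; lra).
    apply is_derive_scal, is_derive_pow, (is_derive_id (K := R_AbsRing)).
  - intros t Ht; assert (0 <= t ^ M) by (apply pow_le; lra).
    rewrite Rabs_pos_eq by (apply Rdiv_le_0_compat; lra).
    apply Rmult_le_compat_l; [easy|apply Rinv_le_contravar; lra]. }
rewrite log_tail_0, Rminus_0_r in B; eapply Rle_trans; [exact B|].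
unfold g; rewrite (pow_i (S M)) by lia; rewrite Rmult_0_r, Rminus_0_r, Rinv_mult.
apply Rmult_le_compat_l.
- apply Rmult_le_pos; apply Rlt_le, Rinv_0_lt_compat; lra.
- simpl; assert (0 <= v ^ M <= 1); [|nra].
  split; [apply pow_le; lra|rewrite <- (pow1 M); apply pow_incr; lra].
Qed.

Lemma is_lim_Rsum0 (f : nat -> R -> R) (M : nat) (x : Rbar) :
  (forall n, is_lim (f n) x 0) -> is_lim (fun t => Rsum (fun n => f n t) M) x 0.
Proof.
intros H; induction M as [|M IH]; simpl; [apply is_lim_const|].
replace (Finite 0) with (Finite (0 + 0)%R) by (apply f_equal; ring).
now apply is_lim_plus'.
Qed.

Definition arith_log_sum (p q M : nat) (s : R) : R :=
  Rsum (fun n => / INR (S n) * arith_log q (S n * p) s)%R M.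

Lemma Rsum_scal_tail (p M : nat) (u : R) :
  (Rsum (fun n => / INR (S n) * u ^ (S n * p)) M = - ln (1 - u ^ p) - log_tail M (u ^ p))%R.
Proof.
unfold log_tail; rewrite (Rsum_ext _ (fun n => (u ^ p) ^ S n / INR (S n))%R); [ring|].
intros n _; rewrite <- pow_mult, (Nat.mul_comm p); unfold Rdiv; ring.
Qed.

(** With u = e^-t, the derivative in t of the partial sum plus A(u) is q/(1-u^q) times
    [log_tail M (u^p)], which is O(u/M) uniformly for t >= s. *)
Lemma arith_log_sum_lim (p q : nat) (A : R -> R) (s : R) :
  (0 < p)%nat -> (0 < q)%nat -> 0 < s ->
  (forall u, 0 < u < 1 ->
     is_derive A u (INR q * ln (1 - u ^ p) / (u * (1 - u ^ q)))%R) ->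
  filterlim A (at_right 0) (locally 0%R) ->
  is_lim_seq (fun M => arith_log_sum p q M s) (- A (exp (- s)))%R.
Proof.
intros Hp Hq Hs HA LA.
assert (HU : forall t, 0 < t -> 0 < exp (- t) < 1) by apply exp_neg_bounds.
set (c := exp (- s)).
assert (Hc := HU s Hs); fold c in Hc.
assert (Hcq := pow_lt_1 c q ltac:(lra) Hq); assert (Hcp := pow_lt_1 c p ltac:(lra) Hp).
set (C := (INR q / (1 - c ^ q) * / (1 - c ^ p))%R).
assert (Hq' := lt_0_INR q Hq).
assert (HC : 0 < C).
{ apply Rmult_lt_0_compat; [apply Rdiv_lt_0_compat|apply Rinv_0_lt_compat]; lra. }
assert (B : forall M, Rabs (arith_log_sum p q M s + A c) <= C * / INR (S M)).
{ intros M; assert (HM := lt_0_INR (S M) ltac:(lia)).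
  set (f := fun t => (arith_log_sum p q M t + A (exp (- t)))%R).
  apply Rle_trans with (C * / INR (S M) * exp (- s) ^ 1)%R.
  2: { rewrite pow_1; fold c; assert (0 < C * / INR (S M)); [|nra].
       apply Rmult_lt_0_compat; [easy|apply Rinv_0_lt_compat; easy]. }
  apply (decay_bound f (fun t => C * / INR (S M) * exp (- t) ^ 1)%R
    (fun t => INR q / (1 - exp (- t) ^ q) * log_tail M (exp (- t) ^ p))%R
    (fun t => - (INR 1 * (C * / INR (S M)) * exp (- t) ^ 1))%R).
  - intros t Ht; specialize (HU t ltac:(lra)); set (u := exp (- t)) in *.
    assert (Huq := pow_lt_1 u q ltac:(lra) Hq).
    replace (INR q / (1 - u ^ q) * log_tail M (u ^ p))%R with
      (plus (Rsum (fun n => / INR (S n) * - (INR q * u ^ (S n * p) / (1 - u ^ q)))%R M)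
         (scal (- u) (INR q * ln (1 - u ^ p) / (u * (1 - u ^ q))))%R).
    + apply (is_derive_plus (V := R_NormedModule)).
      * apply (is_derive_Rsum (fun n t => / INR (S n) * arith_log q (S n * p) t)%R
          (fun n t => / INR (S n) * - (INR q * exp (- t) ^ (S n * p) / (1 - exp (- t) ^ q)))%R).
        intros n _; apply is_derive_scal, arith_log_derive; try easy; try lia; lra.
      * apply (is_derive_comp A (fun t => exp (- t))); [now apply HA|].
        unfold u; auto_derive; [easy|ring].
    + rewrite (Rsum_ext _ (fun n => - (INR q / (1 - u ^ q)) * (/ INR (S n) * u ^ (S n * p)))%R)
        by (intros; unfold Rdiv; ring).
      rewrite Rsum_scal, Rsum_scal_tail; unfold plus, scal; simpl; unfold mult; simpl.
      field; lra.
  - intros t Ht; apply exp_pow_derive.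
  - intros t Ht; specialize (HU t ltac:(lra)).
    assert (Hut : exp (- t) <= c).
    { unfold c; destruct (Req_dec s t) as [->|]; [lra|]; apply Rlt_le, exp_increasing; lra. }
    set (u := exp (- t)) in *.
    assert (Huq : u ^ q <= c ^ q) by (apply pow_incr; lra).
    assert (Hup : u ^ p <= c ^ p) by (apply pow_incr; lra).
    assert (Hup0 := pow_lt_1 u p ltac:(lra) Hp).
    assert (Hup1 : u ^ p <= u).
    { destruct p as [|p]; [lia|]; simpl.
      assert (u ^ p <= 1) by (rewrite <- (pow1 p); apply pow_incr; lra); nra. }
    rewrite Ropp_involutive, pow_1, INR_1, Rmult_1_l.
    assert (T := log_tail_bound M (u ^ p) (c ^ p) ltac:(lra) ltac:(lra)).
    assert (Hi : 0 < / INR (S M) * / (1 - c ^ p)).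
    { apply Rmult_lt_0_compat; apply Rinv_0_lt_compat; lra. }
    assert (Hj : 0 < INR q / (1 - u ^ q) <= INR q / (1 - c ^ q)).
    { split; [apply Rdiv_lt_0_compat; lra|].
      apply Rmult_le_compat_l; [lra|apply Rinv_le_contravar; lra]. }
    rewrite Rabs_mult, (Rabs_pos_eq (_ / _)) by lra.
    apply Rle_trans with (INR q / (1 - c ^ q) * (/ INR (S M) * / (1 - c ^ p) * u))%R.
    + apply Rmult_le_compat; [lra|apply Rabs_pos|lra|].
      eapply Rle_trans; [exact T|]. apply Rmult_le_compat_l; lra.
    + unfold C; right; ring.
  - replace (Finite 0) with (Finite (0 + 0)%R) by (apply f_equal; ring).
    apply is_lim_plus'.
    + apply (is_lim_Rsum0 (fun n t => / INR (S n) * arith_log q (S n * p) t)%R).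
      intros n; replace (Finite 0) with (Rbar_mult (/ INR (S n))%R 0)
        by (simpl; now rewrite Rmult_0_r).
      now apply is_lim_scal_l, arith_log_lim.
    + intros P HP; specialize (LA P HP).
      destruct LA as [d Hd].
      assert (L := is_lim_exp_neg); apply is_lim_spec in L; destruct (L d) as [K HK].
      exists K; intros t Ht; apply Hd; [|apply exp_pos].
      specialize (HK t Ht); exact HK.
  - apply exp_pow_lim; lia. }
apply (is_lim_seq_le_le (fun M => - A c - C * / INR (S M))%R _ (fun M => - A c + C * / INR (S M))%R).
- intros M; specialize (B M); apply Rabs_le_between in B; lra.
- replace (Finite (- A c)) with (Finite (- A c - C * 0)%R) by (f_equal; ring).
  apply is_lim_seq_minus'; [apply is_lim_seq_const|].
  apply (is_lim_seq_scal_l _ C 0).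
  apply is_lim_seq_inv_INR.
- replace (Finite (- A c)) with (Finite (- A c + C * 0)%R) by (f_equal; ring).
  apply is_lim_seq_plus'; [apply is_lim_seq_const|].
  apply (is_lim_seq_scal_l _ C 0).
  apply is_lim_seq_inv_INR.
Qed.

Definition expint_sum (M : nat) (t : R) : R :=
  Rsum (fun n => / INR (S n) * expint (INR (S n) * t))%R M.

Lemma ln_one_sub_exp_bounds (t : R) : 0 < t -> - t <= ln (1 - exp (- t)) - ln t <= 0.
Proof.
intros Ht; assert (Hb := exp_neg_bounds t Ht); assert (Ha := exp_ineq1_le (- t)).
assert (Hc := exp_ineq1_le t).
assert (Ee : (exp (- t) * exp t = 1)%R) by (rewrite <- exp_plus, Rplus_opp_l, exp_0; easy).
split.
- assert (ln (t * exp (- t)) <= ln (1 - exp (- t))).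
  { apply ln_le; [apply Rmult_lt_0_compat; lra|nra]. }
  rewrite ln_mult, ln_exp in H by lra; lra.
- assert (ln (1 - exp (- t)) <= ln t) by (apply ln_le; lra); lra.
Qed.

(** Up to a tail, the derivative of sum E_1(nt)/n is ln(1 - e^-t)/t, which differs from the
    derivative (ln t)/t of (ln t)^2/2 by a bounded amount. Taking the increment from s to ps
    eliminates the constant of integration. *)
Lemma expint_sum_increment (M p : nat) (s : R) :
  (0 < p)%nat -> 0 < s ->
  Rabs (expint_sum M (INR p * s) - expint_sum M s -
        (ln (INR p * s) ^ 2 / 2 - ln s ^ 2 / 2)) <=
  INR p * s * (1 + / s * / (1 - exp (- s)) * / INR (S M)).
Proof.
intros Hp Hs; assert (HM := lt_0_INR (S M) ltac:(lia)).
assert (Hp' : 1 <= INR p) by (apply (le_INR 1); lia).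
assert (Hps : s <= INR p * s) by nra.
assert (Hc := exp_neg_bounds s Hs).
set (D := (1 + / s * / (1 - exp (- s)) * / INR (S M))%R).
assert (HD : 0 < D).
{ unfold D; assert (0 < / s * / (1 - exp (- s)) * / INR (S M)); [|lra].
  repeat apply Rmult_lt_0_compat; apply Rinv_0_lt_compat; lra. }
set (f := fun t => (expint_sum M t - ln t ^ 2 / 2)%R).
apply Rle_trans with (D * (INR p * s) - D * s)%R; [|nra].
replace (expint_sum M (INR p * s) - expint_sum M s - (ln (INR p * s) ^ 2 / 2 - ln s ^ 2 / 2))%R
  with (f (INR p * s)%R - f s)%R by (unfold f; ring).
apply (mean_value_bound f (fun t => D * t)%R
  (fun t => (log_tail M (exp (- t)) + (ln (1 - exp (- t)) - ln t)) / t)%R (fun _ => D)); [easy| | |].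
- intros t Ht.
  assert (HU := exp_neg_bounds t ltac:(lra)).
  replace ((log_tail M (exp (- t)) + (ln (1 - exp (- t)) - ln t)) / t)%R with
    (minus (Rsum (fun n => / INR (S n) * (INR (S n) * - (exp (- (INR (S n) * t)) / (INR (S n) * t))))%R M)
       (ln t / t))%R.
  + apply (is_derive_minus (V := R_NormedModule)).
    * apply (is_derive_Rsum (fun n t => / INR (S n) * expint (INR (S n) * t))%R
        (fun n t => / INR (S n) * (INR (S n) * - (exp (- (INR (S n) * t)) / (INR (S n) * t))))%R).
      intros n _; assert (Hn := lt_0_INR (S n) ltac:(lia)).
      apply is_derive_scal.
      apply (is_derive_comp expint (fun t => INR (S n) * t)%R); [apply expint_derive; nra|].
      generalize (INR (S n)); intros c; auto_derive; [easy|ring].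
    * auto_derive; [lra|field; lra].
  + rewrite (Rsum_ext _ (fun n => - / t * (/ INR (S n) * exp (- t) ^ (S n * 1)))%R).
    2: { intros n _; assert (Hn := lt_0_INR (S n) ltac:(lia)).
         rewrite Nat.mul_1_r, exp_neg_pow; field; lra. }
    rewrite Rsum_scal, Rsum_scal_tail, pow_1; unfold minus, plus, opp; simpl; field; lra.
- intros t _; auto_derive; [easy|ring].
- intros t Ht; assert (HU := exp_neg_bounds t ltac:(lra)).
  assert (Hut : exp (- t) <= exp (- s)).
  { destruct (Req_dec s t) as [->|]; [lra|]; apply Rlt_le, exp_increasing; lra. }
  assert (T := log_tail_bound M (exp (- t)) (exp (- s)) ltac:(lra) ltac:(lra)).
  assert (L := ln_one_sub_exp_bounds t ltac:(lra)).
  assert (Hit : 0 < / t <= / s).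
  { split; [apply Rinv_0_lt_compat; lra|apply Rinv_le_contravar; lra]. }
  unfold Rdiv; rewrite Rabs_mult, (Rabs_pos_eq (/ t)) by lra.
  set (E := (/ INR (S M) * / (1 - exp (- s)))%R) in *.
  assert (HE : 0 < E) by (apply Rmult_lt_0_compat; apply Rinv_0_lt_compat; lra).
  assert (B : Rabs (log_tail M (exp (- t)) + (ln (1 - exp (- t)) - ln t)) <= E + t).
  { apply Rabs_le_between in T; apply Rabs_le; split; nra. }
  apply Rle_trans with ((E + t) * / t)%R; [apply Rmult_le_compat_r; lra|].
  unfold D; replace (/ s * / (1 - exp (- s)) * / INR (S M))%R with (E * / s)%R
    by (unfold E; ring).
  rewrite Rmult_plus_distr_r, Rinv_r by lra; nra.
Qed.

(** The first m terms are at most 1 - V each; the others are bounded by the sum of 1/n^2 over n > m,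
    hence by 1/m. The split index [m] stays free, so that V can go to 1 before m goes to
    infinity. *)
Lemma sum_one_sub_pow_le (V : R) (m M : nat) :
  0 <= V <= 1 -> (0 < m)%nat ->
  Rsum (fun n => / INR (S n) * (/ INR (S n) * (1 - V ^ S n)))%R M <= INR m * (1 - V) + / INR m.
Proof.
intros HV Hm; assert (Hm' := lt_0_INR m Hm).
assert (Him := Rinv_0_lt_compat _ Hm').
assert (A : forall k, (k <= m)%nat ->
  Rsum (fun n => / INR (S n) * (/ INR (S n) * (1 - V ^ S n)))%R k <= INR k * (1 - V)).
{ intros k _; rewrite <- Rsum_const; apply Rsum_le; intros n _.
  assert (Hn := lt_0_INR (S n) ltac:(lia)).
  assert (H1 : 1 <= INR (S n)) by (apply (le_INR 1); lia).
  assert (Hi : 0 < / INR (S n) <= 1).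
  { split; [apply Rinv_0_lt_compat; easy|rewrite <- Rinv_1; apply Rinv_le_contravar; lra]. }
  assert (B := one_sub_pow_le V (S n) HV).
  assert (/ INR (S n) * (1 - V ^ S n) <= 1 - V).
  { apply Rmult_le_reg_l with (INR (S n)); [easy|].
    rewrite <- Rmult_assoc, Rinv_r, Rmult_1_l by lra; exact B. }
  nra. }
assert (B : forall j, Rsum (fun n => / INR (S n) * (/ INR (S n) * (1 - V ^ S n)))%R (m + j) <=
   INR m * (1 - V) + (/ INR m - / INR (m + j))).
{ induction j as [|j IH].
  - rewrite Nat.add_0_r; specialize (A m ltac:(lia)); lra.
  - replace (m + S j)%nat with (S (m + j)) by lia; cbn [Rsum].
    assert (Hn := lt_0_INR (m + j) ltac:(lia)).
    assert (Hn1 := lt_0_INR (S (m + j)) ltac:(lia)).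
    assert (HVn : 0 <= V ^ S (m + j)) by (apply pow_le; lra).
    assert (K : / INR (S (m + j)) * (/ INR (S (m + j)) * (1 - V ^ S (m + j))) <=
      / INR (m + j) - / INR (S (m + j))).
    { replace (/ INR (m + j) - / INR (S (m + j)))%R with
        (/ INR (S (m + j)) * / INR (m + j))%R by (rewrite S_INR in *; field; lra).
      assert (Hi := Rinv_0_lt_compat _ Hn1).
      assert (Hle : / INR (S (m + j)) <= / INR (m + j))
        by (apply Rinv_le_contravar; [easy|apply le_INR; lia]).
      apply Rmult_le_compat_l; [lra|]. nra. }
    lra. }
destruct (Nat.le_gt_cases M m) as [HMm|HMm].
- eapply Rle_trans; [apply A, HMm|].
  assert (INR M <= INR m) by (apply le_INR; easy); nra.
- replace M with (m + (M - m))%nat by lia; eapply Rle_trans; [apply B|].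
  assert (0 < / INR (m + (M - m))) by (apply Rinv_0_lt_compat, lt_0_INR; lia); lra.
Qed.

Definition herglotz_term (x : R) (n : nat) : R :=
  (/ INR (S n) * (digammaR (INR (S n) * x) - ln (INR (S n) * x)))%R.

Lemma herglotz_laplace (p q n : nat) (s : R) :
  (0 < p)%nat -> (0 < q)%nat -> 0 < s ->
  Rabs (herglotz_term (INR p / INR q) n + / INR (S n) * psi_laplace q (S n * p) s) <=
  INR q / INR p * (/ INR (S n) * (/ INR (S n) * (1 - (exp (- s) ^ p) ^ S n))).
Proof.
intros Hp Hq Hs.
assert (H := digamma_laplace q (S n * p) s Hq ltac:(lia) Hs).
assert (Hn := lt_0_INR (S n) ltac:(lia)).
assert (Hp' := lt_0_INR p Hp); assert (Hq' := lt_0_INR q Hq).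
unfold herglotz_term.
replace (INR (S n) * (INR p / INR q))%R with (INR (S n * p) / INR q)%R
  by (rewrite mult_INR; field; lra).
set (y := (INR (S n * p) / INR q)%R) in *.
replace (/ INR (S n) * (digammaR y - ln y) + / INR (S n) * psi_laplace q (S n * p) s)%R
  with (- (/ INR (S n) * (ln y - digammaR y - psi_laplace q (S n * p) s)))%R by ring.
rewrite Rabs_Ropp, Rabs_mult, (Rabs_pos_eq (/ INR (S n)))
  by (apply Rlt_le, Rinv_0_lt_compat; easy).
rewrite <- pow_mult, (Nat.mul_comm p).
eapply Rle_trans; [apply Rmult_le_compat_l; [apply Rlt_le, Rinv_0_lt_compat; easy|exact H]|].
right; rewrite mult_INR; field; lra.
Qed.

(** Taken at the cut-off s = 1, where the error 1 - e and the bound e coming from [psi_laplace_le]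
    add up to 1 and leave q/p over the square of the index. *)
Lemma herglotz_term_bound (p q n : nat) :
  (0 < p)%nat -> (0 < q)%nat ->
  Rabs (herglotz_term (INR p / INR q) n) <= 2 * INR q / INR p * / (INR (S n) * INR (S (S n))).
Proof.
intros Hp Hq.
assert (H := herglotz_laplace p q n 1 Hp Hq Rlt_0_1).
assert (B := psi_laplace_le q (S n * p) 1 Hq ltac:(lia) Rlt_0_1).
assert (Hn := lt_0_INR (S n) ltac:(lia)).
assert (Hp' := lt_0_INR p Hp); assert (Hq' := lt_0_INR q Hq).
assert (Hi := Rinv_0_lt_compat _ Hn).
rewrite <- pow_mult, (Nat.mul_comm p) in H.
set (e := (exp (- (1)) ^ (S n * p))%R) in *.
apply (Rmult_le_compat_l (/ INR (S n))) in B; [|lra].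
rewrite <- (Rabs_pos_eq (/ INR (S n))) in B at 1 by lra; rewrite <- Rabs_mult in B.
replace (/ INR (S n) * (INR q / INR (S n * p) * e))%R with
  (INR q / INR p * (/ INR (S n) * (/ INR (S n) * e)))%R in B
  by (rewrite mult_INR; field; lra).
apply Rabs_le_between in H, B.
assert (G : Rabs (herglotz_term (INR p / INR q) n) <= INR q / INR p * (/ INR (S n) * / INR (S n))).
{ apply Rabs_le; split; lra. }
eapply Rle_trans; [exact G|].
replace (2 * INR q / INR p * / (INR (S n) * INR (S (S n))))%R with
  (INR q / INR p * (/ INR (S n) * (2 * / INR (S (S n)))))%R.
2: { assert (H2 := lt_0_INR (S (S n)) ltac:(lia)); field; lra. }
apply Rmult_le_compat_l; [apply Rlt_le, Rdiv_lt_0_compat; easy|].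
apply Rmult_le_compat_l; [lra|].
rewrite (S_INR (S n)); assert (H1 : 1 <= INR (S n)) by (apply (le_INR 1); lia).
replace (2 * / (INR (S n) + 1))%R with (/ ((INR (S n) + 1) / 2))%R by (field; lra).
apply Rinv_le_contravar; lra.
Qed.

Lemma herglotz_cv (p q : nat) :
  (0 < p)%nat -> (0 < q)%nat ->
  ex_finite_lim_seq (Rsum (herglotz_term (INR p / INR q))).
Proof.
intros Hp Hq; set (C := (2 * INR q / INR p)%R).
set (b := fun n => (C * / (INR (S n) * INR (S (S n))))%R).
assert (HC : 0 < C).
{ assert (Hp' := lt_0_INR p Hp); assert (Hq' := lt_0_INR q Hq); apply Rdiv_lt_0_compat; lra. }
assert (Hb : forall n, 0 < b n).
{ intros n; apply Rmult_lt_0_compat; [easy|apply Rinv_0_lt_compat].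
  apply Rmult_lt_0_compat; apply lt_0_INR; lia. }
assert (B := fun n => herglotz_term_bound p q n Hp Hq); fold C in B.
assert (L1 : ex_finite_lim_seq (Rsum b)).
{ apply (incr_bounded_seq_cv _ b C); [intros n; simpl; ring|].
  intros k; split; [apply Rlt_le, Hb|unfold b, Rdiv; lra]. }
(* Absolute convergence by shifting: after adding [b] every term lies between 0 and 2 b. *)
assert (L2 : ex_finite_lim_seq (Rsum (fun n => herglotz_term (INR p / INR q) n + b n)%R)).
{ apply (incr_bounded_seq_cv _ (fun n => herglotz_term (INR p / INR q) n + b n)%R (2 * C)%R);
    [intros n; simpl; ring|].
  intros k; specialize (B k); apply Rabs_le_between in B; unfold b, Rdiv; lra. }
destruct L1 as [l1 L1], L2 as [l2 L2]; exists (l2 - l1)%R.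
apply (is_lim_seq_ext (fun n => Rsum (fun n => herglotz_term (INR p / INR q) n + b n)%R n - Rsum b n)%R).
- intros n; rewrite Rsum_plus; ring.
- now apply is_lim_seq_minus'.
Qed.

Definition herglotzR (x : R) : R := real (Lim_seq (Rsum (herglotz_term x))).

Lemma Clog_pos (y : R) : 0 < y -> Clog y = RtoC (ln y).
Proof.
intros Hy; unfold Clog; rewrite Cmod_R, Rabs_pos_eq, Carg_half_angle
  by (simpl; lra).
simpl; unfold Rdiv; rewrite Rmult_0_l, atan_0, Rmult_0_r; reflexivity.
Qed.

Lemma Herglotz_F_pos_rat (p q : nat) :
  (0 < p)%nat -> (0 < q)%nat ->
  Herglotz_F (INR p / INR q)%R = RtoC (herglotzR (INR p / INR q)).
Proof.
intros Hp Hq; set (x := (INR p / INR q)%R).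
assert (Hx : 0 < x) by (apply Rdiv_lt_0_compat; apply lt_0_INR; easy).
apply Clim_unique; [apply eventually_filter|].
(* [sum_n] includes its upper index while [Rsum] excludes it. *)
apply (filterlim_ext (fun N => RtoC (Rsum (herglotz_term x) (S N)))).
- intros N.
  assert (T : forall k, (digamma (INR (S k) * x) - Clog (INR (S k) * x)) / INR (S k) =
    RtoC (herglotz_term x k)).
  { intros k; assert (Hk := lt_0_INR (S k) ltac:(lia)).
    rewrite <- RtoC_mult, digamma_pos, Clog_pos by nra.
    rewrite <- RtoC_minus, <- RtoC_div by lra.
    f_equal; unfold herglotz_term, Rdiv; ring. }
  induction N as [|N IH].
  + rewrite sum_O, T; simpl; f_equal; ring.
  + rewrite sum_Sn, T, <- IH.
    change (Rsum (herglotz_term x) (S (S N))) with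
      (Rsum (herglotz_term x) (S N) + herglotz_term x (S N))%R.
    rewrite RtoC_plus; reflexivity.
- apply filterlim_RtoC; [apply eventually_filter|].
  change (is_lim_seq (fun N => Rsum (herglotz_term x) (S N)) (herglotzR x)).
  apply (is_lim_seq_incr_1 (Rsum (herglotz_term x))).
  apply Lim_seq_correct', herglotz_cv; easy.
Qed.

(** The limit in the number of summands, at fixed [s] and fixed split index [m]. The pairs (p, q)
    and (1, 1) are subtracted beforehand, since the E_1 sums are controlled only through their
    increment from s to ps. *)
Lemma herglotz_diff_approx (p q m : nat) (A A1 : R -> R) (s : R) :
  (0 < p)%nat -> (0 < q)%nat -> (0 < m)%nat -> 0 < s ->
  (forall u, 0 < u < 1 ->
     is_derive A u (INR q * ln (1 - u ^ p) / (u * (1 - u ^ q)))%R) ->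
  filterlim A (at_right 0) (locally 0%R) ->
  (forall u, 0 < u < 1 -> is_derive A1 u (INR 1 * ln (1 - u ^ 1) / (u * (1 - u ^ 1)))%R) ->
  filterlim A1 (at_right 0) (locally 0%R) ->
  Rabs (herglotzR (INR p / INR q) - herglotzR (INR 1 / INR 1) -
    (A (exp (- s)) - A1 (exp (- s)) + (ln (INR p * s) ^ 2 / 2 - ln s ^ 2 / 2))) <=
  INR q / INR p * (INR m * (1 - exp (- s) ^ p) + / INR m) +
  INR 1 / INR 1 * (INR m * (1 - exp (- s) ^ 1) + / INR m) + INR p * s.
Proof.
intros Hp Hq Hm Hs HA LA HA1 LA1.
assert (Hp' := lt_0_INR p Hp); assert (Hq' := lt_0_INR q Hq).
assert (HU := exp_neg_bounds s Hs).
assert (G : forall p q M, (0 < p)%nat -> (0 < q)%nat ->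
  Rabs (Rsum (herglotz_term (INR p / INR q)) M + (arith_log_sum p q M s - expint_sum M (INR p * s))) <=
  INR q / INR p * (INR m * (1 - exp (- s) ^ p) + / INR m)).
{ clear - Hm Hs HU; intros p q M Hp Hq.
  assert (Hp' := lt_0_INR p Hp); assert (Hq' := lt_0_INR q Hq).
  assert (HV := pow_lt_1 (exp (- s)) p ltac:(lra) Hp).
  replace (arith_log_sum p q M s - expint_sum M (INR p * s))%R with
    (Rsum (fun n => / INR (S n) * psi_laplace q (S n * p) s)%R M).
  2: { unfold arith_log_sum, expint_sum; rewrite <- Rsum_minus; apply Rsum_ext; intros n _.
       unfold psi_laplace; rewrite mult_INR, Rmult_assoc; ring. }
  rewrite <- Rsum_plus; eapply Rle_trans; [apply Rsum_Rabs|].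
  eapply Rle_trans; [apply Rsum_le; intros n _; apply herglotz_laplace; easy|].
  rewrite Rsum_scal; apply Rmult_le_compat_l; [apply Rlt_le, Rdiv_lt_0_compat; easy|].
  apply sum_one_sub_pow_le; [lra|easy]. }
set (K := (/ s * / (1 - exp (- s)))%R).
set (u := fun M => (Rsum (herglotz_term (INR p / INR q)) M - Rsum (herglotz_term (INR 1 / INR 1)) M -
  (- arith_log_sum p q M s - - arith_log_sum 1 1 M s +
   (ln (INR p * s) ^ 2 / 2 - ln s ^ 2 / 2)))%R).
set (b := fun M : nat => (INR q / INR p * (INR m * (1 - exp (- s) ^ p) + / INR m) +
  INR 1 / INR 1 * (INR m * (1 - exp (- s) ^ 1) + / INR m) +
  INR p * s * (1 + K * / INR (S M)))%R).
assert (B : forall M, Rabs (u M) <= b M).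
{ intros M; assert (G1 := G p q M Hp Hq); assert (G2 := G 1%nat 1%nat M ltac:(lia) ltac:(lia)).
  assert (G3 := expint_sum_increment M p s Hp Hs); fold K in G3.
  assert (E : expint_sum M (INR 1 * s) = expint_sum M s) by (simpl INR; now rewrite Rmult_1_l).
  rewrite E in G2; unfold u, b.
  apply Rabs_le_between in G1, G2, G3; apply Rabs_le; split; lra. }
assert (Lu : is_lim_seq u (herglotzR (INR p / INR q) - herglotzR (INR 1 / INR 1) -
    (- - A (exp (- s)) - - - A1 (exp (- s)) + (ln (INR p * s) ^ 2 / 2 - ln s ^ 2 / 2)))%R).
{ assert (R1 := arith_log_sum_lim p q A s Hp Hq Hs HA LA).
  assert (R2 := arith_log_sum_lim 1 1 A1 s ltac:(lia) ltac:(lia) Hs HA1 LA1).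
  apply is_lim_seq_minus'; [|apply is_lim_seq_plus'; [|apply is_lim_seq_const]].
  - apply is_lim_seq_minus'; apply Lim_seq_correct', herglotz_cv; lia.
  - apply is_lim_seq_minus'; [exact (proj1 (is_lim_seq_opp _ (Finite _)) R1)|exact (proj1 (is_lim_seq_opp _ (Finite _)) R2)]. }
assert (Lb : is_lim_seq b (INR q / INR p * (INR m * (1 - exp (- s) ^ p) + / INR m) +
  INR 1 / INR 1 * (INR m * (1 - exp (- s) ^ 1) + / INR m) + INR p * s * (1 + K * 0))%R).
{ apply is_lim_seq_plus'; [apply is_lim_seq_const|].
  apply (is_lim_seq_scal_l _ (INR p * s)%R (1 + K * 0)%R).
  apply is_lim_seq_plus'; [apply is_lim_seq_const|].
  apply (is_lim_seq_scal_l _ K 0%R).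
  apply is_lim_seq_inv_INR. }
assert (F := is_lim_seq_le _ _ (Rbar_abs _) _ B (is_lim_seq_abs _ _ Lu) Lb).
cbn [Rbar_le Rbar_abs] in F; rewrite Rmult_0_r, Rplus_0_r, (Rmult_1_r (INR p * s)), !Ropp_involutive in F.
exact F.
Qed.

(** Here (ln ps)^2/2 - (ln s)^2/2 = ln p ln s + (ln p)^2/2. The cross term absorbs the divergence of
    A - A1, because ln s and ln(1 - e^-s) differ by at most s; the squared logarithms cancel between
    [A] and [A1]. *)
Lemma herglotz_diff (p q : nat) (A A1 : R -> R) (k k1 : R) :
  (0 < p)%nat -> (0 < q)%nat ->
  (forall u, 0 < u < 1 ->
     is_derive A u (INR q * ln (1 - u ^ p) / (u * (1 - u ^ q)))%R) ->
  filterlim A (at_right 0) (locally 0%R) ->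
  filterlim (fun u => A u + ln (1 - u) ^ 2 / 2 + ln (INR p) * ln (1 - u))%R
    (at_left 1) (locally k) ->
  (forall u, 0 < u < 1 -> is_derive A1 u (INR 1 * ln (1 - u ^ 1) / (u * (1 - u ^ 1)))%R) ->
  filterlim A1 (at_right 0) (locally 0%R) ->
  filterlim (fun u => A1 u + ln (1 - u) ^ 2 / 2 + ln (INR 1) * ln (1 - u))%R
    (at_left 1) (locally k1) ->
  (herglotzR (INR p / INR q) - herglotzR (INR 1 / INR 1) = k - k1 + ln (INR p) ^ 2 / 2)%R.
Proof.
intros Hp Hq HA LA KA HA1 LA1 KA1.
assert (Hp' := lt_0_INR p Hp); assert (Hq' := lt_0_INR q Hq).
set (D := (herglotzR (INR p / INR q) - herglotzR (INR 1 / INR 1) - (k - k1 + ln (INR p) ^ 2 / 2))%R).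
enough (H : Rabs D <= 0).
{ assert (D = 0)%R by (apply Rabs_eq_0; assert (H1 := Rabs_pos D); lra).
  unfold D in *; lra. }
set (Q := (INR q / INR p)%R).
assert (HQ : 0 < Q) by (apply Rdiv_lt_0_compat; easy).
assert (Near : forall eps : posreal, exists d : posreal, forall s, 0 < s < d ->
  Rabs (A (exp (- s)) + ln (1 - exp (- s)) ^ 2 / 2 + ln (INR p) * ln (1 - exp (- s)) - k) < eps /\
  Rabs (A1 (exp (- s)) + ln (1 - exp (- s)) ^ 2 / 2 + ln (INR 1) * ln (1 - exp (- s)) - k1) < eps).
{ intros eps.
  destruct (KA _ (locally_ball k eps)) as [d1 H1].
  destruct (KA1 _ (locally_ball k1 eps)) as [d2 H2].
  assert (Hd : 0 < Rmin d1 d2) by (apply Rmin_glb_lt; apply cond_pos).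
  exists (mkposreal _ Hd); intros s Hs; simpl in Hs.
  assert (HU := exp_neg_bounds s ltac:(lra)); assert (He := exp_ineq1_le (- s)).
  assert (M1 := Rmin_l d1 d2); assert (M2 := Rmin_r d1 d2).
  assert (Ab : Rabs (exp (- s) - 1) < Rmin d1 d2) by (rewrite Rabs_left; lra).
  split.
  - apply H1; [|lra]. change (Rabs (exp (- s) - 1) < d1); lra.
  - apply H2; [|lra]. change (Rabs (exp (- s) - 1) < d2); lra. }
(* The limit s to 0 with m = n+1. Of the constant, Q and 1 come from the two split sums, and 1 each
   from the distances to [k] and [k1], taken below 1/m. *)
assert (B : forall n : nat, Rabs D <= (Q + 3) * / INR (S n)).
{ intros n; set (m := S n); assert (Hm := lt_0_INR m ltac:(unfold m; lia)).
  assert (Him := Rinv_0_lt_compat _ Hm).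
  destruct (Near (mkposreal _ Him)) as [d Hd].
  set (l := Rabs (ln (INR p))).
  apply (Rle_of_small _ _ (Q * (INR m * INR p) + INR m + INR p + l)%R (d / 2));
    [assert (H := cond_pos d); lra|].
  intros s Hs; assert (Hd0 := cond_pos d).
  destruct (Hd s ltac:(lra)) as [N1 N2]; cbn [pos] in N1, N2.
  assert (Ap := herglotz_diff_approx p q m A A1 s Hp Hq ltac:(unfold m; lia) ltac:(lra)
    HA LA HA1 LA1).
  fold Q in Ap.
  assert (W1 := one_sub_exp_pow_le s p ltac:(lra)).
  assert (W2 := one_sub_exp_pow_le s 1 ltac:(lra)).
  assert (L := ln_one_sub_exp_bounds s ltac:(lra)).
  set (e := ln (1 - exp (- s))) in *.
  assert (Hl : Rabs (ln (INR p) * (ln s - e)) <= l * s).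
  { rewrite Rabs_mult; apply Rmult_le_compat_l; [apply Rabs_pos|].
    rewrite Rabs_pos_eq; lra. }
  rewrite ln_mult in Ap by lra.
  replace (ln (INR 1)) with 0%R in N2 by (simpl; now rewrite ln_1).
  rewrite INR_1 in W2, Ap; rewrite Rmult_0_l, Rplus_0_r in N2.
  replace (1 / 1)%R with 1%R in Ap by field.
  unfold D; rewrite INR_1.
  replace (1 / 1)%R with 1%R by field.
  assert (Z1 : Q * (INR m * (1 - exp (- s) ^ p)) <= Q * (INR m * INR p) * s).
  { rewrite !Rmult_assoc; apply Rmult_le_compat_l; [lra|].
    apply Rmult_le_compat_l; lra. }
  assert (Z2 : INR m * (1 - exp (- s) ^ 1) <= INR m * s) by (apply Rmult_le_compat_l; lra).
  set (X := herglotzR (INR p / INR q)) in *; set (Y := herglotzR 1) in *.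
  set (w1 := (exp (- s) ^ p)%R) in *; set (w2 := (exp (- s) ^ 1)%R) in *.
  apply Rabs_def2 in N1; apply Rabs_def2 in N2.
  apply Rabs_le_between in Ap, Hl; apply Rabs_le; split; nra. }
assert (L : is_lim_seq (fun n => (Q + 3) * / INR (S n))%R ((Q + 3) * 0)%R).
{ apply (is_lim_seq_scal_l _ (Q + 3)%R 0%R).
  apply is_lim_seq_inv_INR. }
rewrite Rmult_0_r in L.
exact (is_lim_seq_le _ _ (Finite _) _ B (is_lim_seq_const _) L).
Qed.

(** * Derivatives of complex-valued functions of a real variable *)

(** The componentwise form gives access to real mean value arguments and to [auto_derive]. It is
    converted to derivatives in normed modules where the chain rule and integrals call for them. *)
Definition is_deriveC (f : R -> C) (t : R) (d : C) : Prop :=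
  is_derive (fun s => Re (f s)) t (Re d) /\ is_derive (fun s => Im (f s)) t (Im d).

Lemma is_deriveC_ext (f g : R -> C) (t : R) (d : C) :
  (forall s, f s = g s) -> is_deriveC f t d -> is_deriveC g t d.
Proof.
intros E [H1 H2]; split; [revert H1|revert H2]; apply is_derive_ext; intros s; now rewrite E.
Qed.

Lemma is_deriveC_eq (f : R -> C) (t : R) (d d' : C) :
  d = d' -> is_deriveC f t d -> is_deriveC f t d'.
Proof. now intros ->. Qed.

Lemma is_deriveC_const (c : C) (t : R) : is_deriveC (fun _ => c) t 0.
Proof. split; apply (is_derive_const (K := R_AbsRing) (V := R_NormedModule)). Qed.

Lemma is_deriveC_RtoC (f : R -> R) (t d : R) :
  is_derive f t d -> is_deriveC (fun s => RtoC (f s)) t (RtoC d).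
Proof.
intros H; split; [exact H|simpl].
apply (is_derive_const (K := R_AbsRing) (V := R_NormedModule) 0%R).
Qed.

Lemma is_deriveC_plus (f g : R -> C) (t : R) (a b : C) :
  is_deriveC f t a -> is_deriveC g t b -> is_deriveC (fun s => f s + g s) t (a + b).
Proof.
intros [F1 F2] [G1 G2]; split; now apply (is_derive_plus (V := R_NormedModule)).
Qed.

Lemma is_deriveC_opp (f : R -> C) (t : R) (a : C) :
  is_deriveC f t a -> is_deriveC (fun s => - f s) t (- a).
Proof. intros [F1 F2]; split; now apply (is_derive_opp (V := R_NormedModule)). Qed.

Lemma is_deriveC_minus (f g : R -> C) (t : R) (a b : C) :
  is_deriveC f t a -> is_deriveC g t b -> is_deriveC (fun s => f s - g s) t (a - b).
Proof. intros F G; apply is_deriveC_plus; [exact F|now apply is_deriveC_opp]. Qed.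

Lemma is_derive_multR (f g : R -> R) (t a b : R) :
  is_derive f t a -> is_derive g t b ->
  is_derive (fun s => f s * g s)%R t (a * g t + f t * b)%R.
Proof.
intros F G; apply (is_derive_mult f g t a b F G).
intros n m; apply Rmult_comm.
Qed.

Lemma is_deriveC_mult (f g : R -> C) (t : R) (a b : C) :
  is_deriveC f t a -> is_deriveC g t b ->
  is_deriveC (fun s => f s * g s) t (a * g t + f t * b).
Proof.
intros [F1 F2] [G1 G2]; split.
- apply (is_derive_ext (fun s => Re (f s) * Re (g s) - Im (f s) * Im (g s))%R);
    [intros s; reflexivity|].
  replace (Re (a * g t + f t * b)) with
    (minus (Re a * Re (g t) + Re (f t) * Re b) (Im a * Im (g t) + Im (f t) * Im b))%R.
  + apply (is_derive_minus (V := R_NormedModule)); now apply is_derive_multR.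
  + unfold minus, plus, opp; simpl; unfold Re, Im; ring.
- apply (is_derive_ext (fun s => Re (f s) * Im (g s) + Im (f s) * Re (g s))%R);
    [intros s; reflexivity|].
  replace (Im (a * g t + f t * b)) with
    (plus (Re a * Im (g t) + Re (f t) * Im b) (Im a * Re (g t) + Im (f t) * Re b))%R.
  + apply (is_derive_plus (V := R_NormedModule)); now apply is_derive_multR.
  + unfold minus, plus, opp; simpl; unfold Re, Im; ring.
Qed.

Lemma is_deriveC_scal (c : C) (f : R -> C) (t : R) (a : C) :
  is_deriveC f t a -> is_deriveC (fun s => c * f s) t (c * a).
Proof.
intros F; apply is_deriveC_eq with (0 * f t + c * a); [ring|].
apply is_deriveC_mult; [apply is_deriveC_const|exact F].
Qed.

Lemma is_deriveC_id (t : R) : is_deriveC (fun s => RtoC s) t 1.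
Proof. apply is_deriveC_RtoC, (is_derive_id (K := R_AbsRing)). Qed.

Lemma is_deriveC_linear (a b : C) (t : R) : is_deriveC (fun s => a - b * s) t (- b).
Proof.
apply is_deriveC_eq with (0 - b * 1); [ring|].
apply is_deriveC_minus; [apply is_deriveC_const|apply is_deriveC_scal, is_deriveC_id].
Qed.

(** The device behind the functional equations below: an identity is propagated along a path from
    one endpoint, which also settles the branches of the logarithms. *)
Lemma is_deriveC_constant (f : R -> C) (a b : R) :
  a <= b -> (forall t, a <= t <= b -> is_deriveC f t 0) -> f b = f a.
Proof.
intros Hab H; apply injective_projections.
- assert (B := mean_value_bound (fun s => Re (f s)) (fun _ => 0%R) (fun _ => 0%R) (fun _ => 0%R)
    a b Hab (fun t Ht => proj1 (H t Ht))
    (fun t _ => is_derive_const (K := R_AbsRing) (V := R_NormedModule) 0%R t)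
    (fun t _ => Req_le _ _ Rabs_R0)).
  rewrite Rminus_0_r in B; assert (B' := Rabs_pos (Re (f b) - Re (f a))).
  assert (E : (Re (f b) - Re (f a) = 0)%R) by (apply Rabs_eq_0; lra); unfold Re in E; lra.
- assert (B := mean_value_bound (fun s => Im (f s)) (fun _ => 0%R) (fun _ => 0%R) (fun _ => 0%R)
    a b Hab (fun t Ht => proj2 (H t Ht))
    (fun t _ => is_derive_const (K := R_AbsRing) (V := R_NormedModule) 0%R t)
    (fun t _ => Req_le _ _ Rabs_R0)).
  rewrite Rminus_0_r in B; assert (B' := Rabs_pos (Im (f b) - Im (f a))).
  assert (E : (Im (f b) - Im (f a) = 0)%R) by (apply Rabs_eq_0; lra); unfold Im in E; lra.
Qed.

Lemma is_deriveC_unique (f : R -> C) (t : R) (a b : C) :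
  is_deriveC f t a -> is_deriveC f t b -> a = b.
Proof.
intros [A1 A2] [B1 B2]; apply injective_projections.
- exact (eq_trans (eq_sym (is_derive_unique _ _ _ A1)) (is_derive_unique _ _ _ B1)).
- exact (eq_trans (eq_sym (is_derive_unique _ _ _ A2)) (is_derive_unique _ _ _ B2)).
Qed.

Lemma scal_RC (a : R) (z : C) : @scal R_AbsRing C_R_NormedModule a z = RtoC a * z.
Proof.
apply injective_projections.
- change (a * fst z = a * fst z - 0 * snd z)%R; ring.
- change (a * snd z = a * snd z + 0 * fst z)%R; ring.
Qed.

Lemma C_decomp (z : C) :
  @plus C_R_NormedModule (@scal R_AbsRing C_R_NormedModule (Re z) (RtoC 1))
    (@scal R_AbsRing C_R_NormedModule (Im z) Ci) = z.
Proof.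
rewrite !scal_RC.
change (Re z * 1 + Im z * Ci = z).
apply injective_projections; simpl; unfold Re, Im; ring.
Qed.

Lemma is_derive_of_deriveC (f : R -> C) (t : R) (d : C) :
  is_deriveC f t d -> @is_derive R_AbsRing C_R_NormedModule f t d.
Proof.
intros [H1 H2].
apply (@is_derive_ext R_AbsRing C_R_NormedModule _ _ _ _ (fun s => C_decomp (f s))).
rewrite <- (C_decomp d).
apply (@is_derive_plus R_AbsRing C_R_NormedModule);
  now apply (@is_derive_scal_l R_AbsRing C_R_NormedModule).
Qed.

Lemma deriveC_of_is_derive (f : R -> C) (t : R) (d : C) :
  @is_derive R_AbsRing C_R_NormedModule f t d -> is_deriveC f t d.
Proof.
intros H; split.
- apply (@filterdiff_comp' R_AbsRing R_NormedModule C_R_NormedModule R_NormedModule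
    f fst t (fun y => scal y d) fst H).
  apply filterdiff_linear, is_linear_fst.
- apply (@filterdiff_comp' R_AbsRing R_NormedModule C_R_NormedModule R_NormedModule
    f snd t (fun y => scal y d) snd H).
  apply filterdiff_linear, is_linear_snd.
Qed.

Lemma is_deriveC_continuous (f : R -> C) (t : R) (d : C) :
  is_deriveC f t d -> filterlim f (locally t) (@locally C_UniformSpace (f t)).
Proof.
intros H; apply is_derive_of_deriveC in H.
apply (@filterdiff_continuous R_AbsRing R_NormedModule C_R_NormedModule f t).
eexists; exact H.
Qed.

(** Multiplication by the complex derivative [l] is R-linear, so F is differentiable as a map of
    real normed modules, where the chain rule applies. *)
Lemma is_deriveC_comp_C (F : C -> C) (f : R -> C) (t : R) (l d : C) :
  @is_derive C_AbsRing C_NormedModule F (f t) l -> is_deriveC f t d ->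
  is_deriveC (fun s => F (f s)) t (l * d).
Proof.
intros [_ HF] Hf.
apply deriveC_of_is_derive.
assert (HR : @filterdiff R_AbsRing C_R_NormedModule C_R_NormedModule F (locally (f t))
  (fun y => l * y)).
{ split.
  - split.
    + intros x y; change (l * (x + y) = l * x + l * y); ring.
    + intros k x; rewrite !scal_RC; eqC; ring.
    + exists (Cmod l + 1)%R; split; [assert (H := Cmod_ge_0 l); lra|].
      intros x; rewrite <- !Cmod_norm, Cmod_mult.
      assert (H1 := Cmod_ge_0 l); assert (H2 := Cmod_ge_0 x); nra.
  - intros x Hx.
    apply (@is_filter_lim_locally_unique R_AbsRing C_R_NormedModule) in Hx; subst x.
    intros eps.
    specialize (HF (f t) (fun P HP => HP) eps).
    apply locally_C in HF; revert HF; apply filter_imp; intros w Hw.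
    rewrite <- !Cmod_norm.
    change (Cmod (F w - F (f t) - (w - f t) * l) <= eps * Cmod (w - f t)) in Hw.
    change (Cmod (F w - F (f t) - l * (w - f t)) <= eps * Cmod (w - f t)).
    rewrite (Cmult_comm l); exact Hw. }
apply is_derive_of_deriveC in Hf.
assert (G := @filterdiff_comp' R_AbsRing R_NormedModule C_R_NormedModule C_R_NormedModule
  f F t _ _ Hf HR).
apply (filterdiff_ext_lin _ _ _ G); intros y.
rewrite !scal_RC; eqC; ring.
Qed.

(** * The slit plane and the derivatives of Log and Li2 *)

Definition off_neg (z : C) : Prop := ~ (Im z = 0%R /\ Re z <= 0).

Lemma off_neg_right (z : C) : 0 < Re z -> off_neg z.
Proof. intros H [_ H']; lra. Qed.

Lemma off_neg_neq0 (z : C) : off_neg z -> z <> 0.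
Proof. intros H E; apply H; rewrite E; simpl; lra. Qed.

Lemma on_cut_off_neg (z : C) : off_neg (1 - z) <-> ~ on_cut z.
Proof.
unfold off_neg, on_cut; destruct z as [x y]; simpl; split; intros H [H1 H2]; apply H; lra.
Qed.

Lemma is_deriveC_Clog (f : R -> C) (t : R) (d : C) :
  off_neg (f t) -> is_deriveC f t d -> is_deriveC (fun s => Clog (f s)) t (d / f t).
Proof.
intros Hn [D1 D2].
assert (Hp := Cmod_plus_Re_gt0 _ Hn).
assert (H0 := off_neg_neq0 _ Hn).
set (x := fun s => Re (f s)) in *; set (y := fun s => Im (f s)) in *.
assert (Em : forall s, Cmod (f s) = sqrt (x s * x s + y s * y s)).
{ intros s; unfold Cmod, x, y, Re, Im; f_equal; ring. }
assert (Hm : 0 < x t * x t + y t * y t).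
{ apply Cmod_gt_0 in H0; rewrite Em in H0.
  apply Rnot_le_lt; intros H; rewrite sqrt_neg_0 in H0 by easy; lra. }
assert (Hs := sqrt_lt_R0 _ Hm); assert (Ess := sqrt_sqrt _ (Rlt_le _ _ Hm)).
rewrite Em in Hp; change (Re (f t)) with (x t) in Hp.
assert (Dm : is_derive (fun s => sqrt (x s * x s + y s * y s)) t
  ((x t * Re d + y t * Im d) / sqrt (x t * x t + y t * y t))%R).
{ replace ((x t * Re d + y t * Im d) / sqrt (x t * x t + y t * y t))%R with
    (scal (plus (Re d * x t + x t * Re d) (Im d * y t + y t * Im d))
      (/ (2 * sqrt (x t * x t + y t * y t))))%R.
  - apply (is_derive_comp sqrt (fun s => x s * x s + y s * y s)%R).
    + auto_derive; [easy|field; lra].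
    + apply (is_derive_plus (V := R_NormedModule)); now apply is_derive_multR.
  - unfold scal, plus; simpl; unfold mult; simpl; field; lra. }
assert (E : d / f t = ((x t * Re d + y t * Im d) / (x t * x t + y t * y t),
  (x t * Im d - y t * Re d) / (x t * x t + y t * y t))%R).
{ unfold x, y in *; destruct (f t) as [u v], d as [a b]; simpl in *.
  apply injective_projections; simpl; field; lra. }
rewrite E; set (r := sqrt (x t * x t + y t * y t)) in *; split.
- apply (is_derive_ext (fun s => ln (sqrt (x s * x s + y s * y s)))).
  { intros s; simpl; now rewrite Em. }
  simpl Re; replace ((x t * Re d + y t * Im d) / (x t * x t + y t * y t))%R with
    (scal ((x t * Re d + y t * Im d) / r) (/ r))%R.
  + apply (is_derive_comp ln); [apply is_derive_ln; exact Hs|exact Dm].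
  + rewrite <- Ess; unfold scal; simpl; unfold mult; simpl; field; lra.
- simpl Im.
  apply is_derive_ext_loc with (fun s =>
    2 * atan (y s / (sqrt (x s * x s + y s * y s) + x s)))%R.
  + assert (Hc : continuous (fun s => sqrt (x s * x s + y s * y s) + x s)%R t).
    { apply (ex_derive_continuous (V := R_NormedModule)).
      eexists; apply (is_derive_plus (V := R_NormedModule)); [exact Dm|exact D1]. }
    generalize (Hc _ (open_gt 0 _ Hp)); unfold filtermap; apply filter_imp; intros s Hs'.
    change (Im (Clog ?w)) with (Carg w); rewrite Carg_half_angle.
    * rewrite Em; reflexivity.
    * fold (x s) (y s); intros [Hi Hr].
      change (Im (f s)) with (y s) in Hi; change (Re (f s)) with (x s) in Hr.
      rewrite Hi, Rmult_0_l, Rplus_0_r in Hs'; fold (Rsqr (x s)) in Hs'.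
      rewrite sqrt_Rsqr_abs, Rabs_left1 in Hs' by easy; lra.
  + set (g := (y t / (r + x t))%R).
    (* From y^2 = r^2 - x^2 one gets (r + x)^2 + y^2 = 2r(r + x). *)
    assert (Eg : (1 + g ^ 2 = 2 * r / (r + x t))%R).
    { unfold g; apply Rmult_eq_reg_r with ((r + x t) * (r + x t))%R; [|nra].
      transitivity ((r + x t) * (r + x t) + y t * y t)%R; [field; lra|].
      transitivity (2 * r * (r + x t))%R; [lra|field; lra]. }
    assert (Dg : is_derive (fun s => y s / (sqrt (x s * x s + y s * y s) + x s))%R t
      ((Im d * (r + x t) - y t * ((x t * Re d + y t * Im d) / r + Re d)) / (r + x t) ^ 2)%R).
    { apply (is_derive_div y (fun s => sqrt (x s * x s + y s * y s) + x s)%R);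
        [exact D2| |apply Rgt_not_eq; exact Hp].
      apply (is_derive_plus (V := R_NormedModule)); [exact Dm|exact D1]. }
    assert (Da : is_derive atan g (/ (1 + g ^ 2))%R).
    { auto_derive; [easy|field; simpl; nra]. }
    assert (D := is_derive_scal _ t 2 _ (is_derive_comp atan (fun s => y s / (sqrt (x s * x s + y s * y s) + x s))%R t _ _ Da Dg)).
    replace ((x t * Im d - y t * Re d) / (x t * x t + y t * y t))%R with
      (2 * scal ((Im d * (r + x t) - y t * ((x t * Re d + y t * Im d) / r + Re d)) / (r + x t) ^ 2)
         (/ (1 + g ^ 2)))%R; [exact D|].
    rewrite Eg, <- Ess; unfold scal; simpl; unfold mult; simpl.
    assert (Ey : (y t * y t = r * r - x t * x t)%R) by lra.
    generalize (Re d) (Im d); intros a b.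
    transitivity ((b * r * (r + x t) - x t * a * y t - (y t * y t) * b - a * y t * r) / (r * r * (r + x t)))%R.
    * field; lra.
    * rewrite Ey; field; lra.
Qed.

Lemma off_cut_ray (z : C) :
  ~ on_cut z -> locally 1%R (fun r : R => ~ on_cut (r * z) /\ 0 < r).
Proof.
intros Hz; apply filter_and; [|apply (open_gt 0); lra].
destruct (Req_dec (Im z) 0) as [Hi|Hi].
- assert (Hr : Re z < 1) by (apply Rnot_le_lt; intros H; apply Hz; split; easy).
  assert (Hc : continuous (fun r => r * Re z)%R 1).
  { apply (ex_derive_continuous (V := R_NormedModule)); auto_derive; easy. }
  assert (Hl : 1 * Re z < 1) by lra.
  generalize (Hc _ (open_lt 1 _ Hl)); unfold filtermap; apply filter_imp.
  intros r H [_ H']; rewrite re_scal_l in H'; lra.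
- generalize (open_gt 0 1%R Rlt_0_1); apply filter_imp; intros r Hr [H _].
  rewrite im_scal_l in H; apply Rmult_integral in H; lra.
Qed.

(** Holomorphy provides some derivative l, and its value is found along the ray r z at r = 1. By
    substitution Li2(rz) is the integral of -Log(1-tz)/t from 0 to r, so its r-derivative is
    -Log(1-z), while the chain rule gives l z. *)
Lemma Li2_derive (z : C) :
  ~ on_cut z -> z <> 0 ->
  @is_derive C_AbsRing C_NormedModule Li2 z (- Clog (1 - z) / z).
Proof.
intros Hz Hz0; destruct (Li2_holomorphic z Hz) as [l Hl]; change C in l.
enough (E : l = - Clog (1 - z) / z) by (rewrite <- E; exact Hl).
enough (E : l * z = - Clog (1 - z)) by (rewrite <- E; field; exact Hz0).
apply (is_deriveC_unique (fun r => Li2 (r * z)) 1%R).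
- apply (is_deriveC_comp_C Li2 (fun r => r * z)).
  + rewrite Cmult_1_l; exact Hl.
  + apply is_deriveC_ext with (fun s => z * s); [intros; ring|].
    apply is_deriveC_eq with (z * 1); [ring|].
    apply is_deriveC_scal, is_deriveC_id.
- apply deriveC_of_is_derive.
  set (f := fun t : R => - Clog (1 - t * z) / t).
  replace (- Clog (1 - z)) with (f 1%R).
  2: { unfold f; rewrite Cmult_1_l; field. }
  apply (@is_derive_RInt C_R_NormedModule f _ 0%R).
  + generalize (off_cut_ray z Hz); apply filter_imp; intros r [Hr Hr0]; change R in r.
    assert (I := is_RInt_Li2_slit _ Hr).
    rewrite (Li2_off_cut _ Hr).
    assert (I' := @is_RInt_comp_lin C_R_NormedModule
      (fun t : R => - Clog (1 - t * (r * z)) / t) (/ r)%R 0%R 0%R r (Li2_slit (r * z))).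
    replace (/ r * 0 + 0)%R with 0%R in I' by ring.
    replace (/ r * r + 0)%R with 1%R in I' by (field; lra).
    specialize (I' I); revert I'; apply (@is_RInt_ext C_R_NormedModule).
    intros t; rewrite Rmin_left, Rmax_right by lra; intros Ht.
    unfold f; rewrite Rplus_0_r.
    replace (RtoC (/ r * t)%R * (r * z)) with (t * z).
    2: { rewrite RtoC_mult, RtoC_inv by lra; field; intros E; apply RtoC_inj in E; lra. }
    generalize (- Clog (1 - t * z)); intros c.
    rewrite scal_RC, RtoC_mult, RtoC_inv by lra; eqC; field.
    split; intros E; apply RtoC_inj in E; lra.
  + set (w := 1 - 1%R * z).
    assert (Hw : off_neg w).
    { unfold w; rewrite Cmult_1_l; now apply on_cut_off_neg. }
    assert (D : is_deriveC f 1%R ((- (- z / w)) * / 1%R + - Clog w * (-1)%R)).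
    { unfold f, Cdiv; apply (is_deriveC_mult (fun t => - Clog (1 - t * z)) (fun t => / RtoC t)).
      - apply is_deriveC_opp, (is_deriveC_Clog (fun t => 1 - t * z)); [exact Hw|].
        apply is_deriveC_ext with (fun s => 1 - z * s); [intros; ring|].
        apply is_deriveC_linear.
      - assert (D : is_deriveC (fun t => RtoC (/ t)%R) 1 (RtoC (-1)%R)).
        { apply is_deriveC_RtoC; auto_derive; [lra|field]. }
        destruct D as [D1 D2]; split; [revert D1|revert D2]; apply is_derive_ext_loc;
        generalize (open_gt 0 1%R Rlt_0_1); apply filter_imp; intros s Hs;
        rewrite RtoC_inv by lra; reflexivity. }
    apply (is_deriveC_continuous _ _ _ D).
Qed.

Lemma is_deriveC_Li2 (f : R -> C) (t : R) (d : C) :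
  ~ on_cut (f t) -> f t <> 0 -> is_deriveC f t d ->
  is_deriveC (fun s => Li2 (f s)) t (- Clog (1 - f t) / f t * d).
Proof. intros H1 H2 D; apply is_deriveC_comp_C; [now apply Li2_derive|exact D]. Qed.

Lemma Li2_path_continuous (f : R -> C) (t : R) (d : C) :
  ~ on_cut (f t) -> is_deriveC f t d ->
  filterlim (fun s => Li2 (f s)) (locally t) (@locally C_UniformSpace (Li2 (f t))).
Proof.
intros H D; destruct (Li2_holomorphic _ H) as [l Hl]; change C in l.
apply (is_deriveC_continuous (fun s => Li2 (f s)) _ (l * d)); now apply is_deriveC_comp_C.
Qed.

Lemma Li2_0 : Li2 0 = 0.
Proof.
assert (H : ~ on_cut 0) by (intros [_ H]; simpl in H; lra).
rewrite Li2_off_cut by easy.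
assert (I := is_RInt_Li2_slit 0 H).
enough (J : @is_RInt C_R_NormedModule (fun t : R => - Clog (1 - t * 0) / t) 0 1 (RtoC 0)).
{ exact (eq_trans (eq_sym (@is_RInt_unique C_R_CompleteNormedModule _ _ _ _ I))
    (@is_RInt_unique C_R_CompleteNormedModule _ _ _ _ J)). }
apply (@is_RInt_ext C_R_NormedModule (fun _ => RtoC 0)).
- intros t _; replace (1 - t * 0) with (RtoC 1) by ring.
  rewrite Clog_1; eqC; unfold Cdiv; ring.
- assert (K := @is_RInt_const C_R_NormedModule 0%R 1%R (RtoC 0)).
  rewrite scal_RC in K; replace (RtoC (1 - 0)%R * 0) with (RtoC 0) in K by ring; exact K.
Qed.

(** * The rational span of dilogarithms *)

(** The span of the theorem over an arbitrary set of generators. The generators then enter only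
    through closure under conjugation and the membership of [zeta p] and [zeta q]. *)
Definition Li2_span (G : C -> Prop) (v : C) : Prop :=
  Qspan (fun v : C => exists alpha : C, Qadjoin G alpha /\ v = Li2 alpha) v.

Lemma Li2_span_Li2 (G : C -> Prop) (a : C) : Qadjoin G a -> Li2_span G (Li2 a).
Proof.
intros Ha; exists ((1%Q, Li2 a) :: nil); split.
- constructor; [exists a; easy|constructor].
- simpl; replace (Q2R 1) with 1%R by (unfold Q2R; simpl; field); ring.
Qed.

Lemma Li2_span_0 (G : C -> Prop) : Li2_span G 0.
Proof. exists nil; split; [constructor|reflexivity]. Qed.

Lemma Li2_span_plus (G : C -> Prop) (v w : C) :
  Li2_span G v -> Li2_span G w -> Li2_span G (v + w).
Proof.
intros [l1 [F1 E1]] [l2 [F2 E2]]; exists (l1 ++ l2); split.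
- now apply Forall_app.
- rewrite fold_right_app, <- E2; subst v; clear.
  induction l1 as [|a l IH]; simpl; [ring|rewrite <- IH; ring].
Qed.

Lemma Li2_span_scal (G : C -> Prop) (c : Q) (v : C) :
  Li2_span G v -> Li2_span G (Q2R c * v).
Proof.
intros [l [F E]]; exists (map (fun a => (c * fst a, snd a)%Q) l); split.
- apply Forall_map; revert F; apply Forall_impl; easy.
- subst v; clear; induction l as [|a l IH]; simpl; [ring|].
  rewrite <- IH, Q2R_mult, RtoC_mult; ring.
Qed.

Lemma Li2_span_opp (G : C -> Prop) (v : C) : Li2_span G v -> Li2_span G (- v).
Proof.
intros H; replace (- v) with (Q2R (-1) * v); [now apply Li2_span_scal|].
replace (Q2R (-1)) with (-1)%R by (unfold Q2R; simpl; field).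
replace (RtoC (-1)) with (- RtoC 1) by (rewrite <- RtoC_opp; f_equal; ring); ring.
Qed.

Lemma Li2_span_minus (G : C -> Prop) (v w : C) :
  Li2_span G v -> Li2_span G w -> Li2_span G (v - w).
Proof. intros Hv Hw; apply Li2_span_plus; [exact Hv|now apply Li2_span_opp]. Qed.

Lemma Li2_span_nat (G : C -> Prop) (n : nat) (v : C) :
  Li2_span G v -> Li2_span G (INR n * v).
Proof.
intros H; induction n as [|n IH].
- simpl; rewrite Cmult_0_l; apply Li2_span_0.
- rewrite S_INR, RtoC_plus.
  replace ((INR n + 1) * v) with (INR n * v + v) by ring.
  now apply Li2_span_plus.
Qed.

Lemma Li2_span_div_nat (G : C -> Prop) (n : nat) (v : C) :
  (0 < n)%nat -> Li2_span G v -> Li2_span G (v / INR n).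
Proof.
intros Hn H; replace (v / INR n) with (Q2R (1 # Pos.of_nat n) * v).
- now apply Li2_span_scal.
- assert (H0 := lt_0_INR n Hn).
  replace (Q2R (1 # Pos.of_nat n)) with (/ INR n)%R.
  + rewrite RtoC_inv by lra; unfold Cdiv; ring.
  + unfold Q2R; simpl; rewrite INR_IZR_INZ.
    replace (Z.pos (Pos.of_nat n)) with (Z.of_nat n) by lia; ring.
Qed.

Lemma Li2_span_half (G : C -> Prop) (v : C) : Li2_span G v -> Li2_span G (v / 2).
Proof.
intros H; replace (RtoC 2) with (RtoC (INR 2)) by (f_equal; simpl; ring).
apply Li2_span_div_nat; [lia|exact H].
Qed.

(** * Field operations in Q(G) *)

Lemma Qadjoin_minus (G : C -> Prop) (a b : C) :
  Qadjoin G a -> Qadjoin G b -> Qadjoin G (a - b).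
Proof. intros Ha Hb; apply Qadjoin_add; [exact Ha|now apply Qadjoin_opp]. Qed.

Definition conj_closed (G : C -> Prop) : Prop := forall z, G z -> Qadjoin G (Cconj z).

Lemma Qadjoin_conj (G : C -> Prop) (z : C) :
  conj_closed G -> Qadjoin G z -> Qadjoin G (Cconj z).
Proof.
intros HG H; induction H as [z Hz| |z w _ IH1 _ IH2|z _ IH|z w _ IH1 _ IH2|z Hn Hz IH].
- now apply HG.
- replace (Cconj 1) with (RtoC 1); [apply Qadjoin_1|].
  apply injective_projections; simpl; ring.
- rewrite Cplus_conj; now apply Qadjoin_add.
- rewrite Copp_conj; now apply Qadjoin_opp.
- rewrite Cmult_conj; now apply Qadjoin_mul.
(* In this case [z] is real, so conjugation fixes its inverse. *)
- replace (Cconj (/ z)) with (/ RtoC z); [now apply Qadjoin_inv|].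
  rewrite <- RtoC_inv by easy; apply injective_projections; simpl; ring.
Qed.

(* [Qadjoin_inv] only inverts real elements, whence [1 / z = conj z / |z|^2]. *)
Lemma Qadjoin_Cinv (G : C -> Prop) (z : C) :
  conj_closed G -> z <> 0 -> Qadjoin G z -> Qadjoin G (/ z).
Proof.
intros HG Hn Hz.
set (r := (Cmod z ^ 2)%R).
assert (Hm := proj1 (Cmod_gt_0 z) Hn).
assert (Hr : (r <> 0)%R) by (apply pow_nonzero; lra).
assert (Er : RtoC r = z * Cconj z) by apply Cmod2_conj.
replace (/ z) with (Cconj z * / RtoC r).
- apply Qadjoin_mul; [now apply Qadjoin_conj|].
  apply Qadjoin_inv; [exact Hr|].
  rewrite Er; apply Qadjoin_mul; [exact Hz|now apply Qadjoin_conj].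
- assert (Hc : Cconj z <> 0).
  { intros E; rewrite E, Cmult_0_r in Er; apply RtoC_inj in Er; easy. }
  rewrite Er; field; easy.
Qed.

Lemma Qadjoin_div (G : C -> Prop) (a b : C) :
  conj_closed G -> b <> 0 -> Qadjoin G a -> Qadjoin G b -> Qadjoin G (a / b).
Proof. intros HG H Ha Hb; apply Qadjoin_mul; [exact Ha|now apply Qadjoin_Cinv]. Qed.

Lemma Qadjoin_pow (G : C -> Prop) (a : C) (n : nat) : Qadjoin G a -> Qadjoin G (a ^ n).
Proof.
intros Ha; induction n as [|n IH]; simpl; [apply Qadjoin_1|now apply Qadjoin_mul].
Qed.

Lemma Qadjoin_nat (G : C -> Prop) (n : nat) : Qadjoin G (INR n).
Proof.
induction n as [|n IH].
- simpl; replace (RtoC 0) with (1 - 1) by ring; apply Qadjoin_minus; apply Qadjoin_1.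
- rewrite S_INR, RtoC_plus; apply Qadjoin_add; [exact IH|apply Qadjoin_1].
Qed.

(** * Branches of the logarithm *)

Lemma Cexp_plus (a b : C) : Cexp (a + b) = Cexp a * Cexp b.
Proof.
unfold Cexp; rewrite re_plus, im_plus, exp_plus, cos_plus, sin_plus.
apply injective_projections; simpl; ring.
Qed.

Lemma Cexp_0 : Cexp 0 = 1.
Proof. rewrite Cexp_RtoC, exp_0; reflexivity. Qed.

Lemma Cexp_opp (a : C) : Cexp (- a) * Cexp a = 1.
Proof. rewrite <- Cexp_plus, Cplus_comm, Cplus_opp_r; apply Cexp_0. Qed.

Lemma Cexp_neq0 (a : C) : Cexp a <> 0.
Proof.
intros E; assert (H := Cexp_opp a); rewrite E, Cmult_0_r in H.
apply RtoC_inj in H; lra.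
Qed.

Lemma off_neg_Cexp (w : C) : - PI < Im w < PI -> off_neg (Cexp w).
Proof.
intros Hw [Hi Hr]; unfold Cexp in Hi, Hr; simpl in Hi, Hr.
assert (He := exp_pos (Re w)).
assert (Hs : sin (Im w) = 0%R) by (apply Rmult_integral in Hi; lra).
assert (H0 : Im w = 0%R).
{ destruct (Rtotal_order (Im w) 0) as [H|[H|H]]; [|easy|].
  - assert (0 < sin (- Im w)) by (apply sin_gt_0; lra); rewrite sin_neg in *; lra.
  - assert (0 < sin (Im w)) by (apply sin_gt_0; lra); lra. }
rewrite H0, cos_0 in Hr; lra.
Qed.

Lemma is_deriveC_Cexp_ray (w : C) (t : R) :
  is_deriveC (fun s => Cexp (w * s)) t (w * Cexp (w * t)).
Proof.
destruct w as [a b]; split.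
- apply (is_derive_ext (fun s => exp (a * s) * cos (b * s))%R).
  + intros s; unfold Cexp; simpl; f_equal; f_equal; ring.
  + unfold Cexp; simpl; auto_derive; [easy|].
    replace (a * t - b * 0)%R with (a * t)%R by ring.
    replace (a * 0 + b * t)%R with (b * t)%R by ring; ring.
- apply (is_derive_ext (fun s => exp (a * s) * sin (b * s))%R).
  + intros s; unfold Cexp; simpl; f_equal; f_equal; ring.
  + unfold Cexp; simpl; auto_derive; [easy|].
    replace (a * t - b * 0)%R with (a * t)%R by ring.
    replace (a * 0 + b * t)%R with (b * t)%R by ring; ring.
Qed.

Lemma Im_ray_bound (w : C) (t : R) :
  - PI < Im w < PI -> 0 <= t <= 1 -> - PI < Im (w * t) < PI.
Proof. intros Hw Ht; rewrite im_scal_r; assert (H := PI_RGT_0); nra. Qed.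

(** Log(e^(wt)) - wt has derivative 0 on [0, 1], where e^(wt) stays off the negative axis, and it
    vanishes at t = 0. *)
Lemma Clog_Cexp (w : C) : - PI < Im w < PI -> Clog (Cexp w) = w.
Proof.
intros Hw.
set (f := fun t : R => Clog (Cexp (w * t)) - w * t).
assert (E : f 1%R = f 0%R).
{ apply is_deriveC_constant; [lra|]; intros t Ht.
  apply is_deriveC_eq with (w * Cexp (w * t) / Cexp (w * t) - w * 1).
  - field; apply Cexp_neq0.
  - apply is_deriveC_minus; [|apply is_deriveC_scal, is_deriveC_id].
    apply (is_deriveC_Clog (fun s => Cexp (w * s))); [|apply is_deriveC_Cexp_ray].
    now apply off_neg_Cexp, Im_ray_bound. }
unfold f in E; rewrite Cmult_1_r, Cmult_0_r, Cexp_0, Clog_1 in E.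
replace (Clog (Cexp w)) with ((Clog (Cexp w) - w) + w) by ring.
rewrite E; ring.
Qed.

Lemma Im_Clog_off_neg (z : C) : off_neg z -> - PI < Im (Clog z) < PI.
Proof.
intros H; change (Im (Clog z)) with (Carg z); rewrite Carg_half_angle by easy.
assert (Ha := atan_bound (Im z / (Cmod z + Re z))); lra.
Qed.

(** Since |Im z| < |z| + Re z, the tangent of the half angle lies in (-1, 1). *)
Lemma Im_Clog_right (z : C) : 0 < Re z -> - (PI / 2) < Im (Clog z) < PI / 2.
Proof.
intros H; change (Im (Clog z)) with (Carg z).
rewrite Carg_half_angle by now apply off_neg_right.
assert (Hm : Rabs (Im z) <= Cmod z).
{ eapply Rle_trans; [|apply Rmax_Cmod]; apply Rmax_r. }
apply Rabs_le_between in Hm; assert (H0 := Cmod_ge_0 z).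
set (q := (Im z / (Cmod z + Re z))%R).
assert (Eq : (q * (Cmod z + Re z) = Im z)%R) by (unfold q; field; lra).
assert (Hq : -1 < q < 1) by (split; nra).
assert (A1 := atan_increasing q 1 (proj2 Hq)); assert (A2 := atan_increasing (-1) q (proj1 Hq)).
replace (-1)%R with (- (1))%R in A2 by ring; rewrite atan_opp in A2.
rewrite atan_1 in *; lra.
Qed.

(** Two arguments in (-pi/2, pi/2) differ by less than pi, so no multiple of 2 pi i appears. *)
Lemma Clog_div_right (a b : C) :
  0 < Re a -> 0 < Re b -> off_neg (a / b) /\ Clog (a / b) = Clog a - Clog b.
Proof.
intros Ha Hb.
assert (A := Im_Clog_right a Ha); assert (B := Im_Clog_right b Hb).
assert (Na := off_neg_neq0 _ (off_neg_right _ Ha)).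
assert (Nb := off_neg_neq0 _ (off_neg_right _ Hb)).
assert (E : a / b = Cexp (Clog a - Clog b)).
{ unfold Cminus; rewrite Cexp_plus, Cexp_Clog by easy.
  assert (H := Cexp_opp (Clog b)); rewrite Cexp_Clog in H by easy.
  unfold Cdiv; f_equal.
  replace (/ b) with (Cexp (- Clog b) * b * / b); [field; easy|rewrite H; ring]. }
assert (I : - PI < Im (Clog a - Clog b) < PI).
{ unfold Cminus; rewrite im_plus, im_opp; lra. }
rewrite E; split; [now apply off_neg_Cexp|now apply Clog_Cexp].
Qed.

Lemma off_neg_1p (w : C) : off_neg w -> off_neg (1 + w).
Proof. unfold off_neg; destruct w; simpl; intros H [H1 H2]; apply H; lra. Qed.

(** On the path W = e^(lt) from 1 to w, with V = 1/W, the derivative of Li2(-W) + Li2(-V) is -l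
    (Log(1+W) - Log(1+V)) = -l^2 t. The starting point t = 0 gives the constant 2 Li2(-1). *)
Lemma Li2_inversion (w : C) :
  off_neg w -> Li2 (- w) + Li2 (- / w) + Clog w * Clog w / 2 = 2 * Li2 (-1).
Proof.
intros Hw; assert (Hl := Im_Clog_off_neg w Hw).
assert (H0 := off_neg_neq0 w Hw).
set (l := Clog w) in *.
assert (Hl' : - PI < Im (- l) < PI) by (rewrite im_opp; lra).
set (W := fun t : R => Cexp (l * t)); set (V := fun t : R => Cexp (- l * t)).
assert (VW : forall t, V t * W t = 1).
{ intros t; unfold V, W; replace (- l * t) with (- (l * t)) by ring; apply Cexp_opp. }
assert (OW : forall t, 0 <= t <= 1 -> off_neg (W t))
  by (intros t Ht; now apply off_neg_Cexp, Im_ray_bound).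
assert (OV : forall t, 0 <= t <= 1 -> off_neg (V t))
  by (intros t Ht; now apply off_neg_Cexp, Im_ray_bound).
assert (DW : forall t, is_deriveC W t (l * W t)) by (intros; apply is_deriveC_Cexp_ray).
assert (DV : forall t, is_deriveC V t (- l * V t)) by (intros; apply is_deriveC_Cexp_ray).
assert (NW : forall t, W t <> 0) by (intros; apply Cexp_neq0).
assert (NV : forall t, V t <> 0) by (intros; apply Cexp_neq0).
assert (W0 : W 0%R = 1) by (unfold W; rewrite Cmult_0_r; apply Cexp_0).
assert (V0 : V 0%R = 1) by (unfold V; rewrite Cmult_0_r; apply Cexp_0).
assert (EV : forall t, V t = / W t).
{ intros t; replace (/ W t) with (V t * W t * / W t) by (rewrite VW; ring); field; apply NW. }
assert (Phi : forall t, 0 <= t <= 1 -> Clog (1 + W t) - Clog (1 + V t) = l * t).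
{ intros t Ht.
  set (f := fun t : R => Clog (1 + W t) - Clog (1 + V t) - l * t).
  assert (E : f t = f 0%R).
  { apply is_deriveC_constant; [lra|]; intros s Hs.
    assert (N1 := off_neg_neq0 _ (off_neg_1p _ (OW s ltac:(lra)))).
    apply is_deriveC_eq with ((0 + l * W s) / (1 + W s) - (0 + - l * V s) / (1 + V s) - l * 1).
    - rewrite EV; field; repeat split; try apply NW; try exact N1.
      rewrite Cplus_comm; exact N1.
    - apply is_deriveC_minus; [apply is_deriveC_minus|apply is_deriveC_scal, is_deriveC_id].
      + apply (is_deriveC_Clog (fun s => 1 + W s)).
        * apply off_neg_1p, OW; lra.
        * apply is_deriveC_plus; [apply is_deriveC_const|apply DW].
      + apply (is_deriveC_Clog (fun s => 1 + V s)).
        * apply off_neg_1p, OV; lra.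
        * apply is_deriveC_plus; [apply is_deriveC_const|apply DV]. }
  unfold f in E; rewrite W0, V0, Cmult_0_r in E.
  replace (Clog (1 + W t) - Clog (1 + V t)) with
    (Clog (1 + W t) - Clog (1 + V t) - l * t + l * t) by ring.
  rewrite E; ring. }
set (F := fun t : R => Li2 (- W t) + Li2 (- V t) + l * l * RtoC (t * t / 2)%R).
assert (E : F 1%R = F 0%R).
{ apply is_deriveC_constant; [lra|]; intros t Ht.
  assert (Cut : forall z, off_neg z -> ~ on_cut (- z)).
  { intros z Hz; apply on_cut_off_neg; replace (1 - - z) with (1 + z) by ring.
    now apply off_neg_1p. }
  apply is_deriveC_eq with
    (- Clog (1 - - W t) / - W t * - (l * W t) + - Clog (1 - - V t) / - V t * - (- l * V t)
     + l * l * RtoC t).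
  - replace (1 - - W t) with (1 + W t) by ring; replace (1 - - V t) with (1 + V t) by ring.
    replace (Clog (1 + W t)) with ((Clog (1 + W t) - Clog (1 + V t)) + Clog (1 + V t)) by ring.
    rewrite (Phi t Ht); field.
    split; [apply NV|apply NW].
  - apply is_deriveC_plus; [apply is_deriveC_plus|].
    + apply (is_deriveC_Li2 (fun s => - W s)).
      * apply Cut, OW; lra.
      * intros E; apply (NW t); replace (W t) with (- - W t) by ring; rewrite E; ring.
      * apply is_deriveC_opp, DW.
    + apply (is_deriveC_Li2 (fun s => - V s)).
      * apply Cut, OV; lra.
      * intros E; apply (NV t); replace (V t) with (- - V t) by ring; rewrite E; ring.
      * apply is_deriveC_opp, DV.
    + apply is_deriveC_scal, is_deriveC_RtoC; auto_derive; [easy|field]. }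
unfold F in E; rewrite W0, V0 in E.
assert (W1 : W 1%R = w) by (unfold W; rewrite Cmult_1_r; now apply Cexp_Clog).
rewrite EV, W1 in E.
replace (l * l / 2) with (l * l * RtoC (1 * 1 / 2)%R).
2: { rewrite RtoC_div by lra; rewrite Rmult_1_l; field. }
rewrite E.
replace (RtoC (0 * 0 / 2)%R) with (RtoC 0) by (f_equal; field).
replace (RtoC (-1)) with (- RtoC 1) by (rewrite <- RtoC_opp; f_equal; ring); ring.
Qed.

Lemma Li2_span_Clog_sqr (G : C -> Prop) (w : C) :
  conj_closed G -> off_neg w -> Qadjoin G w -> Li2_span G (Clog w * Clog w).
Proof.
intros HG Hw HK; assert (H0 := off_neg_neq0 w Hw).
assert (E := Li2_inversion w Hw).
replace (Clog w * Clog w) with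
  (INR 2 * (INR 2 * Li2 (-1) - (Li2 (- w) + Li2 (- / w)))).
- apply Li2_span_nat, Li2_span_minus; [apply Li2_span_nat|apply Li2_span_plus]; apply Li2_span_Li2.
  + replace (RtoC (-1)) with (- RtoC 1) by (rewrite <- RtoC_opp; f_equal; ring).
    apply Qadjoin_opp, Qadjoin_1.
  + now apply Qadjoin_opp.
  + now apply Qadjoin_opp, Qadjoin_Cinv.
- replace (RtoC (INR 2)) with (RtoC 2) by (f_equal; simpl; ring).
  rewrite <- E; field.
Qed.

(** Polarization 2ab = a^2 + b^2 - (a-b)^2. In the right half-plane Log a - Log b is the principal
    Log(a/b), whose square is in the span. *)
Lemma Li2_span_Clog_mult (G : C -> Prop) (a b : C) :
  conj_closed G -> 0 < Re a -> 0 < Re b -> Qadjoin G a -> Qadjoin G b -> Li2_span G (Clog a * Clog b).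
Proof.
intros HG Ha Hb Ka Kb; destruct (Clog_div_right a b Ha Hb) as [Hn E].
assert (Nb := off_neg_neq0 _ (off_neg_right _ Hb)).
replace (Clog a * Clog b) with
  ((Clog a * Clog a + Clog b * Clog b - Clog (a / b) * Clog (a / b)) / 2)
  by (rewrite E; field).
apply Li2_span_half, Li2_span_minus; [apply Li2_span_plus|]; apply Li2_span_Clog_sqr; try easy.
- now apply off_neg_right.
- now apply off_neg_right.
- now apply Qadjoin_div.
Qed.

(** * Dilogarithmic primitives on [0, 1) *)

Definition limC (F : (R -> Prop) -> Prop) (f : R -> C) (l : C) : Prop :=
  filterlim f F (@locally C_UniformSpace l).

Lemma limC_plus (F : (R -> Prop) -> Prop) (f g : R -> C) (a b : C) :
  Filter F -> limC F f a -> limC F g b -> limC F (fun u => f u + g u) (a + b).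
Proof.
intros FF Hf Hg.
eapply filterlim_comp_2; [exact Hf|exact Hg|].
exact (@filterlim_plus R_AbsRing C_R_NormedModule a b).
Qed.

Lemma limC_scal (F : (R -> Prop) -> Prop) (k : R) (f : R -> C) (a : C) :
  Filter F -> limC F f a -> limC F (fun u => k * f u) (k * a).
Proof.
intros FF Hf.
assert (H := filterlim_comp _ _ _ _ _ _ _ _ Hf (@filterlim_scal_r R_AbsRing C_R_NormedModule k a)).
rewrite scal_RC in H; revert H; apply filterlim_ext; intros u; apply scal_RC.
Qed.

Lemma limC_opp (F : (R -> Prop) -> Prop) (f : R -> C) (a : C) :
  Filter F -> limC F f a -> limC F (fun u => - f u) (- a).
Proof.
intros FF Hf.
exact (filterlim_comp _ _ _ _ _ _ _ _ Hf (@filterlim_opp R_AbsRing C_R_NormedModule a)).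
Qed.

Lemma limC_const (F : (R -> Prop) -> Prop) (a : C) : Filter F -> limC F (fun _ => a) a.
Proof. intros FF; apply filterlim_const. Qed.

Lemma limC_pair (F : (R -> Prop) -> Prop) (f : R -> C) (l : C) :
  Filter F ->
  filterlim (fun u => Re (f u)) F (locally (Re l)) ->
  filterlim (fun u => Im (f u)) F (locally (Im l)) -> limC F f l.
Proof.
intros FF H1 H2; apply (proj2 (@filterlim_locally _ C_UniformSpace F FF _ _)); intros eps.
assert (G1 := proj1 (filterlim_locally _ _) H1 eps).
assert (G2 := proj1 (filterlim_locally _ _) H2 eps).
generalize (filter_and _ _ G1 G2); apply filter_imp; intros u [B1 B2]; split; assumption.
Qed.

Lemma limC_Re (F : (R -> Prop) -> Prop) (f : R -> C) (l : C) :
  Filter F -> limC F f l -> filterlim (fun u => Re (f u)) F (locally (Re l)).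
Proof.
intros FF H; apply (proj2 (filterlim_locally _ _)); intros eps.
generalize (proj1 (@filterlim_locally _ C_UniformSpace F FF _ _) H eps).
apply filter_imp; intros u B; apply B.
Qed.

Lemma limC_Im (F : (R -> Prop) -> Prop) (f : R -> C) (l : C) :
  Filter F -> limC F f l -> filterlim (fun u => Im (f u)) F (locally (Im l)).
Proof.
intros FF H; apply (proj2 (filterlim_locally _ _)); intros eps.
generalize (proj1 (@filterlim_locally _ C_UniformSpace F FF _ _) H eps).
apply filter_imp; intros u B; apply B.
Qed.

Lemma limC_unique (F : (R -> Prop) -> Prop) (f : R -> C) (a b : C) :
  ProperFilter F -> limC F f a -> limC F f b -> a = b.
Proof.
intros FF Ha Hb; apply injective_projections.
- exact (filterlim_locally_unique _ _ _ (limC_Re F f a _ Ha) (limC_Re F f b _ Hb)).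
- exact (filterlim_locally_unique _ _ _ (limC_Im F f a _ Ha) (limC_Im F f b _ Hb)).
Qed.

Lemma at_left_1_mem : at_left 1 (fun u => 0 < u < 1).
Proof.
exists (mkposreal _ Rlt_0_1); intros u Hu Hl.
change (Rabs (u - 1) < 1) in Hu; apply Rabs_def2 in Hu; lra.
Qed.

Lemma limC_within (D : R -> Prop) (f : R -> C) (x : R) (l : C) :
  limC (locally x) f l -> limC (within D (locally x)) f l.
Proof. intros H; apply (filterlim_filter_le_1 (F := locally x)); [apply filter_le_within|exact H]. Qed.

(** With r = sqrt e the left-hand side is 2r (r (-ln r)), and -ln r <= 1/r. *)
Lemma mul_ln_small (e : R) : 0 < e < 1 -> e * Rabs (ln e) <= 2 * sqrt e.
Proof.
intros He; assert (Hs := sqrt_lt_R0 e ltac:(lra)); assert (Es := sqrt_sqrt e ltac:(lra)).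
assert (Hl : ln e < 0) by (rewrite <- ln_1; apply ln_increasing; lra).
rewrite Rabs_left by easy.
assert (E : (ln e = 2 * ln (sqrt e))%R) by (rewrite <- Es at 1; rewrite ln_mult by easy; ring).
assert (B := ln_ge_1_sub_inv (sqrt e) Hs).
set (r := sqrt e) in *; rewrite E, <- Es.
assert (Ei : (r * / r = 1)%R) by (field; lra).
assert (K : - ln r <= / r) by lra.
replace (r * r * - (2 * ln r))%R with (2 * r * (r * - ln r))%R by ring.
assert (r * - ln r <= 1) by (rewrite <- Ei; apply Rmult_le_compat_l; lra).
nra.
Qed.

(** Near 1 the increment of h is at most (|d|+1)(1-u), and (1-u)|ln(1-u)| <= 2 sqrt(1-u).
    Logarithmic singularities multiplied by a vanishing factor are removed in this way below. *)
Lemma ln_mul_increment_lim (h : R -> R) (d : R) :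
  is_derive h 1 d ->
  filterlim (fun u => ln (1 - u) * (h u - h 1))%R (at_left 1) (locally 0%R).
Proof.
intros H; apply is_derive_Reals in H.
apply (proj2 (filterlim_locally _ _)); intros eps.
destruct (H 1%R Rlt_0_1) as [d0 Hd0].
set (K := (Rabs d + 1)%R).
assert (HK : 0 < K) by (unfold K; assert (T := Rabs_pos d); lra).
set (e1 := (eps / (2 * K))%R).
assert (He1 : 0 < e1) by (apply Rdiv_lt_0_compat; [apply cond_pos|lra]).
assert (Hm : 0 < Rmin d0 (Rmin 1 (e1 * e1))).
{ repeat apply Rmin_glb_lt; [apply cond_pos|lra|nra]. }
exists (mkposreal _ Hm); intros u Hu Hl; change R in u.
change (Rabs (u - 1) < Rmin d0 (Rmin 1 (e1 * e1))) in Hu.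
rewrite Rabs_left in Hu by lra.
assert (B1 := Rmin_l d0 (Rmin 1 (e1 * e1))); assert (B2 := Rmin_r d0 (Rmin 1 (e1 * e1))).
assert (B3 := Rmin_l 1 (e1 * e1)); assert (B4 := Rmin_r 1 (e1 * e1)).
change (Rabs (ln (1 - u) * (h u - h 1%R) - 0) < eps).
rewrite Rminus_0_r, Rabs_mult.
set (e := (1 - u)%R); assert (He : 0 < e < 1) by (unfold e; lra).
assert (Hh : Rabs (h u - h 1%R) <= K * e).
{ specialize (Hd0 (u - 1)%R ltac:(lra) ltac:(rewrite Rabs_left; lra)).
  replace (1 + (u - 1))%R with u in Hd0 by ring.
  replace (h u - h 1%R)%R with (((h u - h 1%R) / (u - 1) - d + d) * (u - 1))%R by (field; lra).
  rewrite Rabs_mult, (Rabs_left (u - 1)) by lra.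
  replace (- (u - 1))%R with e by (unfold e; ring).
  apply Rmult_le_compat_r; [lra|].
  eapply Rle_trans; [apply Rabs_triang|unfold K; lra]. }
assert (M := mul_ln_small e He).
assert (Hsq : sqrt e < e1).
{ rewrite <- (sqrt_square e1) by lra; apply sqrt_lt_1; unfold e in *; nra. }
apply Rle_lt_trans with (K * (2 * sqrt e))%R.
- apply Rle_trans with (Rabs (ln e) * (K * e))%R.
  + apply Rmult_le_compat_l; [apply Rabs_pos|exact Hh].
  + replace (Rabs (ln e) * (K * e))%R with (K * (e * Rabs (ln e)))%R by ring.
    apply Rmult_le_compat_l; lra.
- replace (pos eps) with (K * (2 * e1))%R by (unfold e1; field; lra).
  apply Rmult_lt_compat_l; lra.
Qed.

Lemma ln_mul_increment_limC (h : R -> C) (d : C) :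
  is_deriveC h 1 d ->
  limC (at_left 1) (fun u => RtoC (ln (1 - u)) * (h u - h 1%R)) 0.
Proof.
intros [D1 D2]; apply limC_pair; [apply within_filter, locally_filter| |].
- generalize (ln_mul_increment_lim _ _ D1); apply filterlim_ext; intros u.
  unfold Cminus; rewrite re_scal_l, re_plus, re_opp; reflexivity.
- generalize (ln_mul_increment_lim _ _ D2); apply filterlim_ext; intros u.
  unfold Cminus; rewrite im_scal_l, im_plus, im_opp; reflexivity.
Qed.

(* [corr] is the divergent part at [1] of the primitive vanishing at [0]. *)
Definition dilog_primitive (G : C -> Prop) (f corr : R -> C) : Prop :=
  exists (T : R -> C) (k : C),
    Li2_span G k /\
    (forall u, 0 < u < 1 -> is_deriveC T u (f u)) /\
    limC (at_right 0) T 0 /\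
    limC (at_left 1) (fun u => T u + corr u) k.

Lemma dilog_primitive_intro (G : C -> Prop) (f corr T : R -> C) (k : C) :
  Li2_span G k -> T 0%R = 0 ->
  (forall u, 0 <= u < 1 -> is_deriveC T u (f u)) ->
  limC (at_left 1) (fun u => T u + corr u) k -> dilog_primitive G f corr.
Proof.
intros Hk H0 HD HL; exists T, k; split; [exact Hk|split; [|split; [|exact HL]]].
- intros u Hu; apply HD; lra.
- rewrite <- H0; apply limC_within.
  exact (is_deriveC_continuous _ _ _ (HD 0%R ltac:(lra))).
Qed.

Lemma dilog_primitive_ext (G : C -> Prop) (f g corr corr' : R -> C) :
  (forall u, 0 < u < 1 -> f u = g u) -> (forall u, 0 < u < 1 -> corr u = corr' u) ->
  dilog_primitive G f corr -> dilog_primitive G g corr'.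
Proof.
intros Ef Ec [T [k [Hk [HD [H0 H1]]]]]; exists T, k; split; [exact Hk|split; [|split; [exact H0|]]].
- intros u Hu; apply is_deriveC_eq with (f u); [now apply Ef|now apply HD].
- revert H1; apply filterlim_ext_loc.
  generalize at_left_1_mem; apply filter_imp; intros u Hu; now rewrite Ec.
Qed.

Lemma dilog_primitive_0 (G : C -> Prop) : dilog_primitive G (fun _ => 0) (fun _ => 0).
Proof.
apply (dilog_primitive_intro G _ _ (fun _ => 0) 0).
- apply Li2_span_0.
- reflexivity.
- intros; apply is_deriveC_const.
- assert (L := limC_const (at_left 1) 0 _).
  revert L; apply filterlim_ext; intros u; eqC; ring.
Qed.

Lemma dilog_primitive_plus (G : C -> Prop) (f g c d : R -> C) :
  dilog_primitive G f c -> dilog_primitive G g d ->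
  dilog_primitive G (fun u => f u + g u) (fun u => c u + d u).
Proof.
intros [T [k [Hk [HD [H0 H1]]]]] [T' [k' [Hk' [HD' [H0' H1']]]]].
exists (fun u => T u + T' u), (k + k'); split; [|split; [|split]].
- now apply Li2_span_plus.
- intros u Hu; apply is_deriveC_plus; [now apply HD|now apply HD'].
- replace (RtoC 0) with (0 + 0) by ring; apply limC_plus; try easy.
  apply within_filter, locally_filter.
- assert (L := limC_plus (at_left 1) _ _ _ _ _ H1 H1').
  revert L; apply filterlim_ext; intros u; eqC; ring.
Qed.

Fixpoint Csum (f : nat -> C) (n : nat) : C :=
  match n with O => 0 | S m => Csum f m + f m end.

Lemma dilog_primitive_sum (G : C -> Prop) (f c : nat -> R -> C) (n : nat) :
  (forall j, (j < n)%nat -> dilog_primitive G (f j) (c j)) ->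
  dilog_primitive G (fun u => Csum (fun j => f j u) n) (fun u => Csum (fun j => c j u) n).
Proof.
induction n as [|n IH]; intros H; simpl; [apply dilog_primitive_0|].
apply (dilog_primitive_plus G (fun u => Csum (fun j => f j u) n) (f n)
  (fun u => Csum (fun j => c j u) n) (c n)); [apply IH; intros; apply H; lia|apply H; lia].
Qed.

Lemma Re_le_Cmod (z : C) : Re z <= Cmod z.
Proof. eapply Rle_trans; [apply Rle_abs|apply re_le_Cmod]. Qed.

Lemma Re_one_sub (z : C) (u : R) : Re (1 - z * u) = (1 - Re z * u)%R.
Proof. destruct z; simpl; ring. Qed.

Lemma right_of_unit (z : C) (u : R) : Cmod z = 1%R -> 0 <= u < 1 -> 0 < Re (1 - z * u).
Proof.
intros Hz Hu; rewrite Re_one_sub; assert (H := Re_le_Cmod z); rewrite Hz in H; nra.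
Qed.

Lemma unit_Re_lt_1 (z : C) : Cmod z = 1%R -> z <> 1 -> Re z < 1.
Proof.
intros Hz Hn; assert (H := Re_le_Cmod z); rewrite Hz in H.
destruct (Req_dec (Re z) 1) as [E|E]; [exfalso|lra].
apply Hn; destruct z as [x y]; simpl in E; subst x.
unfold Cmod in Hz; simpl fst in Hz; simpl snd in Hz.
assert (Hs := sqrt_sqrt (1 ^ 2 + y ^ 2) ltac:(nra)); rewrite Hz in Hs.
assert (y = 0)%R by nra; subst y; reflexivity.
Qed.

Lemma right_of_unit_neq1 (z : C) (u : R) :
  Cmod z = 1%R -> z <> 1 -> 0 <= u <= 1 -> 0 < Re (1 - z * u).
Proof.
intros Hz Hn Hu; rewrite Re_one_sub; assert (H := unit_Re_lt_1 z Hz Hn).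
destruct (Rlt_dec u 1); [nra|replace u with 1%R by lra; lra].
Qed.

Lemma Cmod_div_unit (z w : C) : Cmod z = 1%R -> Cmod w = 1%R -> w <> 0 -> Cmod (z / w) = 1%R.
Proof. intros Hz Hw H0; rewrite Cmod_div by easy; rewrite Hz, Hw; field. Qed.

Lemma unit_neq0 (z : C) : Cmod z = 1%R -> z <> 0.
Proof. intros H E; rewrite E, Cmod_0 in H; lra. Qed.

(** Chosen so that the argument is a constant times 1 - wu while 1 minus it is (1-zu)/(1-z/w). *)
Definition dilog_arg (z w : C) (u : R) : C := z * (1 - w * u) / (z - w).

Definition dilog_prim (z w : C) (u : R) : C :=
  Li2 (dilog_arg z w u) - Li2 (dilog_arg z w 0) - Clog (1 - z / w) * Clog (1 - w * u).

Lemma Cminus_neq0 (z w : C) : z <> w -> z - w <> 0.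
Proof.
intros H E; apply H; replace z with (z - w + w) by ring; rewrite E; ring.
Qed.

Lemma one_sub_ratio_right (z w : C) :
  Cmod z = 1%R -> Cmod w = 1%R -> z <> w -> 0 < Re (1 - z / w).
Proof.
intros Hz Hw Hn; assert (H0 := unit_neq0 w Hw).
replace (1 - z / w) with (1 - z / w * 1%R) by ring.
apply right_of_unit_neq1; [now apply Cmod_div_unit| |lra].
intros E; apply Hn; replace z with (z / w * w) by (field; easy); rewrite E; ring.
Qed.

(* Both 1 - z u and 1 - z/w lie in the right half-plane, so that the principal
   logarithm of their quotient is the difference of the logarithms. *)
Lemma dilog_arg_log (z w : C) (u : R) :
  Cmod z = 1%R -> Cmod w = 1%R -> z <> w -> 0 < Re (1 - z * u) ->
  ~ on_cut (dilog_arg z w u) /\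
  Clog (1 - dilog_arg z w u) = Clog (1 - z * u) - Clog (1 - z / w).
Proof.
intros Hz Hw Hn Hr; assert (H0 := unit_neq0 w Hw); assert (Hd := Cminus_neq0 z w Hn).
assert (Hd' : w - z <> 0) by (apply Cminus_neq0; congruence).
assert (E : 1 - dilog_arg z w u = (1 - z * u) / (1 - z / w)).
{ unfold dilog_arg; field; repeat split; assumption. }
destruct (Clog_div_right (1 - z * u) (1 - z / w)) as [O L]; try easy.
- now apply one_sub_ratio_right.
- rewrite <- E in O, L; split; [now apply on_cut_off_neg|exact L].
Qed.

Lemma is_deriveC_dilog_arg (z w : C) (u : R) :
  z <> w -> is_deriveC (dilog_arg z w) u (- (z * w / (z - w))).
Proof.
intros Hn; assert (Hd := Cminus_neq0 z w Hn).
apply is_deriveC_ext with (fun s => z / (z - w) * (1 - w * s)).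
{ intros s; unfold dilog_arg; field; easy. }
apply is_deriveC_eq with (z / (z - w) * - w); [field; easy|].
apply is_deriveC_scal, is_deriveC_linear.
Qed.

Lemma is_deriveC_Clog_linear (w : C) (u : R) :
  0 < Re (1 - w * u) -> is_deriveC (fun s => Clog (1 - w * s)) u (- w / (1 - w * u)).
Proof.
intros H; apply (is_deriveC_Clog (fun s => 1 - w * s)); [now apply off_neg_right|].
apply is_deriveC_linear.
Qed.

(** The argument has logarithmic derivative -w/(1-wu), and the constant Log(1-z/w) inside Log(1 -
    [dilog_arg z w u]) is compensated by the product of logarithms. Conditions on real parts admit u
    = 1 when z and w differ from 1. *)
Lemma dilog_prim_derive (z w : C) (u : R) :
  Cmod z = 1%R -> Cmod w = 1%R -> z <> w ->
  0 < Re (1 - z * u) -> 0 < Re (1 - w * u) ->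
  is_deriveC (dilog_prim z w) u (Clog (1 - z * u) * (w / (1 - w * u))).
Proof.
intros Hz Hw Hn Rz Rw.
assert (Hd := Cminus_neq0 z w Hn); assert (Nz := unit_neq0 z Hz).
assert (Nw := off_neg_neq0 _ (off_neg_right _ Rw)).
destruct (dilog_arg_log z w u Hz Hw Hn Rz) as [Hc L].
assert (Na : dilog_arg z w u <> 0).
{ unfold dilog_arg; apply Cmult_neq_0; [now apply Cmult_neq_0|].
  intros E; assert (H : (z - w) * / (z - w) = 1) by (field; easy).
  rewrite E, Cmult_0_r in H; apply RtoC_inj in H; lra. }
apply is_deriveC_eq with
  (- Clog (1 - dilog_arg z w u) / dilog_arg z w u * - (z * w / (z - w)) - 0
   - Clog (1 - z / w) * (- w / (1 - w * u))).
- rewrite L; unfold dilog_arg; generalize (Clog (1 - z * u)) (Clog (1 - z / w)); intros a b.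
  field; repeat split; assumption.
- apply is_deriveC_minus; [apply is_deriveC_minus|].
  + apply is_deriveC_Li2; [exact Hc|exact Na|now apply is_deriveC_dilog_arg].
  + apply is_deriveC_const.
  + apply is_deriveC_scal, is_deriveC_Clog_linear, Rw.
Qed.

Lemma dilog_prim_0 (z w : C) : dilog_prim z w 0 = 0.
Proof.
unfold dilog_prim; rewrite Cmult_0_r; replace (1 - 0) with (RtoC 1) by ring.
rewrite Clog_1; ring.
Qed.

Lemma Qadjoin_dilog_arg (G : C -> Prop) (z w : C) (n : nat) :
  conj_closed G -> Qadjoin G z -> Qadjoin G w -> z <> w ->
  Qadjoin G (dilog_arg z w (INR n)).
Proof.
intros HG Kz Kw Hn; unfold dilog_arg.
apply Qadjoin_div; [exact HG|now apply Cminus_neq0| |now apply Qadjoin_minus].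
apply Qadjoin_mul; [exact Kz|apply Qadjoin_minus; [apply Qadjoin_1|]].
apply Qadjoin_mul; [exact Kw|apply Qadjoin_nat].
Qed.

Lemma Qadjoin_one_sub (G : C -> Prop) (z : C) : Qadjoin G z -> Qadjoin G (1 - z).
Proof. intros H; apply Qadjoin_minus; [apply Qadjoin_1|exact H]. Qed.

(** The primitive is differentiable at u = 1 itself, so its limit is its value there: two
    dilogarithms with arguments in the field and a product of logarithms. *)
Lemma dilog_primitive_generic (G : C -> Prop) (z w : C) :
  conj_closed G -> Qadjoin G z -> Qadjoin G w ->
  Cmod z = 1%R -> Cmod w = 1%R -> z <> w -> z <> 1 -> w <> 1 ->
  dilog_primitive G (fun u => Clog (1 - z * u) * (w / (1 - w * u))) (fun _ => 0).
Proof.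
intros HG Kz Kw Hz Hw Hn Nz Nw.
assert (R1 : 0 < Re (1 - w * 1%R)) by (apply right_of_unit_neq1; try easy; lra).
apply (dilog_primitive_intro G _ _ (dilog_prim z w) (dilog_prim z w 1%R + 0)).
- rewrite Cplus_0_r; unfold dilog_prim; apply Li2_span_minus; [apply Li2_span_minus|].
  + apply Li2_span_Li2, (Qadjoin_dilog_arg G z w 1); easy.
  + apply Li2_span_Li2, (Qadjoin_dilog_arg G z w 0); easy.
  + apply Li2_span_Clog_mult; try easy.
    * now apply one_sub_ratio_right.
    * apply Qadjoin_one_sub, Qadjoin_div; try easy; now apply unit_neq0.
    * rewrite Cmult_1_r; now apply Qadjoin_one_sub.
- apply dilog_prim_0.
- intros u Hu; apply dilog_prim_derive; try easy; now apply right_of_unit.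
- apply limC_plus; [apply within_filter, locally_filter| |apply limC_const, within_filter, locally_filter].
  apply limC_within; eapply is_deriveC_continuous, dilog_prim_derive; try easy.
  apply right_of_unit_neq1; try easy; lra.
Qed.

(** For z = w the argument [dilog_arg] degenerates, and -Log(1-zu)^2/2 is a primitive. *)
Lemma dilog_primitive_diag (G : C -> Prop) (z : C) :
  conj_closed G -> Qadjoin G z -> Cmod z = 1%R -> z <> 1 ->
  dilog_primitive G (fun u => Clog (1 - z * u) * (z / (1 - z * u))) (fun _ => 0).
Proof.
intros HG Kz Hz Nz.
set (T := fun u : R => RtoC (- (1 / 2))%R * (Clog (1 - z * u) * Clog (1 - z * u))).
assert (D : forall u : R, 0 < Re (1 - z * u) ->
  is_deriveC T u (Clog (1 - z * u) * (z / (1 - z * u)))).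
{ intros u Hu; assert (N0 := off_neg_neq0 _ (off_neg_right _ Hu)).
  assert (L := is_deriveC_Clog_linear z u Hu).
  assert (M := is_deriveC_scal (RtoC (- (1 / 2))%R) _ _ _ (is_deriveC_mult _ _ _ _ _ L L)).
  revert M; apply is_deriveC_eq.
  rewrite RtoC_opp, RtoC_div by lra; field; exact N0. }
apply (dilog_primitive_intro G _ _ T (T 1%R + 0)).
- rewrite Cplus_0_r; unfold T.
  replace (RtoC (- (1 / 2))%R * (Clog (1 - z * 1%R) * Clog (1 - z * 1%R))) with
    (- (Clog (1 - z * 1%R) * Clog (1 - z * 1%R) / 2))
    by (rewrite RtoC_opp, RtoC_div by lra; field).
  apply Li2_span_opp, Li2_span_half.
  assert (R1 : 0 < Re (1 - z * 1%R)) by (apply right_of_unit_neq1; try easy; lra).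
  apply Li2_span_Clog_mult; try easy; rewrite Cmult_1_r; now apply Qadjoin_one_sub.
- unfold T; rewrite Cmult_0_r; replace (1 - 0) with (RtoC 1) by ring.
  rewrite Clog_1; ring.
- intros u Hu; apply D; now apply right_of_unit.
- apply limC_plus; [apply within_filter, locally_filter| |apply limC_const, within_filter, locally_filter].
  apply limC_within; eapply is_deriveC_continuous, D.
  apply right_of_unit_neq1; try easy; lra.
Qed.

Lemma Clog_one_sub (u : R) : u < 1 -> Clog (1 - 1 * u) = RtoC (ln (1 - u)).
Proof.
intros Hu; rewrite <- Clog_pos by lra; f_equal.
rewrite RtoC_minus; ring.
Qed.

Lemma dilog_primitive_11 (G : C -> Prop) :
  dilog_primitive G (fun u => Clog (1 - 1 * u) * (1 / (1 - 1 * u)))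
    (fun u => RtoC (ln (1 - u) ^ 2 / 2)%R).
Proof.
set (T := fun u : R => RtoC (- (1 / 2))%R * (Clog (1 - 1 * u) * Clog (1 - 1 * u))).
apply (dilog_primitive_intro G _ _ T 0).
- apply Li2_span_0.
- unfold T; rewrite Cmult_0_r; replace (1 - 0) with (RtoC 1) by ring.
  rewrite Clog_1; ring.
- intros u Hu; assert (Hr := right_of_unit 1 u Cmod_1 Hu).
  assert (N0 := off_neg_neq0 _ (off_neg_right _ Hr)).
  assert (L := is_deriveC_Clog_linear 1 u Hr).
  assert (M := is_deriveC_scal (RtoC (- (1 / 2))%R) _ _ _ (is_deriveC_mult _ _ _ _ _ L L)).
  revert M; apply is_deriveC_eq.
  rewrite RtoC_opp, RtoC_div by lra; rewrite Cmult_1_l in N0; field; exact N0.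
- assert (L := limC_const (at_left 1) 0 _).
  revert L; apply filterlim_ext_loc.
  generalize at_left_1_mem; apply filter_imp; intros u Hu.
  unfold T; rewrite Clog_one_sub by lra; rewrite <- !RtoC_mult, <- RtoC_plus; f_equal; field.
Qed.

Lemma dilog_arg_z1_lim (z : C) :
  Cmod z = 1%R -> z <> 1 ->
  limC (at_left 1) (fun u => Li2 (dilog_arg z 1 u)) 0.
Proof.
intros Hz Nz; apply limC_within.
assert (E : dilog_arg z 1 1%R = 0).
{ unfold dilog_arg, Cdiv; replace (1 - 1 * 1%R) with (RtoC 0) by ring; ring. }
assert (H : ~ on_cut (dilog_arg z 1 1%R)).
{ rewrite E; intros [_ H]; simpl in H; lra. }
assert (L := Li2_path_continuous (dilog_arg z 1) 1 _ H (is_deriveC_dilog_arg z 1 1 Nz)).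
rewrite E, Li2_0 in L; exact L.
Qed.

(** As u goes to 1 the argument of the dilogarithm tends to 0. The product of logarithms is thus the
    whole divergence, and the initial value -Li2(z/(z-1)) remains as the constant. *)
Lemma dilog_primitive_z1 (G : C -> Prop) (z : C) :
  conj_closed G -> Qadjoin G z -> Cmod z = 1%R -> z <> 1 ->
  dilog_primitive G (fun u => Clog (1 - z * u) * (1 / (1 - 1 * u)))
    (fun u => Clog (1 - z) * RtoC (ln (1 - u))).
Proof.
intros HG Kz Hz Nz.
apply (dilog_primitive_intro G _ _ (dilog_prim z 1) (0 + - Li2 (dilog_arg z 1 0%R))).
- rewrite Cplus_0_l; apply Li2_span_opp, Li2_span_Li2, (Qadjoin_dilog_arg G z 1 0); try easy.
  apply Qadjoin_1.
- apply dilog_prim_0.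
- intros u Hu; apply dilog_prim_derive; try easy; try apply Cmod_1; apply right_of_unit; try easy.
  apply Cmod_1.
- assert (L := limC_plus (at_left 1) _ _ _ _ _
    (dilog_arg_z1_lim z Hz Nz)
    (limC_const (at_left 1) (- Li2 (dilog_arg z 1 0%R)) _)).
  revert L; apply filterlim_ext_loc.
  generalize at_left_1_mem; apply filter_imp; intros u Hu.
  unfold dilog_prim; rewrite Clog_one_sub by lra.
  replace (z / 1) with z by field; eqC; ring.
Qed.

(* Integration by parts exchanges the roles of the two roots of unity, and so
   avoids the value of Li2 on its cut. *)
Lemma dilog_primitive_1w (G : C -> Prop) (w : C) :
  conj_closed G -> Qadjoin G w -> Cmod w = 1%R -> w <> 1 ->
  dilog_primitive G (fun u => Clog (1 - 1 * u) * (w / (1 - w * u))) (fun _ => 0).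
Proof.
intros HG Kw Hw Nw.
set (T := fun u : R => - (Clog (1 - 1 * u) * Clog (1 - w * u)) - dilog_prim w 1 u).
apply (dilog_primitive_intro G _ _ T (- 0 + (- 0 + Li2 (dilog_arg w 1 0%R)))).
- replace (- 0 + (- 0 + Li2 (dilog_arg w 1 0%R))) with (Li2 (dilog_arg w 1 0%R)) by ring.
  apply Li2_span_Li2, (Qadjoin_dilog_arg G w 1 0); try easy; apply Qadjoin_1.
- unfold T; rewrite dilog_prim_0, !Cmult_0_r; replace (1 - 0) with (RtoC 1) by ring.
  rewrite Clog_1; ring.
- intros u Hu.
  assert (R1 := right_of_unit 1 u Cmod_1 Hu); assert (Rw := right_of_unit w u Hw Hu).
  assert (N1 := off_neg_neq0 _ (off_neg_right _ R1)).
  assert (N2 := off_neg_neq0 _ (off_neg_right _ Rw)).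
  assert (L1 := is_deriveC_Clog_linear 1 u R1); assert (L2 := is_deriveC_Clog_linear w u Rw).
  assert (L3 := dilog_prim_derive w 1 u Hw Cmod_1 Nw Rw R1).
  assert (M := is_deriveC_minus _ _ _ _ _
    (is_deriveC_opp _ _ _ (is_deriveC_mult _ _ _ _ _ L1 L2)) L3).
  rewrite Cmult_1_l in N1; revert M; apply is_deriveC_eq; field; split; assumption.
- assert (R1 : 0 < Re (1 - w * 1%R)) by (apply right_of_unit_neq1; try easy; lra).
  (* The divergent parts combine into -ln(1-u) (Log(1-wu) - Log(1-w)), which tends to 0. *)
  assert (I := ln_mul_increment_limC (fun u => Clog (1 - w * u)) _ (is_deriveC_Clog_linear w 1 R1)).
  assert (FF : Filter (at_left 1)) by apply within_filter, locally_filter.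
  assert (L := limC_plus (at_left 1) _ _ _ _ FF (limC_opp _ _ _ FF I)
    (limC_plus (at_left 1) _ _ _ _ FF (limC_opp _ _ _ FF (dilog_arg_z1_lim w Hw Nw))
      (limC_const (at_left 1) (Li2 (dilog_arg w 1 0%R)) FF))).
  revert L; apply filterlim_ext_loc.
  generalize at_left_1_mem; apply filter_imp; intros u Hu.
  unfold T, dilog_prim; rewrite !Clog_one_sub by lra.
  replace (w / 1) with w by field; rewrite (Cmult_1_r w); eqC; ring.
Qed.

(** * The dilogarithm at 1 and the term Li2(u^p) *)

Lemma RtoC_off_cut (u : R) : u < 1 -> ~ on_cut u.
Proof. intros Hu [_ H]; simpl in H; lra. Qed.

(** The left-hand side has derivative 0 on (0, 1), and the constant is its value at u = 1/2. *)
Lemma Li2_reflection (u : R) :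
  0 < u < 1 ->
  Li2 u + Li2 (1 - u)%R + RtoC (ln u * ln (1 - u))%R = 2 * Li2 (1 / 2)%R + RtoC (ln (1 / 2) ^ 2)%R.
Proof.
intros Hu.
set (f := fun u : R => Li2 u + Li2 (1 - u)%R + RtoC (ln u * ln (1 - u))%R).
assert (D : forall t, 0 < t < 1 -> is_deriveC f t 0).
{ intros t Ht.
  assert (N1 : RtoC t <> 0) by (intros E; apply RtoC_inj in E; lra).
  assert (N2 : RtoC (1 - t)%R <> 0) by (intros E; apply RtoC_inj in E; lra).
  assert (D1 := is_deriveC_Li2 (fun s => RtoC s) t 1 (RtoC_off_cut t ltac:(lra)) N1 (is_deriveC_id t)).
  assert (D2 := is_deriveC_Li2 (fun s => RtoC (1 - s)%R) t (RtoC (-1)%R)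
    (RtoC_off_cut (1 - t)%R ltac:(lra)) N2
    (is_deriveC_RtoC (fun s => 1 - s)%R t (-1)%R ltac:(auto_derive; [easy|ring]))).
  assert (D3 := is_deriveC_RtoC (fun s => ln s * ln (1 - s))%R t
    (ln (1 - t) / t - ln t / (1 - t))%R ltac:(auto_derive; [lra|unfold Rminus; field; lra])).
  assert (M := is_deriveC_plus _ _ _ _ _ (is_deriveC_plus _ _ _ _ _ D1 D2) D3).
  revert M; apply is_deriveC_eq.
  replace (1 - RtoC t) with (RtoC (1 - t)%R) by (rewrite RtoC_minus; ring).
  replace (1 - RtoC (1 - t)%R) with (RtoC t) by (rewrite RtoC_minus; ring).
  rewrite !Clog_pos by lra.
  rewrite (RtoC_minus (ln (1 - t) / t)), (RtoC_div (ln (1 - t))), (RtoC_div (ln t)) by lra.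
  replace (RtoC (-1)) with (- RtoC 1) by (rewrite <- RtoC_opp; f_equal; ring).
  field; split; assumption. }
assert (E : f u = f (1 / 2)%R).
{ destruct (Rle_dec u (1 / 2)) as [H|H].
  - symmetry; apply is_deriveC_constant; [easy|intros t Ht; apply D; lra].
  - apply is_deriveC_constant; [lra|intros t Ht; apply D; lra]. }
unfold f in E; rewrite E.
replace (1 - 1 / 2)%R with (1 / 2)%R by field.
replace (ln (1 / 2) * ln (1 / 2))%R with (ln (1 / 2) ^ 2)%R by ring; ring.
Qed.

(** Reflection trades Li2(u) for Li2(1-u), which is continuous at u = 1, and ln u ln(1-u) tends to
    0. The limit at the end of the cut is thus expressed by values off the cut. *)
Lemma Li2_lim_1 :
  limC (at_left 1) (fun u => Li2 u) (2 * Li2 (1 / 2)%R + RtoC (ln (1 / 2) ^ 2)%R).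
Proof.
assert (FF : Filter (at_left 1)) by apply within_filter, locally_filter.
set (L := 2 * Li2 (1 / 2)%R + RtoC (ln (1 / 2) ^ 2)%R).
replace L with (L + (- Li2 (1 - 1)%R + - 0)).
2: { rewrite Rminus_eq_0, Li2_0; ring. }
assert (I1 : limC (at_left 1) (fun u : R => RtoC (ln (1 - u)) * (RtoC (ln u) - RtoC (ln 1))) 0).
{ apply (ln_mul_increment_limC (fun u => RtoC (ln u)) (RtoC (/ 1)%R)).
  apply is_deriveC_RtoC, is_derive_ln; lra. }
assert (I2 : limC (at_left 1) (fun u : R => Li2 (1 - u)%R) (Li2 (1 - 1)%R)).
{ apply limC_within, (Li2_path_continuous (fun u => RtoC (1 - u)%R) 1 (RtoC (-1)%R)).
  - apply RtoC_off_cut; lra.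
  - apply is_deriveC_RtoC; auto_derive; [easy|ring]. }
assert (H := limC_plus _ _ _ _ _ FF (limC_const (at_left 1) L FF)
  (limC_plus _ _ _ _ _ FF (limC_opp _ _ _ FF I2) (limC_opp _ _ _ FF I1))).
revert H; apply filterlim_ext_loc.
generalize at_left_1_mem; apply filter_imp; intros u Hu.
assert (E := Li2_reflection u Hu); fold L in E; rewrite <- E.
rewrite ln_1, RtoC_mult; eqC; ring.
Qed.

Lemma Li2_span_Li2_1 (G : C -> Prop) :
  conj_closed G -> Li2_span G (2 * Li2 (1 / 2)%R + RtoC (ln (1 / 2) ^ 2)%R).
Proof.
intros HG.
assert (K : Qadjoin G (1 / 2)%R).
{ rewrite RtoC_div by lra; apply Qadjoin_div; [exact HG| |apply Qadjoin_1|].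
  - intros E; apply RtoC_inj in E; lra.
  - apply (Qadjoin_nat G 2). }
apply Li2_span_plus.
- replace (RtoC 2) with (RtoC (INR 2)) by (f_equal; simpl; ring).
  now apply Li2_span_nat, Li2_span_Li2.
- replace (RtoC (ln (1 / 2) ^ 2)%R) with (Clog (1 / 2)%R * Clog (1 / 2)%R).
  + apply Li2_span_Clog_mult; try easy; simpl; lra.
  + rewrite Clog_pos by lra; rewrite <- RtoC_mult; f_equal; ring.
Qed.

Lemma dilog_primitive_pow (G : C -> Prop) (p q : nat) :
  conj_closed G -> (0 < p)%nat -> (0 < q)%nat ->
  dilog_primitive G (fun u => RtoC (INR q * ln (1 - u ^ p) / u)%R) (fun _ => 0).
Proof.
intros HG Hp Hq; assert (Hp' := lt_0_INR p Hp).
set (c := (- (INR q / INR p))%R).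
set (T := fun u : R => c * Li2 (u ^ p)%R).
assert (FL : Filter (at_left 1)) by apply within_filter, locally_filter.
assert (FR : Filter (at_right 0)) by apply within_filter, locally_filter.
assert (DP : forall u, is_derive (fun s => s ^ p)%R u (INR p * u ^ pred p)%R).
{ intros u; auto_derive; [easy|ring]. }
exists T, (c * (2 * Li2 (1 / 2)%R + RtoC (ln (1 / 2) ^ 2)%R) + 0); split; [|split; [|split]].
- rewrite Cplus_0_r.
  replace (c * (2 * Li2 (1 / 2)%R + RtoC (ln (1 / 2) ^ 2)%R)) with
    (- (INR q * (2 * Li2 (1 / 2)%R + RtoC (ln (1 / 2) ^ 2)%R) / INR p)).
  + apply Li2_span_opp, Li2_span_div_nat; [exact Hp|].
    now apply Li2_span_nat, Li2_span_Li2_1.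
  + generalize (2 * Li2 (1 / 2)%R + RtoC (ln (1 / 2) ^ 2)%R); intros L.
    unfold c; rewrite RtoC_opp, RtoC_div by lra; field.
    intros E; apply RtoC_inj in E; lra.
- intros u Hu; assert (Hv := pow_lt_1 u p ltac:(lra) Hp).
  assert (Hv0 : 0 < u ^ p) by (apply pow_lt; lra).
  assert (N1 : RtoC (u ^ p)%R <> 0) by (intros E; apply RtoC_inj in E; lra).
  assert (D := is_deriveC_scal (RtoC c) _ _ _ (is_deriveC_Li2 (fun s => RtoC (s ^ p)%R) u _
    (RtoC_off_cut (u ^ p)%R ltac:(lra)) N1 (is_deriveC_RtoC _ _ _ (DP u)))).
  revert D; apply is_deriveC_eq.
  replace (1 - RtoC (u ^ p)%R) with (RtoC (1 - u ^ p)%R) by (rewrite RtoC_minus; ring).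
  rewrite Clog_pos by lra.
  rewrite <- RtoC_opp, <- RtoC_div, <- !RtoC_mult by lra; f_equal; unfold c.
  destruct p as [|p]; [lia|]; simpl pred.
  change (u ^ S p)%R with (u * u ^ p)%R in *.
  assert (u ^ p <> 0)%R by (apply pow_nonzero; lra).
  field; repeat split; lra.
- replace (RtoC 0) with (T 0%R).
  2: { unfold T; rewrite pow_i by lia; rewrite Li2_0; ring. }
  apply (limC_scal _ c (fun u => Li2 (u ^ p)%R)); [exact FR|].
  apply limC_within, (Li2_path_continuous (fun u => RtoC (u ^ p)%R) 0 (RtoC (INR p * 0 ^ pred p)%R)).
  + rewrite pow_i by lia; apply RtoC_off_cut; lra.
  + apply is_deriveC_RtoC, DP.
- apply limC_plus; [exact FL| |now apply limC_const].
  apply (limC_scal _ c (fun u => Li2 (u ^ p)%R)); [exact FL|].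
  apply (filterlim_comp _ _ _ (fun u => u ^ p)%R (fun v => Li2 v) _ (at_left 1)); [|exact Li2_lim_1].
  (* The limit at 1 is one-sided, so u^p must approach 1 from below: [C1] gives the approach and
     [pow_lt_1] the side. *)
  intros P HP.
  assert (C1 : continuous (fun s => s ^ p)%R 1).
  { apply (ex_derive_continuous (V := R_NormedModule)); eexists; apply DP. }
  unfold continuous in C1; rewrite pow1 in C1.
  specialize (C1 _ HP); unfold filtermap in C1 |- *.
  assert (C2 : at_left 1 (fun u : R => u ^ p < 1 -> P (u ^ p)%R)).
  { apply filter_le_within; exact C1. }
  generalize (filter_and _ _ C2 at_left_1_mem); apply filter_imp; intros u [H Hu].
  apply H, pow_lt_1; [lra|exact Hp].
Qed.

(** * Sums over roots of unity *)

Lemma Csum_ext (f g : nat -> C) (n : nat) :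
  (forall k, (k < n)%nat -> f k = g k) -> Csum f n = Csum g n.
Proof.
induction n as [|n IH]; intros H; simpl; [easy|].
rewrite IH, H by (try lia; intros; apply H; lia); easy.
Qed.

Lemma Csum_plus (f g : nat -> C) (n : nat) :
  Csum (fun k => f k + g k) n = Csum f n + Csum g n.
Proof. induction n as [|n IH]; simpl; [ring|rewrite IH; ring]. Qed.

Lemma Csum_scal (c : C) (f : nat -> C) (n : nat) :
  Csum (fun k => c * f k) n = c * Csum f n.
Proof. induction n as [|n IH]; simpl; [ring|rewrite IH; ring]. Qed.

Lemma Csum_0 (n : nat) : Csum (fun _ => 0) n = 0.
Proof. induction n as [|n IH]; simpl; [easy|rewrite IH; ring]. Qed.

Lemma Csum_const (c : C) (n : nat) : Csum (fun _ => c) n = INR n * c.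
Proof.
induction n as [|n IH]; [simpl; ring|].
rewrite S_INR, RtoC_plus; simpl Csum; rewrite IH; ring.
Qed.

Lemma Csum_exchange (f : nat -> nat -> C) (n m : nat) :
  Csum (fun j => Csum (fun k => f j k) m) n = Csum (fun k => Csum (fun j => f j k) n) m.
Proof.
induction n as [|n IH]; simpl; [now rewrite Csum_0|].
now rewrite IH, <- Csum_plus.
Qed.

Lemma Csum_first (f g : nat -> C) (n : nat) :
  (0 < n)%nat -> (forall k, f (S k) = g (S k)) -> Csum f n = Csum g n + (f O - g O).
Proof.
intros Hn H; destruct n as [|n]; [lia|]; clear Hn.
induction n as [|n IH]; [simpl; ring|].
change (Csum f (S (S n))) with (Csum f (S n) + f (S n)).
change (Csum g (S (S n))) with (Csum g (S n) + g (S n)).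
rewrite IH, H; ring.
Qed.

Lemma is_deriveC_Csum (f : nat -> R -> C) (df : nat -> C) (n : nat) (t : R) :
  (forall k, (k < n)%nat -> is_deriveC (f k) t (df k)) ->
  is_deriveC (fun s => Csum (fun k => f k s) n) t (Csum df n).
Proof.
induction n as [|n IH]; intros H; simpl; [apply is_deriveC_const|].
apply is_deriveC_plus; [apply IH; intros; apply H; lia|apply H; lia].
Qed.

Lemma limC_Csum (F : (R -> Prop) -> Prop) (f : nat -> R -> C) (l : nat -> C) (n : nat) :
  Filter F -> (forall k, (k < n)%nat -> limC F (f k) (l k)) ->
  limC F (fun u => Csum (fun k => f k u) n) (Csum l n).
Proof.
intros FF; induction n as [|n IH]; intros H; simpl; [now apply limC_const|].
apply limC_plus; [easy|apply IH; intros; apply H; lia|apply H; lia].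
Qed.

Definition cis (a : R) : C := (cos a, sin a).

Lemma cis_plus (a b : R) : cis (a + b) = cis a * cis b.
Proof.
unfold cis; rewrite cos_plus, sin_plus; apply injective_projections; simpl; ring.
Qed.

Lemma cis_0 : cis 0 = 1.
Proof. unfold cis; now rewrite cos_0, sin_0. Qed.

Lemma cis_pow (a : R) (n : nat) : cis a ^ n = cis (INR n * a).
Proof.
induction n as [|n IH]; [simpl; now rewrite Rmult_0_l, cis_0|].
rewrite Cpow_S, IH, <- cis_plus, S_INR; f_equal; ring.
Qed.

Lemma cis_2PI (n : nat) : cis (INR n * (2 * PI)) = 1.
Proof.
rewrite <- cis_pow; unfold cis; rewrite cos_2PI, sin_2PI.
change (1%R, 0%R) with (RtoC 1); apply Cpow_1_l.
Qed.

Lemma Cmod_cis (a : R) : Cmod (cis a) = 1%R.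
Proof.
unfold Cmod, cis; simpl fst; simpl snd.
replace (cos a ^ 2 + sin a ^ 2)%R with 1%R; [apply sqrt_1|].
assert (H := sin2_cos2 a); unfold Rsqr in H; simpl; lra.
Qed.

Lemma cis_neq1 (a : R) : 0 < a < 2 * PI -> cis a <> 1.
Proof.
intros Ha E; unfold cis in E; injection E; intros Hs Hc.
destruct (Rtotal_order a PI) as [H|[H|H]].
- assert (0 < sin a) by (apply sin_gt_0; lra); lra.
- rewrite H, cos_PI in Hc; lra.
- assert (sin a < 0) by (apply sin_lt_0; lra); lra.
Qed.

Lemma Cexp_cis (r : R) : Cexp (2 * PI * Ci * r) = cis (2 * PI * r).
Proof.
unfold Cexp, cis; simpl.
replace (((2 * PI - 0 * 0) * 0 - (2 * 0 + 0 * PI) * 1) * r -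
  ((2 * PI - 0 * 0) * 1 + (2 * 0 + 0 * PI) * 0) * 0)%R with 0%R by ring.
rewrite exp_0, !Rmult_1_l; f_equal; f_equal; ring.
Qed.

Definition zeta (n : nat) : C := cis (2 * PI / INR n).

Lemma zeta_pow_n (n : nat) : (0 < n)%nat -> zeta n ^ n = 1.
Proof.
intros Hn; assert (H := lt_0_INR n Hn); unfold zeta; rewrite cis_pow.
replace (INR n * (2 * PI / INR n))%R with (INR 1 * (2 * PI))%R by (simpl; field; lra).
apply cis_2PI.
Qed.

Lemma zeta_pow_neq1 (n j : nat) : (0 < j < n)%nat -> zeta n ^ j <> 1.
Proof.
intros Hj; assert (H := lt_0_INR n ltac:(lia)); assert (H1 := lt_0_INR j ltac:(lia)).
assert (H2 : INR j < INR n) by (apply lt_INR; lia).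
assert (HP := PI_RGT_0).
unfold zeta; rewrite cis_pow; apply cis_neq1.
replace (INR j * (2 * PI / INR n))%R with (INR j / INR n * (2 * PI))%R by (field; lra).
assert (0 < INR j / INR n < 1).
{ split; [apply Rdiv_lt_0_compat; lra|].
  apply Rmult_lt_reg_r with (INR n); [easy|].
  replace (INR j / INR n * INR n)%R with (INR j) by (field; lra); lra. }
split; nra.
Qed.

Lemma Cmod_zeta_pow (n j : nat) : Cmod (zeta n ^ j) = 1%R.
Proof. unfold zeta; rewrite cis_pow; apply Cmod_cis. Qed.

Lemma Csum_geom (z : C) (n : nat) : (1 - z) * Csum (fun k => z ^ k) n = 1 - z ^ n.
Proof.
induction n as [|n IH]; [simpl; ring|].
rewrite Cpow_S; simpl Csum; rewrite Cmult_plus_distr_l, IH; ring.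
Qed.

Lemma Csum_geom_root (z : C) (n : nat) : z ^ n = 1 -> z <> 1 -> Csum (fun k => z ^ k) n = 0.
Proof.
intros Hz Hn; assert (H := Csum_geom z n); rewrite Hz in H.
assert (N := Cminus_neq0 1 z ltac:(congruence)).
replace (Csum (fun k => z ^ k) n) with ((1 - z) * Csum (fun k => z ^ k) n / (1 - z))
  by (field; exact N).
rewrite H; field; exact N.
Qed.

(** Orthogonality of characters, with exponents running over 1, ..., n as they occur in the partial
    fractions. *)
Lemma Csum_zeta_pow (n k : nat) :
  (0 < k <= n)%nat ->
  Csum (fun j => (zeta n ^ j) ^ k) n = if Nat.eq_dec k n then RtoC (INR n) else 0.
Proof.
intros Hk; destruct (Nat.eq_dec k n) as [->|Hn].
- rewrite (Csum_ext _ (fun _ => 1)), Csum_const; [ring|].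
  intros j _; rewrite <- Cpow_mult_r, Nat.mul_comm, Cpow_mult_r, zeta_pow_n by lia.
  apply Cpow_1_l.
- rewrite (Csum_ext _ (fun j => (zeta n ^ k) ^ j)).
  + apply Csum_geom_root; [|apply zeta_pow_neq1; lia].
    rewrite <- Cpow_mult_r, Nat.mul_comm, Cpow_mult_r, zeta_pow_n by lia; apply Cpow_1_l.
  + intros j _; rewrite <- !Cpow_mult_r; f_equal; lia.
Qed.

(** For y^n = 1 the geometric series closes up: y/(1-yu) is the sum of u^k y^(k+1) over k < n,
    divided by 1-u^n. Summing over the roots y leaves only k+1 = n. *)
Lemma zeta_partial_fractions (n : nat) (u : R) :
  (0 < n)%nat -> 0 <= u < 1 ->
  Csum (fun j => zeta n ^ j / (1 - zeta n ^ j * u)) n =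
  RtoC (INR n * u ^ pred n / (1 - u ^ n))%R.
Proof.
intros Hn Hu; assert (Hv := pow_lt_1 u n Hu Hn).
assert (Nv : 1 - RtoC (u ^ n)%R <> 0).
{ rewrite <- RtoC_minus; intros E; apply RtoC_inj in E; lra. }
set (z := zeta n).
assert (T : forall j, z ^ j / (1 - z ^ j * u) =
  / (1 - RtoC (u ^ n)%R) * Csum (fun k => RtoC (u ^ k)%R * (z ^ j) ^ S k) n).
{ intros j; set (y := z ^ j).
  assert (Hy : Cmod y = 1%R) by apply Cmod_zeta_pow.
  assert (N1 := off_neg_neq0 _ (off_neg_right _ (right_of_unit y u Hy Hu))).
  rewrite (Csum_ext _ (fun k => y * (y * u) ^ k)), Csum_scal.
  2: { intros k _; rewrite Cpow_mult_l, <- RtoC_pow, Cpow_S; ring. }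
  assert (E := Csum_geom (y * u) n).
  rewrite Cpow_mult_l, <- RtoC_pow in E.
  replace (y ^ n) with (RtoC 1) in E.
  2: { unfold y, z; rewrite <- Cpow_mult_r, Nat.mul_comm, Cpow_mult_r, zeta_pow_n by lia.
       now rewrite Cpow_1_l. }
  rewrite Cmult_1_l in E.
  transitivity (y / (1 - y * u) * / (1 - RtoC (u ^ n)%R) *
    ((1 - y * u) * Csum (fun k => (y * u) ^ k) n));
    [rewrite E|change (Csum (Cpow (y * u)) n) with (Csum (fun k => (y * u) ^ k) n)];
    field; split; assumption. }
rewrite (Csum_ext _ _ n (fun j _ => T j)), Csum_scal, Csum_exchange.
rewrite (Csum_ext _ (fun k => RtoC (u ^ k)%R * if Nat.eq_dec (S k) n then RtoC (INR n) else 0)).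
2: { intros k Hk; rewrite Csum_scal; f_equal; apply Csum_zeta_pow; lia. }
destruct n as [|n]; [lia|]; simpl pred; cbn [Csum].
rewrite (Csum_ext _ (fun _ => 0)), Csum_0.
2: { intros k Hk; destruct (Nat.eq_dec (S k) (S n)); [lia|ring]. }
destruct (Nat.eq_dec (S n) (S n)) as [_|]; [|easy].
rewrite RtoC_div, RtoC_mult, RtoC_minus by lra; field; exact Nv.
Qed.

(** The factorization of 1-u^n over the roots of unity, in logarithmic form. Derivatives agree by
    partial fractions, and since both sides vanish at 0 the principal branches add up exactly. *)
Lemma zeta_log_sum (n : nat) (u : R) :
  (0 < n)%nat -> 0 <= u < 1 ->
  Csum (fun j => Clog (1 - zeta n ^ j * u)) n = RtoC (ln (1 - u ^ n)).
Proof.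
intros Hn Hu.
set (f := fun t : R => Csum (fun j => Clog (1 - zeta n ^ j * t)) n - RtoC (ln (1 - t ^ n))).
assert (E : f u = f 0%R).
{ apply is_deriveC_constant; [lra|]; intros t Ht.
  assert (Hv := pow_lt_1 t n ltac:(lra) Hn).
  apply is_deriveC_eq with (Csum (fun j => (- 1) * (zeta n ^ j / (1 - zeta n ^ j * t))) n
    - RtoC (- (INR n * t ^ pred n / (1 - t ^ n)))%R).
  - rewrite Csum_scal, zeta_partial_fractions by (try easy; lra).
    rewrite RtoC_opp; ring.
  - apply is_deriveC_minus.
    + apply (is_deriveC_Csum (fun j t => Clog (1 - zeta n ^ j * t))
        (fun j => (- 1) * (zeta n ^ j / (1 - zeta n ^ j * t)))).
      intros j _; apply is_deriveC_eq with (- zeta n ^ j / (1 - zeta n ^ j * t)).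
      * unfold Cdiv; ring.
      * apply is_deriveC_Clog_linear, right_of_unit; [apply Cmod_zeta_pow|lra].
    + apply is_deriveC_RtoC; auto_derive; [lra|].
      unfold Rminus; field; lra. }
assert (E0 : f 0%R = 0).
{ unfold f; rewrite pow_i, Rminus_0_r, ln_1 by lia.
  rewrite (Csum_ext _ (fun _ => 0)), Csum_0; [ring|].
  intros j _; rewrite Cmult_0_r; replace (1 - 0) with (RtoC 1) by ring; apply Clog_1. }
rewrite E0 in E; unfold f in E.
replace (Csum (fun j => Clog (1 - zeta n ^ j * u)) n) with
  (Csum (fun j => Clog (1 - zeta n ^ j * u)) n - RtoC (ln (1 - u ^ n)) + RtoC (ln (1 - u ^ n)))
  by ring.
rewrite E; ring.
Qed.

(** Without the root 1 the sum of logarithms is ln((1-u^n)/(1-u)) = ln(1 + u + ... + u^(n-1)), which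
    tends to ln n as u goes to 1. *)
Lemma zeta_log_sum_1 (n : nat) :
  (0 < n)%nat ->
  Csum (fun j => match j with O => 0 | S _ => Clog (1 - zeta n ^ j) end) n = RtoC (ln (INR n)).
Proof.
intros Hn; assert (Hn' := lt_0_INR n Hn).
set (g := fun (u : R) (j : nat) => match j return C with O => 0 | S _ => Clog (1 - zeta n ^ j * u) end).
apply (limC_unique (at_left 1) (fun u => Csum (g u) n)); [apply at_left_proper_filter| |].
- apply (limC_Csum (at_left 1) (fun j u => g u j)); [apply at_left_proper_filter|].
  intros j Hj; destruct j as [|j]; [exact (limC_const (at_left 1) 0 _)|].
  apply limC_within.
  assert (R1 : 0 < Re (1 - zeta n ^ S j * 1%R)).
  { apply right_of_unit_neq1; [apply Cmod_zeta_pow|apply zeta_pow_neq1; lia|lra]. }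
  assert (L := is_deriveC_continuous _ _ _ (is_deriveC_Clog_linear (zeta n ^ S j) 1 R1)).
  cbv beta in L; rewrite Cmult_1_r in L; exact L.
- assert (HS : Rsum (fun k => 1 ^ k)%R n = INR n).
  { rewrite (Rsum_ext _ (fun _ => 1%R)), Rsum_const by (intros; apply pow1); ring. }
  assert (L : limC (at_left 1) (fun u => RtoC (ln (Rsum (fun k => u ^ k)%R n))) (RtoC (ln (INR n)))).
  { rewrite <- HS; apply limC_within.
    assert (D : is_derive (fun u => Rsum (fun k => u ^ k)%R n) 1
      (Rsum (fun k => INR k * 1 ^ pred k)%R n)).
    { apply (is_derive_Rsum (fun k u => u ^ k)%R (fun k u => INR k * u ^ pred k)%R).
      intros k _; auto_derive; [easy|ring]. }
    apply (is_deriveC_continuous (fun u => RtoC (ln (Rsum (fun k => u ^ k)%R n))) 1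
      (RtoC (scal (Rsum (fun k => INR k * 1 ^ pred k)%R n) (/ INR n))%R)).
    apply is_deriveC_RtoC, (is_derive_comp ln (fun u => Rsum (fun k => u ^ k)%R n)); [|exact D].
    rewrite HS; apply is_derive_ln; exact Hn'. }
  revert L; apply filterlim_ext_loc.
  generalize at_left_1_mem; apply filter_imp; intros u Hu.
  assert (E := zeta_log_sum n u Hn ltac:(lra)).
  rewrite (Csum_first (fun j => Clog (1 - zeta n ^ j * u)) (g u) n Hn (fun k => eq_refl)) in E.
  unfold g at 2 in E; simpl Cpow in E; rewrite Clog_one_sub in E by lra.
  assert (Hv := pow_lt_1 u n ltac:(lra) Hn).
  assert (EG := Rsum_geom u n).
  replace (Rsum (fun k => u ^ k)%R n) with ((1 - u ^ n) / (1 - u))%R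
    by (rewrite <- EG; field; lra).
  rewrite ln_div, RtoC_minus, <- E by lra; eqC; ring.
Qed.

Lemma dilog_primitive_roots (G : C -> Prop) (p q j k : nat) :
  conj_closed G -> Qadjoin G (zeta p) -> Qadjoin G (zeta q) -> (j < p)%nat -> (k < q)%nat ->
  dilog_primitive G
    (fun u => Clog (1 - zeta p ^ j * u) * (zeta q ^ k / (1 - zeta q ^ k * u)))
    (fun u => match k, j with
              | O, O => RtoC (ln (1 - u) ^ 2 / 2)%R
              | O, S _ => Clog (1 - zeta p ^ j) * RtoC (ln (1 - u))
              | S _, _ => 0
              end).
Proof.
intros HG Kp Kq Hj Hk.
destruct k as [|k], j as [|j].
- apply dilog_primitive_11.
- apply dilog_primitive_z1; try easy.
  + now apply Qadjoin_pow.
  + apply Cmod_zeta_pow.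
  + apply zeta_pow_neq1; lia.
- apply dilog_primitive_1w; try easy.
  + now apply Qadjoin_pow.
  + apply Cmod_zeta_pow.
  + apply zeta_pow_neq1; lia.
- assert (N1 : zeta p ^ S j <> 1) by (apply zeta_pow_neq1; lia).
  assert (N2 : zeta q ^ S k <> 1) by (apply zeta_pow_neq1; lia).
  destruct (Ceq_dec (zeta p ^ S j) (zeta q ^ S k)) as [E|E].
  + rewrite <- E in *; apply dilog_primitive_diag; try easy.
    * now apply Qadjoin_pow.
    * apply Cmod_zeta_pow.
  + apply dilog_primitive_generic; try easy; try apply Cmod_zeta_pow; now apply Qadjoin_pow.
Qed.

(** Here q/(u(1-u^q)) = q/u + q u^(q-1)/(1-u^q). The first part leads to Li2(u^p); in the second
    both the fraction and ln(1-u^p) split over roots of unity. *)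
Lemma dilog_primitive_herglotz (G : C -> Prop) (p q : nat) :
  conj_closed G -> Qadjoin G (zeta p) -> Qadjoin G (zeta q) -> (0 < p)%nat -> (0 < q)%nat ->
  dilog_primitive G (fun u => RtoC (INR q * ln (1 - u ^ p) / (u * (1 - u ^ q)))%R)
    (fun u => RtoC (ln (1 - u) ^ 2 / 2 + ln (INR p) * ln (1 - u))%R).
Proof.
intros HG Kp Kq Hp Hq.
assert (D := dilog_primitive_plus _ _ _ _ _ (dilog_primitive_pow G p q HG Hp Hq)
  (dilog_primitive_sum G _ _ p (fun j Hj =>
     dilog_primitive_sum G _ _ q (fun k Hk => dilog_primitive_roots G p q j k HG Kp Kq Hj Hk)))).
revert D; apply dilog_primitive_ext; intros u Hu; cbv beta.
- rewrite (Csum_ext _ (fun j => RtoC (INR q * u ^ pred q / (1 - u ^ q))%R *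
    Clog (1 - zeta p ^ j * u))).
  2: { intros j _; rewrite Csum_scal, zeta_partial_fractions by (try easy; lra); ring. }
  rewrite Csum_scal, zeta_log_sum by (try easy; lra).
  assert (Hv := pow_lt_1 u q ltac:(lra) Hq).
  rewrite <- RtoC_mult, <- RtoC_plus; f_equal.
  destruct q as [|q]; [lia|]; simpl pred.
  change (u ^ S q)%R with (u * u ^ q)%R in *; field; lra.
(* Only the root 1 among the q-th roots diverges. It contributes the squared logarithm for j = 0,
   and the other j add up to ln p by [zeta_log_sum_1]. *)
- rewrite (Csum_ext _ (fun j => match j with O => RtoC (ln (1 - u) ^ 2 / 2)%R
    | S _ => Clog (1 - zeta p ^ j) * RtoC (ln (1 - u)) end)).
  2: { intros j _; rewrite (Csum_first _ (fun _ => 0) q Hq) by reflexivity; rewrite Csum_0.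
       destruct j; ring. }
  rewrite (Csum_first _ (fun j => RtoC (ln (1 - u)) *
    match j with O => 0 | S _ => Clog (1 - zeta p ^ j) end) p Hp).
  2: { intros j; ring. }
  rewrite Csum_scal, zeta_log_sum_1 by easy.
  rewrite RtoC_plus, RtoC_mult; ring.
Qed.

(** Im T has derivative 0 on (0, 1) and limit 0 at 0, so T and its constant are real. This is the
    form that [herglotz_diff] takes as input. *)
Lemma dilog_primitive_real (G : C -> Prop) (h c : R -> R) :
  dilog_primitive G (fun u => RtoC (h u)) (fun u => RtoC (c u)) ->
  exists (A : R -> R) (k : R),
    Li2_span G k /\ (forall u, 0 < u < 1 -> is_derive A u (h u)) /\
    filterlim A (at_right 0) (locally 0%R) /\
    filterlim (fun u => A u + c u)%R (at_left 1) (locally k).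
Proof.
intros [T [k [Hk [HD [H0 H1]]]]].
assert (FR : ProperFilter (at_right 0)) by apply at_right_proper_filter.
assert (FL : ProperFilter (at_left 1)) by apply at_left_proper_filter.
assert (I0 : forall u, 0 < u < 1 -> Im (T u) = 0%R).
{ intros u Hu.
  assert (L := limC_Im _ _ _ _ H0).
  assert (L' : filterlim (fun s => Im (T s)) (at_right 0) (locally (Im (T u)))).
  { apply filterlim_ext_loc with (fun _ => Im (T u)); [|apply filterlim_const].
    assert (M : at_right 0 (fun s => 0 < s < u)).
    { exists (mkposreal u (proj1 Hu)); intros s Hs Hl.
      change (Rabs (s - 0) < u) in Hs; apply Rabs_def2 in Hs; lra. }
    revert M; apply filter_imp; intros s Hs.
    assert (B := mean_value_bound (fun s => Im (T s)) (fun _ => 0%R) (fun _ => 0%R) (fun _ => 0%R)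
      s u ltac:(lra) (fun t Ht => proj2 (HD t ltac:(lra)))
      (fun t _ => is_derive_const (K := R_AbsRing) (V := R_NormedModule) 0%R t)
      (fun t _ => Req_le _ _ Rabs_R0)).
    assert (B' := Rabs_pos (Im (T u) - Im (T s))).
    assert (E : (Im (T u) - Im (T s) = 0)%R) by (apply Rabs_eq_0; lra); lra. }
  exact (filterlim_locally_unique _ _ _ L' L). }
assert (Ik : Im k = 0%R).
{ assert (L := limC_Im _ _ _ _ H1).
  assert (L' : filterlim (fun u => Im (T u + RtoC (c u))) (at_left 1) (locally 0%R)).
  { apply filterlim_ext_loc with (fun _ => 0%R); [|apply filterlim_const].
    generalize at_left_1_mem; apply filter_imp; intros u Hu.
    rewrite im_plus, I0 by easy; simpl; ring. }
  exact (filterlim_locally_unique _ _ _ L L'). }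
exists (fun u => Re (T u)), (Re k); split; [|split; [|split]].
- replace (RtoC (Re k)) with k; [exact Hk|].
  apply injective_projections; [reflexivity|exact Ik].
- intros u Hu; exact (proj1 (HD u Hu)).
- exact (limC_Re _ _ _ _ H0).
- generalize (limC_Re _ _ _ _ H1); apply filterlim_ext; intros u; now rewrite re_plus.
Qed.

(** * The generators as roots of unity, and the assembly *)

Lemma unit_root_conj (z : C) (n : nat) :
  (0 < n)%nat -> Cmod z = 1%R -> z ^ n = 1 -> Cconj z = z ^ pred n.
Proof.
intros Hn Hz H; destruct n as [|n]; [lia|]; simpl pred; rewrite Cpow_S in H.
assert (E := Cmod2_conj z); rewrite Hz, pow1 in E.
replace (Cconj z) with (Cconj z * (z * z ^ n)) by (rewrite H; ring).
replace (Cconj z * (z * z ^ n)) with (z * Cconj z * z ^ n) by ring.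
rewrite <- E; ring.
Qed.

Lemma cis_rat_pow (p q : nat) : (0 < q)%nat -> cis (2 * PI * (INR p / INR q)) ^ q = 1.
Proof.
intros Hq; assert (H := lt_0_INR q Hq); rewrite cis_pow.
replace (INR q * (2 * PI * (INR p / INR q)))%R with (INR p * (2 * PI))%R by (field; lra).
apply cis_2PI.
Qed.

(** Bezout: if ap = 1 + bq, then ap/q and 1/q differ by the integer b. *)
Lemma zeta_power_of_coprime (p q : nat) :
  (0 < p)%nat -> (0 < q)%nat -> Nat.gcd p q = 1%nat ->
  exists a : nat, zeta q = cis (2 * PI * (INR p / INR q)) ^ a.
Proof.
intros Hp Hq Hg; destruct (Nat.gcd_bezout_pos p q Hp) as [a [b E]]; rewrite Hg in E.
exists a; assert (H := lt_0_INR q Hq); rewrite cis_pow; unfold zeta.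
apply (f_equal INR) in E; rewrite mult_INR, plus_INR, mult_INR in E; simpl (INR 1) in E.
replace (INR a * (2 * PI * (INR p / INR q)))%R with (2 * PI / INR q + INR b * (2 * PI))%R.
- rewrite cis_plus, cis_2PI; ring.
- replace (INR a * (2 * PI * (INR p / INR q)))%R with (2 * PI * (INR a * INR p) / INR q)%R
    by (field; lra).
  rewrite E; field; lra.
Qed.

Lemma Qpos_reduced (x : Q) :
  (0 < x)%Q -> exists p q : nat,
    (0 < p)%nat /\ (0 < q)%nat /\ Nat.gcd p q = 1%nat /\ Q2R x = (INR p / INR q)%R.
Proof.
intros Hx.
assert (Hr : (0 < Qred x)%Q) by (rewrite Qred_correct; exact Hx).
assert (E : Q2R x = Q2R (Qred x)) by (apply Qeq_eqR; symmetry; apply Qred_correct).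
assert (Hg : Z.gcd (Qnum (Qred x)) (Zpos (Qden (Qred x))) = 1%Z).
{ destruct x as [a b]; unfold Qred.
  assert (G := Z.ggcd_gcd a (Zpos b)); assert (D := Z.ggcd_correct_divisors a (Zpos b)).
  destruct (Z.ggcd a (Zpos b)) as [g [aa bb]]; simpl in G, D |- *; destruct D as [D1 D2].
  assert (Hg0 : (0 < g)%Z).
  { assert (0 <= g)%Z by (rewrite G; apply Z.gcd_nonneg).
    assert (g <> 0)%Z by (intros ->; lia); lia. }
  assert (Hbb : (0 < bb)%Z) by nia.
  rewrite Z2Pos.id by easy.
  apply (Z.mul_reg_l _ _ g); [lia|].
  rewrite <- Z.gcd_mul_mono_l_nonneg by lia; rewrite <- D1, <- D2; lia. }
rewrite E; destruct (Qred x) as [a b]; unfold Qlt in Hr; simpl in Hr, Hg.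
exists (Z.to_nat a), (Pos.to_nat b).
assert (Ha : (0 < a)%Z) by lia.
split; [lia|split; [lia|split]].
- set (g := Nat.gcd (Z.to_nat a) (Pos.to_nat b)).
  destruct (Nat.gcd_divide_l (Z.to_nat a) (Pos.to_nat b)) as [k Hk]; fold g in Hk.
  destruct (Nat.gcd_divide_r (Z.to_nat a) (Pos.to_nat b)) as [l Hl]; fold g in Hl.
  assert (D : (Z.of_nat g | Z.gcd a (Zpos b))%Z).
  { apply Z.gcd_greatest; [exists (Z.of_nat k)|exists (Z.of_nat l)]; lia. }
  rewrite Hg in D; apply Z.divide_1_r_nonneg in D; lia.
- unfold Q2R; simpl; rewrite !INR_IZR_INZ, Z2Nat.id, positive_nat_Z by lia; reflexivity.
Qed.

Theorem theorem3 (x : Q) (hx : (0 < x)%Q) :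
  Qspan
    (fun v : C => exists alpha : C,
       Qadjoin
         (fun z : C => z = Cexp (2 * PI * Ci * Q2R x) \/
                       z = Cexp (2 * PI * Ci / Q2R x))
         alpha /\
       v = Li2 alpha)
    (Herglotz_F (Q2R x) - Herglotz_F 1).
Proof.
destruct (Qpos_reduced x hx) as [p [q [Hp [Hq [Hg Ex]]]]].
assert (Hp' := lt_0_INR p Hp); assert (Hq' := lt_0_INR q Hq).
set (G := fun z : C => z = Cexp (2 * PI * Ci * Q2R x) \/ z = Cexp (2 * PI * Ci / Q2R x)).
change (Li2_span G (Herglotz_F (Q2R x) - Herglotz_F 1)).
assert (E1 : Cexp (2 * PI * Ci * Q2R x) = cis (2 * PI * (INR p / INR q))).
{ rewrite Cexp_cis, Ex; reflexivity. }
assert (E2 : Cexp (2 * PI * Ci / Q2R x) = cis (2 * PI * (INR q / INR p))).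
{ rewrite <- Cexp_cis, Ex; f_equal; unfold Cdiv; f_equal.
  rewrite <- RtoC_inv by (apply Rgt_not_eq, Rdiv_lt_0_compat; lra).
  f_equal; field; lra. }
assert (G1 : Qadjoin G (cis (2 * PI * (INR p / INR q)))) by (apply Qadjoin_gen; left; now rewrite E1).
assert (G2 : Qadjoin G (cis (2 * PI * (INR q / INR p)))) by (apply Qadjoin_gen; right; now rewrite E2).
(* The generators are a q-th and a p-th root of unity, so their conjugates are powers of them. *)
assert (HG : conj_closed G).
{ intros z [Hz|Hz]; rewrite Hz; [rewrite E1|rewrite E2].
  - rewrite (unit_root_conj _ q) by (try easy; try apply Cmod_cis; now apply cis_rat_pow).
    now apply Qadjoin_pow.
  - rewrite (unit_root_conj _ p) by (try easy; try apply Cmod_cis; now apply cis_rat_pow).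
    now apply Qadjoin_pow. }
assert (Kq : Qadjoin G (zeta q)).
{ destruct (zeta_power_of_coprime p q Hp Hq Hg) as [a ->]; now apply Qadjoin_pow. }
assert (Kp : Qadjoin G (zeta p)).
{ rewrite Nat.gcd_comm in Hg.
  destruct (zeta_power_of_coprime q p Hq Hp Hg) as [a ->]; now apply Qadjoin_pow. }
assert (K1 : Qadjoin G (zeta 1)).
{ replace (zeta 1) with (RtoC 1); [apply Qadjoin_1|].
  rewrite <- (zeta_pow_n 1), Cpow_1_r by lia; reflexivity. }
destruct (dilog_primitive_real _ _ _ (dilog_primitive_herglotz G p q HG Kp Kq Hp Hq))
  as [A [k [Sk [DA [LA KA]]]]].
destruct (dilog_primitive_real _ _ _ (dilog_primitive_herglotz G 1 1 HG K1 K1 Nat.lt_0_1 Nat.lt_0_1))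
  as [A1 [k1 [Sk1 [DA1 [LA1 KA1]]]]].
assert (D : (herglotzR (INR p / INR q) - herglotzR (INR 1 / INR 1) =
  k - k1 + ln (INR p) ^ 2 / 2)%R).
{ apply (herglotz_diff p q A A1 k k1); try easy.
  - revert KA; apply filterlim_ext; intros u; ring.
  - revert KA1; apply filterlim_ext; intros u; ring. }
rewrite Ex, (Herglotz_F_pos_rat p q) by easy.
replace (RtoC 1) with (RtoC (INR 1 / INR 1)%R) by (f_equal; simpl; field).
rewrite (Herglotz_F_pos_rat 1 1), <- RtoC_minus, D by lia.
rewrite RtoC_plus, RtoC_minus; apply Li2_span_plus; [now apply Li2_span_minus|].
rewrite RtoC_div by lra; apply Li2_span_half.
(* The remaining (ln p)^2 is a product of logarithms of a positive integer of the field. *)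
replace (RtoC (ln (INR p) ^ 2)%R) with (Clog (INR p) * Clog (INR p)).
- apply Li2_span_Clog_mult; try easy; apply Qadjoin_nat.
- rewrite Clog_pos by easy; rewrite <- RtoC_mult; f_equal; ring.
Qed.
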